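(* Let $\mathfrak{g}(\infty)$ be $\mathfrak{o}(\infty)$ or $\mathfrak{sp}(\infty)$. Then every primitive ideal $I\subset U(\mathfrak{g}(\infty))$ is weakly bounded. Moreover, every primitive ideal of $U(\mathfrak{o}(\infty))$ is locally integrable.
   Context: For $n\ge 1$, $\mathfrak{o}(2n)$ (resp. $\mathfrak{sp}(2n)$) is the Lie algebra of complex $2n\times2n$ matrices $X$ (indices $-n,\dots,-1,1,\dots,n$) with $XF+FX^t=0$, where $F$ is antidiagonal with all antidiagonal entries $1$ (resp. entries $1$ in rows $-n,\dots,-1$ and $-1$ in rows $1,\dots,n$). $\mathfrak{g}(2n)$ denotes $\mathfrak{o}(2n)$ or $\mathfrak{sp}(2n)$, embedded into $\mathfrak{g}(2n+2)$ by bordering with zeros, and $\mathfrak{g}(\infty)=\varinjlim\mathfrak{g}(2n)$. The diagonal matrices form a Cartan subalgebra of $\mathfrak{g}(2n)$; a weight module is bounded if its weight spaces have uniformly bounded dimension. A primitive ideal is the annihilator of a simple module. An ideal $I\subset U(\mathfrak{g}(\infty))$ is weakly bounded if for every $n\ge2$, $I\cap U(\mathfrak{g}(2n))$ is an intersection of annihilators of bounded weight $\mathfrak{g}(2n)$-modules; it is locally integrable if for every $n$, $I\cap U(\mathfrak{g}(2n))$ is an intersection of two-sided ideals of finite codimension in $U(\mathfrak{g}(2n))$. *)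

(* Defs.v *)
From Stdlib Require List.
From HB Require Import structures.
From mathcomp Require Import all_boot all_order all_algebra all_field.
From mathcomp Require Import complex reals.
Set Implicit Arguments. Unset Strict Implicit. Unset Printing Implicit Defensive.
Import Order.TTheory GRing.Theory Num.Theory.
Local Open Scope ring_scope.

Section LieDefs.
Variable R : realType.
Local Notation C := R[i].

(* Matrices indexed by Z; only indices -n..-1,1..n are used for g(2n). *)
Definition gmat := int -> int -> C.

Variant kind := KO | KSp.

(* diagonal entries of the antidiagonal form F: F_{i,-i} = fF i *)
Definition fF (k : kind) (i : int) : C :=
  match k with KO => 1 | KSp => if (i < 0)%R then 1 else -1 end.

(* X belongs to g(2n) (indices -n..-1,1..n, X F + F X^t = 0) *)
Definition in_g (k : kind) (n : nat) (X : gmat) : Prop :=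
  (forall i j : int, X i j != 0 ->
     [&& i != 0, j != 0, (absz i <= n)%N & (absz j <= n)%N]) /\
  (forall i j : int, X i (- j) * fF k (- j) + fF k i * X j (- i) = 0).

Definition in_h (k : kind) (n : nat) (H : gmat) : Prop :=
  in_g k n H /\ (forall i j : int, i != j -> H i j = 0).

Definition gcomb (a : C) (X Y : gmat) : gmat := fun i j => a * X i j + Y i j.

Definition lie (N : nat) (X Y : gmat) : gmat := fun i j =>
  \sum_(k < (N + N).+1)
    (X i (k%:Z - N%:Z) * Y (k%:Z - N%:Z) j - Y i (k%:Z - N%:Z) * X (k%:Z - N%:Z) j).

(* A representation of the Lie algebra  g_D = union_{m, D m} g(2m).
   For g(2n): D m := (m <= n); for g(infinity): D m := True. *)
Record lie_rep (k : kind) (D : nat -> Prop) := LieRep {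
  rV : lmodType C;
  ract : gmat -> rV -> rV;
  ract_linV : forall X (a : C) (v w : rV),
      ract X (a *: v + w) = a *: ract X v + ract X w;
  ract_linX : forall m, D m -> forall (a : C) X Y, in_g k m X -> in_g k m Y ->
      forall v, ract (gcomb a X Y) v = a *: ract X v + ract Y v;
  ract_bracket : forall m, D m -> forall X Y, in_g k m X -> in_g k m Y ->
      forall v, ract (lie m X Y) v = ract X (ract Y v) - ract Y (ract X v)
}.
Arguments ract {k D} l : rename.

(* Elements of the universal enveloping algebra, presented as formal
   noncommutative expressions in Lie algebra elements. *)
Inductive uterm :=
  | UGen of gmat
  | UScal of C
  | UAdd of uterm & uterm
  | UMul of uterm & uterm.

Fixpoint term_in (k : kind) (n : nat) (t : uterm) : Prop :=
  match t with
  | UGen X => in_g k n X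
  | UScal _ => True
  | UAdd s u => term_in k n s /\ term_in k n u
  | UMul s u => term_in k n s /\ term_in k n u
  end.

Fixpoint ueval k D (M : lie_rep k D) (t : uterm) (v : rV M) : rV M :=
  match t with
  | UGen X => ract M X v
  | UScal c => c *: v
  | UAdd s u => ueval s v + ueval u v
  | UMul s u => ueval s (ueval u v)
  end.
Arguments ueval {k D} M t v.

Definition Ann k D (M : lie_rep k D) (t : uterm) : Prop :=
  forall v, ueval M t v = 0.

Definition ginf_rep (k : kind) := lie_rep k (fun _ => True).
Definition gn_rep (k : kind) (n : nat) := lie_rep k (fun m => (m <= n)%N).

Definition simple_rep k (M : ginf_rep k) : Prop :=
  (exists v : rV M, v != 0) /\
  forall S : rV M -> Prop,
    (forall v w, S v -> S w -> S (v + w)) ->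
    (forall (a : C) v, S v -> S (a *: v)) ->
    (forall n X v, in_g k n X -> S v -> S (ract M X v)) ->
    (exists v, S v /\ v != 0) -> forall w, S w.

Definition lin_indep (V : lmodType C) (s : seq V) : Prop :=
  forall c : seq C, size c = size s ->
    \sum_(i < size s) c`_i *: nth 0 s i = 0 -> forall i, c`_i = 0.

Definition weight_vec k n (M : gn_rep k n) (lam : gmat -> C) (v : rV M) : Prop :=
  forall H, in_h k n H -> ract M H v = lam H *: v.
Arguments weight_vec {k n} M lam v.

Definition weight_module k n (M : gn_rep k n) : Prop :=
  forall v : rV M, exists s : seq ((gmat -> C) * rV M),
    (forall p, List.In p s -> weight_vec M p.1 p.2) /\
    v = \sum_(p <- s) p.2.

Definition bounded_dims k n (M : gn_rep k n) : Prop :=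
  exists d : nat, forall lam (s : seq (rV M)),
    (forall v, List.In v s -> weight_vec M lam v) -> lin_indep s ->
    (size s <= d)%N.

Definition bounded_weight k n (M : gn_rep k n) : Prop :=
  weight_module M /\ bounded_dims M.

Definition restr (k : kind) (n : nat) (I : uterm -> Prop) (t : uterm) : Prop :=
  term_in k n t /\ I t.

Definition weakly_bounded (k : kind) (I : uterm -> Prop) : Prop :=
  forall n : nat, (2 <= n)%N ->
    exists (J : Type) (M : J -> gn_rep k n),
      (forall j, bounded_weight (M j)) /\
      (forall t, restr k n I t <-> (term_in k n t /\ forall j, Ann (M j) t)).

(* A two-sided ideal of U(g(2n)) of finite codimension: the kernel of the
   algebra homomorphism U(g(2n)) -> A induced (universal property) by a Lie
   homomorphism g(2n) -> A into a finite-dimensional algebra A. *)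
Record fin_codim_ideal (k : kind) (n : nat) := FCI {
  fA : falgType C;
  fphi : gmat -> fA;
  fphi_lin : forall (a : C) X Y, in_g k n X -> in_g k n Y ->
      fphi (gcomb a X Y) = a *: fphi X + fphi Y;
  fphi_bracket : forall X Y, in_g k n X -> in_g k n Y ->
      fphi (lie n X Y) = fphi X * fphi Y - fphi Y * fphi X
}.
Arguments fphi {k n} f : rename.

Fixpoint aeval k n (J : fin_codim_ideal k n) (t : uterm) : fA J :=
  match t with
  | UGen X => fphi J X
  | UScal c => c%:A
  | UAdd s u => aeval J s + aeval J u
  | UMul s u => aeval J s * aeval J u
  end.
Arguments aeval {k n} J t.

Definition in_ideal k n (J : fin_codim_ideal k n) (t : uterm) : Prop :=
  aeval J t = 0.

Definition locally_integrable (k : kind) (I : uterm -> Prop) : Prop :=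
  forall n : nat,
    exists (Jt : Type) (Js : Jt -> fin_codim_ideal k n),
      forall t, restr k n I t <-> (term_in k n t /\ forall j, in_ideal (Js j) t).

End LieDefs.

(* Main.v *)
(** The operators T_ab : v |-> e_a B(e_b, v) - eps e_b B(e_a, v) span g(2n), so a simple
   module is a family of operators F_ab with the same brackets.  A polynomial in the F_ij,
   with i and j in a finite isotropic set of indices, is injective or locally nilpotent,
   because the vectors killed by one of its powers form a submodule.  If some root operator
   F_ij (in the symplectic case some F(w, w)) is injective, it can be inverted after
   enlarging the module, and the rows F_ik, F_jk give canonical variables indexed by k;
   subtracting the quadratic expressions in them leaves a family of the same kind, on all
   but finitely many indices, which commutes with these variables.  Shifting the indices
   does not change the annihilator in U(g(2n)), since shifts are products of flows of
   elements of the Lie algebra.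

   Iterating, either the remaining root operators become locally nilpotent, or 2n pairs of
   canonical variables appear; in the second case, by the Poincare-Birkhoff-Witt theorem,
   the quadratic part alone has the same annihilator as the whole.  Canonical pairs can be
   replaced by multiplications and differentiations acting on polynomials, again without
   changing annihilators.  Then all root operators are locally nilpotent and every vector
   lies in a finite-dimensional submodule, except that in the symplectic case one
   self-conjugate row of variables may be left over; every vector then lies in the product
   of polynomials in n variables and a finite-dimensional module, which is bounded. *)
Require Import Defs.
From Stdlib Require Import Ncring Ncring_tac.
From HB Require Import structures.
From mathcomp Require Import all_boot all_order all_algebra all_field.
From mathcomp Require Import zify ring complex reals.
From mathcomp Require Import ring_quotient generic_quotient.
From mathcomp Require Import boolp functions.
Set Implicit Arguments. Unset Strict Implicit. Unset Printing Implicit Defensive.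
Import Order.TTheory GRing.Theory Num.Theory.
Local Open Scope ring_scope.

(** * Endomorphism algebras and isomorphic subalgebras *)

(** Whether an element of U(g(2n)) annihilates a module depends only on which polynomials in the
    operators vanish. Each change of module is therefore recorded by a relation [corr] between
    operators, compatible with sums, products and vanishing; no map between the modules is needed,
    and the relation may be partial. This makes flows available: exp(ad x) is applied only where t
    -> exp(t ad x) a is a polynomial in t, although exp(x) need not exist on the module. The
    obstacle is that root operators of a simple module need not be locally nilpotent. Every
    splitting spoils finitely many indices only, and infinitely many remain to carry a copy of
    g(2n). In the symplectic case one row F(w, k) has brackets B(k, l) F(w, w), so it is normalised
    by an inverse square root and is its own conjugate. In the orthogonal case F is antisymmetric,
    two rows are needed at once, and no row can be left unpaired; hence the stronger conclusion
    there. The number 2n of pairs is the size of the natural module: from then on the quadratic part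
    can be given arbitrary second brackets with linear combinations of the variables, which forces
    the independence of its ordered monomials. *)

Section EndAlgebra.
Variable C : numClosedFieldType.

(** Modules are nonzero so that 1 differs from 0 in [End V], as the structure [algType] demands. *)
Record nzmod := NzMod { ncar :> lmodType C; nz_ex : exists v : ncar, v != 0 }.

Record End (V : nzmod) := MkEnd { efun :> V -> V; efun_lin : linear efun }.

Lemma end_ext (V : nzmod) (f g : End V) : (forall v, f v = g v) -> f = g.
Proof.
case: f g => [f Hf] [g Hg] /= /funext E; rewrite E in Hf *.
by congr MkEnd; apply: Prop_irrelevance.
Qed.

HB.instance Definition _ V := gen_eqMixin (End V).
HB.instance Definition _ V := gen_choiceMixin (End V).

Section Ops.
Variable V : nzmod.
Implicit Types f g h : End V.

Lemma efunP f a u v : f (a *: u + v) = a *: f u + f v.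
Proof. by case: f => f Hf /=; apply: Hf. Qed.
Lemma efunD f u v : f (u + v) = f u + f v.
Proof. by rewrite -[u]scale1r efunP !scale1r. Qed.
Lemma efun0 f : f 0 = 0.
Proof. by apply: (addrI (f 0)); rewrite -efunD !addr0. Qed.
Lemma efunZ f a u : f (a *: u) = a *: f u.
Proof. by rewrite -[a *: u]addr0 efunP efun0 addr0. Qed.
Lemma efunN f u : f (- u) = - f u.
Proof. by rewrite -scaleN1r efunZ scaleN1r. Qed.
Lemma efunB f u v : f (u - v) = f u - f v.
Proof. by rewrite efunD efunN. Qed.
Lemma efun_sum f (I : Type) (r : seq I) (P : pred I) (F : I -> V) :
  f (\sum_(i <- r | P i) F i) = \sum_(i <- r | P i) f (F i).
Proof.
elim/big_rec2: _ => [|i y z _ <-]; first exact: efun0.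
by rewrite efunD.
Qed.

Fact end0_lin : linear (fun _ : V => 0 : V).
Proof. by move=> a u v /=; rewrite scaler0 addr0. Qed.
Fact endD_lin f g : linear (fun v => f v + g v).
Proof. by move=> a u v /=; rewrite !efunP scalerDr addrACA. Qed.
Fact endN_lin f : linear (fun v => - f v).
Proof. by move=> a u v /=; rewrite efunP opprD scalerN. Qed.
Fact end1_lin : linear (fun v : V => v).
Proof. by []. Qed.
Fact endM_lin f g : linear (fun v => f (g v)).
Proof. by move=> a u v /=; rewrite !efunP. Qed.
Fact endZ_lin b f : linear (fun v => b *: f v).
Proof. by move=> a u v /=; rewrite efunP scalerDr !scalerA mulrC. Qed.

Definition end0 := MkEnd end0_lin.
Definition endD f g := MkEnd (endD_lin f g).
Definition endN f := MkEnd (endN_lin f).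
Definition end1 := MkEnd end1_lin.
Definition endM f g := MkEnd (endM_lin f g).
Definition endZ b f := MkEnd (endZ_lin b f).

Fact endDA : associative endD. Proof. by move=> f g h; apply: end_ext => v /=; rewrite addrA. Qed.
Fact endDC : commutative endD. Proof. by move=> f g; apply: end_ext => v /=; rewrite addrC. Qed.
Fact end0D : left_id end0 endD. Proof. by move=> f; apply: end_ext => v /=; rewrite add0r. Qed.
Fact endND : left_inverse end0 endN endD.
Proof. by move=> f; apply: end_ext => v /=; rewrite addNr. Qed.
HB.instance Definition _ := GRing.isZmodule.Build (End V) endDA endDC end0D endND.

Fact endMA : associative endM. Proof. by move=> f g h; apply: end_ext. Qed.
Fact end1M : left_id end1 endM. Proof. by move=> f; apply: end_ext. Qed.
Fact endM1 : right_id end1 endM. Proof. by move=> f; apply: end_ext. Qed.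
Fact endMDl : left_distributive endM +%R. Proof. by move=> f g h; apply: end_ext. Qed.
Fact endMDr : right_distributive endM +%R.
Proof. by move=> f g h; apply: end_ext => v /=; rewrite efunD. Qed.
Fact end1_neq0 : end1 != 0 :> End V.
Proof.
case: (nz_ex V) => v v0; apply/eqP => /(congr1 (fun f : End V => f v)) /= E.
by rewrite E eqxx in v0.
Qed.
HB.instance Definition _ :=
  GRing.Zmodule_isNzRing.Build (End V) endMA end1M endM1 endMDl endMDr end1_neq0.

Fact endZA a b f : endZ a (endZ b f) = endZ (a * b) f.
Proof. by apply: end_ext => v /=; rewrite scalerA. Qed.
Fact end1Z : left_id 1 endZ. Proof. by move=> f; apply: end_ext => v /=; rewrite scale1r. Qed.
Fact endZDr : right_distributive endZ +%R.
Proof. by move=> a f g; apply: end_ext => v /=; rewrite scalerDr. Qed.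
Fact endZDl f : {morph endZ^~ f : a b / a + b}.
Proof. by move=> a b; apply: end_ext => v /=; rewrite scalerDl. Qed.
HB.instance Definition _ := GRing.Zmodule_isLmodule.Build C (End V) endZA end1Z endZDr endZDl.
Fact endZAl (a : C) f g : a *: (f * g) = (a *: f) * g.
Proof. by apply: end_ext. Qed.
HB.instance Definition _ := GRing.Lmodule_isLalgebra.Build C (End V) endZAl.
Fact endZAr (a : C) f g : a *: (f * g) = f * (a *: g).
Proof. by apply: end_ext => v /=; rewrite /= -efunZ. Qed.
HB.instance Definition _ := GRing.Lalgebra_isAlgebra.Build C (End V) endZAr.

Lemma endDE f g v : (f + g) v = f v + g v. Proof. by []. Qed.
Lemma endNE f v : (- f) v = - f v. Proof. by []. Qed.
Lemma endBE f g v : (f - g) v = f v - g v. Proof. by []. Qed.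
Lemma endME f g v : (f * g) v = f (g v). Proof. by []. Qed.
Lemma endZE a f v : (a *: f) v = a *: f v. Proof. by []. Qed.
Lemma end0E v : (0 : End V) v = 0. Proof. by []. Qed.
Lemma end1E v : (1 : End V) v = v. Proof. by []. Qed.
Lemma end_sumE (I : Type) (r : seq I) (P : pred I) (F : I -> End V) v :
  (\sum_(i <- r | P i) F i) v = \sum_(i <- r | P i) F i v.
Proof. by elim/big_rec2: _ => // i y z _ <-. Qed.

Definition endE := (endDE, endNE, endME, endZE, end0E, end1E).

End Ops.
End EndAlgebra.

Section Corr.
Variable C : numClosedFieldType.
Implicit Types A B D : algType C.

Definition comm0 A (a b : A) := a * b = b * a.
Definition lieb A (a b : A) := a * b - b * a.

(* A relation whose graph is the graph of an isomorphism between subalgebras. *)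
Record corr A B (Rl : A -> B -> Prop) : Prop := Corr {
  corr1 : Rl 1 1;
  corrD : forall a a' b b', Rl a b -> Rl a' b' -> Rl (a + a') (b + b');
  corrM : forall a a' b b', Rl a b -> Rl a' b' -> Rl (a * a') (b * b');
  corrZ : forall c a b, Rl a b -> Rl (c *: a) (c *: b);
  corr_eq0 : forall a b, Rl a b -> (a = 0 <-> b = 0) }.

Section CorrTheory.
Variables (A B : algType C) (Rl : A -> B -> Prop).
Hypothesis HR : corr Rl.
Lemma corr0 : Rl 0 0.
Proof. by have := corrZ HR 0 (corr1 HR); rewrite !scale0r. Qed.
Lemma corrN a b : Rl a b -> Rl (- a) (- b).
Proof. by move=> h; rewrite -scaleN1r -[- b]scaleN1r; apply: corrZ. Qed.
Lemma corrB a a' b b' : Rl a b -> Rl a' b' -> Rl (a - a') (b - b').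
Proof. by move=> h h'; apply: corrD => //; apply: corrN. Qed.
Lemma corr_eq a a' b b' : Rl a b -> Rl a' b' -> (a = a' <-> b = b').
Proof.
move=> h h'; have [h1 h2] := corr_eq0 HR (corrB h h').
by split=> E; apply: subr0_eq; [apply: h1 | apply: h2]; rewrite E subrr.
Qed.
Lemma corr_sum (I : Type) (r : seq I) (P : pred I) (F : I -> A) (G : I -> B) :
  (forall i, P i -> Rl (F i) (G i)) ->
  Rl (\sum_(i <- r | P i) F i) (\sum_(i <- r | P i) G i).
Proof. by move=> h; elim/big_rec2: _ => [|i y z /h]; [apply: corr0 | apply: corrD]. Qed.
Lemma corrL a b a' b' : Rl a b -> Rl a' b' -> Rl (lieb a a') (lieb b b').
Proof. by move=> h h'; apply: corrB; apply: corrM. Qed.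
Lemma corr_comm a b a' b' : Rl a b -> Rl a' b' -> comm0 a a' -> comm0 b b'.
Proof. by move=> h h' /(corr_eq (corrM HR h h') (corrM HR h' h)). Qed.
End CorrTheory.

Lemma corr_comp A B D (R1 : A -> B -> Prop) (R2 : B -> D -> Prop) :
  corr R1 -> corr R2 -> corr (fun a d => exists2 b, R1 a b & R2 b d).
Proof.
move=> h1 h2; split.
- by exists 1; [apply: corr1 h1 | apply: corr1 h2].
- move=> a a' d d' [b r1 r2] [b' r1' r2']; exists (b + b').
    exact: corrD. exact: corrD.
- move=> a a' d d' [b r1 r2] [b' r1' r2']; exists (b * b').
    exact: corrM. exact: corrM.
- move=> c a d [b r1 r2]; exists (c *: b). exact: corrZ. exact: corrZ.
- move=> a d [b r1 r2]; have := corr_eq0 h1 r1; have := corr_eq0 h2 r2; tauto.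
Qed.

Lemma corr_refl A : corr (fun a b : A => a = b).
Proof. by split=> //; [move=> a a' b b' -> -> | move=> a a' b b' -> -> | move=> c a b -> | move=> a b ->]. Qed.

(* [p] plays the role of the curve [t |-> exp(t ad x) a], which has [p.[0] = a]
   and [p.[1] = exp(ad x) a]. *)
Definition exp_rel A (x a b : A) :=
  exists p : {poly A}, [/\ x%:P * p - p * x%:P = p^`(), p`_0 = a & p.[1] = b].

(** Bracketing with x commutes with differentiation and with evaluation at a central point, so every
    derivative of p vanishes at c; the one of order deg p is a nonzero multiple of the leading
    coefficient. *)
Lemma exp_curve_eq0 A (x c : A) (p : {poly A}) : (forall a, comm0 c a) ->
  x%:P * p - p * x%:P = p^`() -> p.[c] = 0 -> p = 0.
Proof.
move=> cc Dp pc.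
have nat_inj n : (n.+1%:R : A) != 0.
  rewrite -scaler_nat scaler_eq0 oner_eq0 orbF pnatr_eq0 //.
have Dn k : x%:P * p^`(k) - p^`(k) * x%:P = p^`(k.+1) /\ p^`(k).[c] = 0.
  elim: k => [|k [IH1 IH2]]; first by rewrite derivn0 derivn1.
  split.
    rewrite derivnS -[RHS]/(p^`(k.+2)) [p^`(k.+2)]derivnS -IH1 derivB !derivM !derivC.
    by rewrite mul0r mulr0 add0r addr0 -derivnS.
  rewrite -IH1 hornerD hornerN hornerCM hornerM_comm; last first.
    by rewrite /comm_poly hornerC; apply: cc.
  by rewrite IH2 hornerC mulr0 mul0r subrr.
apply/eqP/negP => /negP pn0.
have sp : (0 < size p)%N by rewrite size_poly_gt0.
have [_] := Dn (size p).-1.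
have -> : p^`((size p).-1) = ((size p).-1)`!%:R%:P * (lead_coef p)%:P.
  apply/polyP => i; rewrite coef_derivn -polyCM coefC.
  case: eqP => [->|i0].
    by rewrite addn0 ffactnn lead_coefE mulr_natl.
  rewrite nth_default ?mul0rn // -{1}(prednK sp).
  by case: i i0 => // i _; rewrite addnS ltnS leq_addr.
rewrite -polyCM hornerC mulr_natl -scaler_nat => /eqP.
rewrite scaler_eq0 lead_coef_eq0 (negbTE pn0) orbF pnatr_eq0.
by rewrite (gtn_eqF (fact_gt0 _)).
Qed.

(** The curves of x are closed under products by the Leibniz rule, and evaluation at each of the
    central points 0 and 1 is injective on them. The two evaluations thus identify one subalgebra
    with another. *)
Lemma exp_rel_corr A (x : A) : corr (exp_rel x).
Proof.
have c0 : forall a : A, comm0 0 a by move=> a; rewrite /comm0 mulr0 mul0r.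
have c1 : forall a : A, comm0 1 a by move=> a; rewrite /comm0 mulr1 mul1r.
split.
- by exists 1; rewrite mulr1 mul1r subrr derivC coefC hornerC.
- move=> a a' b b' [p [p1 p2 p3]] [q [q1 q2 q3]]; exists (p + q).
  rewrite mulrDr mulrDl opprD addrACA p1 q1 derivD coefD p2 q2 hornerD p3 q3.
  by [].
- move=> a a' b b' [p [p1 p2 p3]] [q [q1 q2 q3]]; exists (p * q); split.
  + rewrite derivM -p1 -q1 mulrBl mulrBr !mulrA addrA addrNK //.
  + by rewrite coef0M p2 q2.
  + by rewrite hornerM_comm ?p3 ?q3 // /comm_poly mulr1 mul1r.
- move=> c a b [p [p1 p2 p3]]; exists (c%:A%:P * p); split.
  + rewrite derivM derivC mul0r add0r -p1 mulrBr !mulrA; congr (_ * _ - _).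
    by rewrite -!polyCM mulr_algl mulr_algr.
  + by rewrite coefCM p2 mulr_algl.
  + by rewrite hornerCM p3 mulr_algl.
- move=> a b [p [p1 p2 p3]]; split=> h.
    by rewrite -p3 (exp_curve_eq0 c0 p1) ?horner0 // horner_coef0 p2.
  by rewrite -p2 (exp_curve_eq0 c1 p1) ?coef0 // p3.
Qed.

Definition curve A (x : A) (p : {poly A}) := x%:P * p - p * x%:P = p^`().

Lemma curveD A (x : A) p q : curve x p -> curve x q -> curve x (p + q).
Proof. by rewrite /curve mulrDr mulrDl opprD addrACA derivD => -> ->. Qed.
Lemma curveM A (x : A) p q : curve x p -> curve x q -> curve x (p * q).
Proof. by rewrite /curve derivM => <- <-; rewrite mulrBl mulrBr !mulrA addrA subrK. Qed.
Lemma curveC A (x : A) (c : C) : curve x (c *: 1)%:P.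
Proof. by rewrite /curve derivC -!polyCM -scalerAr -scalerAl mulr1 mul1r subrr. Qed.

(** The orbit of a under exp(t ad x) when three brackets with x kill a: b is the first bracket and c
    is half of the second. *)
Definition quad A (a b c : A) : {poly A} := a%:P + b%:P * 'X + c%:P * 'X^2.

Lemma quad_curve A (x a b c : A) : lieb x a = b -> lieb x b = c *+ 2 ->
  lieb x c = 0 -> curve x (quad a b c).
Proof.
rewrite /lieb /curve /quad => h1 h2 h3.
have brX (d : A) n : x%:P * (d%:P * 'X^n) - d%:P * 'X^n * x%:P
      = (x * d - d * x)%:P * 'X^n.
  by rewrite -[_ * 'X^n * x%:P]mulrA -commr_polyXn !mulrA -!polyCM -mulrBl polyCB.
have := brX a 0%N; have := brX b 1%N; have := brX c 2%N.
rewrite h1 h2 h3 expr0 expr1 !mulr1 mul0r => e2 e1 e0.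
rewrite !mulrDr !mulrDl !opprD addrACA [X in X + _ = _]addrACA e0 e1 e2.
rewrite !mul_polyC !derivD !derivZ derivC derivXn derivX !add0r addr0 /=.
by rewrite expr1 alg_polyC -scalerMnl scalerMnr.
Qed.

Lemma exp_rel2 A (x a b c : A) : lieb x a = b -> lieb x b = c *+ 2 ->
  lieb x c = 0 -> exp_rel x a (a + b + c).
Proof.
move=> h1 h2 h3; exists (quad a b c); rewrite /quad; split; first exact: quad_curve.
- by rewrite !coefD !coefCM coefX coefXn coefC /= !mulr0 !addr0.
- by rewrite !hornerD !hornerCM hornerX hornerXn hornerC expr1n !mulr1.
Qed.

Lemma exp_rel1 A (x a b : A) : lieb x a = b -> lieb x b = 0 -> exp_rel x a (a + b).
Proof.
move=> h1 h2; rewrite -[a + b]addr0; apply: exp_rel2 => //; first by rewrite mul0rn.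
by rewrite /lieb mulr0 mul0r subrr.
Qed.

Lemma exp_rel0 A (x a : A) : lieb x a = 0 -> exp_rel x a a.
Proof.
by move=> h1; rewrite -{2}[a]addr0; apply: exp_rel1 => //; rewrite /lieb mulr0 mul0r subrr.
Qed.

End Corr.

(** The interface through which [non_commutative_ring], called by [ncr], treats rings with Leibniz
    equality. *)
#[global] Instance nzRing_ncops (A : nzRingType) :
  @Ring_ops A (0 : A) (1 : A) +%R *%R (fun a b => a - b) -%R (@eq A) := {}.
#[global] Instance nzRing_ncring (A : nzRingType) : Ring (Ro := nzRing_ncops A).
Proof.
split; rewrite /_==_ /eq_notation /=.
- exact: RelationClasses.eq_equivalence.
- by move=> ? ? -> ? ? ->.
- by move=> ? ? -> ? ? ->.
- by move=> ? ? -> ? ? ->.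
- by move=> ? ? ->.
- exact: add0r.
- exact: addrC.
- exact: addrA.
- exact: mul1r.
- exact: mulr1.
- exact: mulrA.
- exact: mulrDl.
- by move=> x y z; exact: mulrDr.
- by [].
- exact: subrr.
Defined.
Ltac ncr := match goal with |- @eq ?T ?a ?b => change (@Algebra_syntax.equality T _ a b) end;
  non_commutative_ring.

Section LieBracket.
Variable C : numClosedFieldType.
Variable A : algType C.
Implicit Types a b c x : A.
Lemma liebMl a b c : lieb (a * b) c = a * lieb b c + lieb a c * b.
Proof. rewrite /lieb mulrBr mulrBl !mulrA addrA. by rewrite subrK. Qed.
Lemma liebMr a b c : lieb c (a * b) = a * lieb c b + lieb c a * b.
Proof. by rewrite /lieb mulrBr mulrBl !mulrA [RHS]addrC addrA subrK. Qed.
Lemma liebC a b : lieb a b = - lieb b a. Proof. by rewrite /lieb opprB. Qed.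
Lemma liebDl a b c : lieb (a + b) c = lieb a c + lieb b c.
Proof. by rewrite /lieb mulrDl mulrDr opprD addrACA. Qed.
Lemma liebDr a b c : lieb c (a + b) = lieb c a + lieb c b.
Proof. by rewrite /lieb mulrDl mulrDr opprD addrACA. Qed.
Lemma liebNl a b : lieb (- a) b = - lieb a b.
Proof. by rewrite /lieb mulrN mulNr opprB opprK addrC. Qed.
Lemma liebNr a b : lieb a (- b) = - lieb a b.
Proof. by rewrite /lieb mulrN mulNr opprB opprK addrC. Qed.
Lemma liebBl a b c : lieb (a - b) c = lieb a c - lieb b c.
Proof. by rewrite liebDl liebNl. Qed.
Lemma liebBr a b c : lieb c (a - b) = lieb c a - lieb c b.
Proof. by rewrite liebDr liebNr. Qed.
Lemma liebZl k a b : lieb (k *: a) b = k *: lieb a b.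
Proof. by rewrite /lieb scalerBr -scalerAl -scalerAr. Qed.
Lemma liebZr k a b : lieb a (k *: b) = k *: lieb a b.
Proof. by rewrite /lieb scalerBr -scalerAl -scalerAr. Qed.
Lemma lieb0l a : lieb 0 a = 0. Proof. by rewrite /lieb mulr0 mul0r subrr. Qed.
Lemma lieb0r a : lieb a 0 = 0. Proof. by rewrite /lieb mulr0 mul0r subrr. Qed.
Lemma liebb a : lieb a a = 0. Proof. by rewrite /lieb subrr. Qed.
Lemma lieb1l a : lieb 1 a = 0. Proof. by rewrite /lieb mul1r mulr1 subrr. Qed.
Lemma lieb1r a : lieb a 1 = 0. Proof. by rewrite /lieb mul1r mulr1 subrr. Qed.
Lemma lieb_suml (I : Type) (r : seq I) (P : pred I) (F : I -> A) b :
  lieb (\sum_(i <- r | P i) F i) b = \sum_(i <- r | P i) lieb (F i) b.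
Proof. by elim/big_rec2: _ => [|i y z _ <-]; [apply: lieb0l | apply: liebDl]. Qed.
Lemma lieb_sumr (I : Type) (r : seq I) (P : pred I) (F : I -> A) b :
  lieb b (\sum_(i <- r | P i) F i) = \sum_(i <- r | P i) lieb b (F i).
Proof. by elim/big_rec2: _ => [|i y z _ <-]; [apply: lieb0r | apply: liebDr]. Qed.
Lemma lieb0P a b : lieb a b = 0 <-> comm0 a b.
Proof. by rewrite /lieb /comm0; split=> [/subr0_eq|->] //; rewrite subrr. Qed.
Lemma lieb_scaled z a b : lieb z a = 0 -> lieb z b = 0 -> lieb (z * a) (z * b) = z * z * lieb a b.
Proof.
move=> /lieb0P za /lieb0P zb.
rewrite /lieb mulrBr; congr (_ - _); rewrite !mulrA.
  by rewrite -[z * a * z]mulrA -[a * z]za !mulrA.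
by rewrite -[z * b * z]mulrA -[b * z]zb !mulrA.
Qed.
Lemma lieb_sym0 a b : lieb a b = 0 -> lieb b a = 0.
Proof. by move=> h; rewrite liebC h oppr0. Qed.
End LieBracket.

Section LocalNilpotence.
Variable C : numClosedFieldType.
Variable V : nzmod C.
Implicit Types a b : End V.
Definition locnilp a := forall v, exists k, (a ^+ k) v = 0.
Definition injop a := forall v, a v = 0 -> v = 0.

Lemma end_expSr a k v : (a ^+ k.+1) v = (a ^+ k) (a v).
Proof. by rewrite exprSr endME. Qed.
Lemma end_expS a k v : (a ^+ k.+1) v = a ((a ^+ k) v).
Proof. by rewrite exprS endME. Qed.
Lemma end_exp_le a k l v : (k <= l)%N -> (a ^+ k) v = 0 -> (a ^+ l) v = 0.
Proof. by move=> /subnK <- h; rewrite exprD endME h efun0. Qed.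
Lemma injop_exp a k : injop a -> injop (a ^+ k).
Proof. by move=> h; elim: k => [|k IH] v //; rewrite end_expS => /h /IH. Qed.

Lemma locnilpZ c a : locnilp a -> locnilp (c *: a).
Proof. by move=> h v; have [k hk] := h v; exists k; rewrite exprZn endZE hk scaler0. Qed.
Lemma locnilpM a b : comm0 a b -> locnilp a -> locnilp (a * b).
Proof.
move=> ab h v; have [k hk] := h v; exists k.
by rewrite exprMn_comm // commrX ?endME ?hk ?efun0 //; apply/commr_sym/commrX/commr_sym.
Qed.
End LocalNilpotence.

(** * Canonical pairs acting on polynomials *)

Section PolyModule.
Variable C : numClosedFieldType.
Variable V : nzmod C.

(** The module V[z], as finitely supported sequences of coefficients. Below, [vz] is multiplication
    by z, [vd] is d/dz, and [vlift] lets an operator of V act on the coefficients. *)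
Record vpoly := VPoly { vcoef :> nat -> V; _ : exists K, forall k, (K <= k)%N -> vcoef k = 0 }.

Lemma vpolyP (u : vpoly) : exists K, forall k, (K <= k)%N -> u k = 0.
Proof. by case: u. Qed.
Lemma vpoly_ext (u w : vpoly) : (forall k, u k = w k) -> u = w.
Proof.
case: u w => [u Hu] [w Hw] /= /funext E; rewrite E in Hu *.
by congr VPoly; apply: Prop_irrelevance.
Qed.
HB.instance Definition _ := gen_eqMixin vpoly.
HB.instance Definition _ := gen_choiceMixin vpoly.

Fact vp0_sub : exists K, forall k, (K <= k)%N -> (fun _ => 0 : V) k = 0.
Proof. by exists 0%N. Qed.
Fact vpD_sub (u w : vpoly) : exists K, forall k, (K <= k)%N -> (fun k => u k + w k) k = 0.
Proof.
have [K HK] := vpolyP u; have [L HL] := vpolyP w.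
by exists (maxn K L) => k; rewrite geq_max => /andP [/HK -> /HL ->]; rewrite addr0.
Qed.
Fact vpmap_sub (f : End V) (u : vpoly) : exists K, forall k, (K <= k)%N -> (fun k => f (u k)) k = 0.
Proof. by have [K HK] := vpolyP u; exists K => k /HK ->; rewrite efun0. Qed.
Definition vp0 := VPoly vp0_sub.
Definition vpD u w := VPoly (vpD_sub u w).
Definition vpmap f u := VPoly (vpmap_sub f u).
Definition vpN u := vpmap (-1) u.
Definition vpZ (c : C) u := vpmap (c *: 1) u.
Fact vpDA : associative vpD. Proof. by move=> u v w; apply: vpoly_ext => k /=; rewrite addrA. Qed.
Fact vpDC : commutative vpD. Proof. by move=> u v; apply: vpoly_ext => k /=; rewrite addrC. Qed.
Fact vp0D : left_id vp0 vpD. Proof. by move=> u; apply: vpoly_ext => k /=; rewrite add0r. Qed.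
Fact vpND : left_inverse vp0 vpN vpD. Proof. by move=> u; apply: vpoly_ext => k /=; rewrite addNr. Qed.
HB.instance Definition _ := GRing.isZmodule.Build vpoly vpDA vpDC vp0D vpND.
Fact vpZA a b u : vpZ a (vpZ b u) = vpZ (a * b) u.
Proof. by apply: vpoly_ext => k /=; rewrite scalerA. Qed.
Fact vp1Z : left_id 1 vpZ. Proof. by move=> f; apply: vpoly_ext => v /=; rewrite scale1r. Qed.
Fact vpZDr : right_distributive vpZ +%R.
Proof. by move=> a f g; apply: vpoly_ext => v /=; rewrite scalerDr. Qed.
Fact vpZDl f : {morph vpZ^~ f : a b / a + b}.
Proof. by move=> a b; apply: vpoly_ext => v /=; rewrite scalerDl. Qed.
HB.instance Definition _ := GRing.Zmodule_isLmodule.Build C vpoly vpZA vp1Z vpZDr vpZDl.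

Lemma vpDE (u w : vpoly) k : (u + w) k = u k + w k. Proof. by []. Qed.
Lemma vpNE (u : vpoly) k : (- u) k = - u k. Proof. by []. Qed.
Fact vconst_sub v : exists K, forall k, (K <= k)%N -> (fun k => if k is 0 then v else 0 : V) k = 0.
Proof. by exists 1%N; case. Qed.
Definition vconst v := VPoly (vconst_sub v).
Fact vpoly_nz : exists u : vpoly, u != 0.
Proof.
case: (nz_ex V) => v v0; exists (vconst v); apply/eqP => /(congr1 (fun u : vpoly => u 0%N)) /= E.
by rewrite E eqxx in v0.
Qed.
Definition PolyV : nzmod C := NzMod vpoly_nz.

Fact shift_sub (u : vpoly) :
  exists K, forall k, (K <= k)%N -> (fun k => if k is k'.+1 then u k' else 0) k = 0.
Proof. by have [K HK] := vpolyP u; exists K.+1; case=> // k /HK. Qed.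
Fact deriv_sub (u : vpoly) :
  exists K, forall k, (K <= k)%N -> (fun k => k.+1%:R *: u k.+1) k = 0.
Proof. by have [K HK] := vpolyP u; exists K => k h; rewrite HK ?scaler0 // ltnW. Qed.
Fact lift_lin f : linear (vpmap f).
Proof. by move=> a u w; apply: vpoly_ext => k /=; rewrite efunP. Qed.
Fact shift_lin : linear (fun u => VPoly (shift_sub u)).
Proof. by move=> a u w; apply: vpoly_ext => -[|k] //=; rewrite scaler0 addr0. Qed.
Fact deriv_lin : linear (fun u => VPoly (deriv_sub u)).
Proof. by move=> a u w; apply: vpoly_ext => k /=; rewrite !scalerDr !scalerA mulrC. Qed.
Definition vlift f : End PolyV := MkEnd (lift_lin f : linear (vpmap f : PolyV -> PolyV)).
Definition vz : End PolyV := MkEnd (shift_lin : linear (_ : PolyV -> PolyV)).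
Definition vd : End PolyV := MkEnd (deriv_lin : linear (_ : PolyV -> PolyV)).

Lemma vliftE f (u : vpoly) k : (vlift f u : vpoly) k = f (u k). Proof. by []. Qed.
Lemma vzS (u : vpoly) k : (vz u : vpoly) k.+1 = u k. Proof. by []. Qed.
Lemma vz0 (u : vpoly) : (vz u : vpoly) 0%N = 0. Proof. by []. Qed.
Lemma vdE (u : vpoly) k : (vd u : vpoly) k = k.+1%:R *: u k.+1. Proof. by []. Qed.

Lemma vlift_corr : corr (fun a b => b = vlift a).
Proof.
split.
- by apply: end_ext => u; apply: vpoly_ext.
- by move=> a a' b b' -> ->; apply: end_ext => u; apply: vpoly_ext.
- by move=> a a' b b' -> ->; apply: end_ext => u; apply: vpoly_ext.
- by move=> c a b ->; apply: end_ext => u; apply: vpoly_ext => k /=; rewrite /= ?scale1r.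
- move=> a b ->; split=> [->|E]; first by apply: end_ext => u; apply: vpoly_ext.
  apply: end_ext => v; have /(congr1 (fun f : End PolyV => f (vconst v) : vpoly)) := E.
  by move/(congr1 (fun u : vpoly => u 0%N)).
Qed.

Lemma lieb_vd_vz : lieb vd vz = 1.
Proof.
apply: end_ext => u; apply: vpoly_ext => k; rewrite endBE !endME end1E.
rewrite vpDE vpNE vdE vzS; case: k => [|k]; first by rewrite vz0 subr0 scale1r.
by rewrite vzS vdE -scalerBl -natrB // subSnn scale1r.
Qed.
Lemma vlift_vz a : lieb (vlift a) vz = 0.
Proof.
apply/lieb0P; apply: end_ext => u; apply: vpoly_ext => -[|k] //=.
exact: efun0.
Qed.
Lemma vlift_vd a : lieb (vlift a) vd = 0.
Proof. by apply/lieb0P; apply: end_ext => u; apply: vpoly_ext => k /=; rewrite efunZ. Qed.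

Lemma vlift_expE a n (u : vpoly) k : ((vlift a ^+ n) u : vpoly) k = (a ^+ n) (u k).
Proof. by elim: n => // n IH; rewrite !end_expS vliftE IH. Qed.

Lemma vd_locnilp : locnilp vd.
Proof.
move=> u; have [K HK] := vpolyP u; exists K; apply: vpoly_ext => k.
have E : forall n k, (K <= n + k)%N -> ((vd ^+ n) u : vpoly) k = 0.
  elim=> [|n IH] j h; first exact: HK.
  by rewrite end_expS vdE IH ?scaler0 // addnS -addSn.
by rewrite E ?leq_addr.
Qed.
Lemma vlift_locnilp a : locnilp a -> locnilp (vlift a).
Proof.
move=> h u; have [K HK] := vpolyP u.
have [N HN] : exists N, forall k, (k < K)%N -> (a ^+ N) (u k) = 0.
  elim: K {HK} => [|K [N HN]]; first by exists 0%N.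
  have [M HM] := h (u K); exists (maxn N M) => k; rewrite ltnS leq_eqVlt => /orP [/eqP ->|/HN].
    by apply: end_exp_le HM; rewrite leq_maxr.
  by apply: end_exp_le; rewrite leq_maxl.
exists N; apply: vpoly_ext => k; rewrite vlift_expE.
by have [/HN //|/HK ->] := ltnP k K; rewrite efun0.
Qed.

End PolyModule.

Section WeylTransfer.
Variable C : numClosedFieldType.

(* The symplectic map exchanging the pairs (q, p) and (z, d/dz) is a product of
   three shears, the flows of z p, - q d/dz and z p. *)
Lemma weyl_transfer (V : nzmod C) (p q : End V) : lieb p q = 1 ->
  exists (V' : nzmod C) (Rl : End V -> End V' -> Prop) (d z : End V')
    (L : End V -> End V'), [/\ corr Rl, Rl p d, Rl q z, locnilp d &
    forall b, comm0 b p -> comm0 b q -> Rl b (L b) /\ (locnilp b -> locnilp (L b))].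
Proof.
move=> pq; set z := vz V; set d := vd V.
have HL := vlift_corr V; pose l a := @vlift C V a.
have Ll a b : lieb (l a) (l b) = l (lieb a b) := corrL HL (erefl (l a)) (erefl (l b)).
have l1 : l 1 = 1 := esym (corr1 HL).
have l0 : l 0 = 0 := esym (corr0 HL).
have lN1 : l (-1) = -1 := esym (corrN HL (corr1 HL)).
have lz a : lieb (l a) z = 0 := vlift_vz a.
have ld a : lieb (l a) d = 0 := vlift_vd a.
have zl a := lieb_sym0 (lz a); have dl a := lieb_sym0 (ld a).
have dz : lieb d z = 1 := lieb_vd_vz V.
have zd : lieb z d = -1 by rewrite liebC dz.
have qp : lieb q p = -1 by rewrite liebC pq.
(* The flow of [x] sends q to q + z and d to d - p; that of [y] sends p to p + d and z to z - q. The
   successive images are q, q + z, z, z and p, p, p + d, d. *)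
pose x := z * l p; pose y := - (l q * d).
pose simp := (mulr0, mul0r, addr0, add0r, oppr0, mulr1, mul1r, mulN1r, mulrN1, opprK, subr0, sub0r).
exists (PolyV V), (fun a e => exists2 b, (exists2 c, (exists2 f, f = l a & exp_rel x f c) &
   exp_rel y c b) & exp_rel x b e), d, z, l; split.
- apply: corr_comp (exp_rel_corr x); apply: corr_comp (exp_rel_corr y).
  exact: corr_comp HL (exp_rel_corr x).
- exists (l p + d); last first.
    rewrite [X in exp_rel _ _ X](_ : _ = (l p + d) + - l p); last by rewrite addrAC subrr add0r.
    apply: exp_rel1; first by rewrite /x liebMl !liebDr Ll liebb l0 ld zl zd !simp.
    by rewrite /x liebMl liebNr Ll liebb l0 liebNr zl !simp.
  exists (l p); last first.
    apply: exp_rel1; last by rewrite /y liebNl liebMl liebb ld !simp.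
    by rewrite /y liebNl liebMl dl Ll qp lN1 !simp.
  by exists (l p) => //; apply: exp_rel0; rewrite /x liebMl Ll liebb l0 zl !simp.
- exists z; last by apply: exp_rel0; rewrite /x liebMl lz liebb !simp.
  exists (l q + z); last first.
    rewrite [X in exp_rel _ _ X](_ : _ = (l q + z) + - l q); last by rewrite addrAC subrr add0r.
    apply: exp_rel1; first by rewrite /y liebNl liebMl !liebDr dl dz lz Ll liebb l0 !simp.
    by rewrite /y liebNl liebMl !liebNr dl Ll liebb l0 !simp.
  exists (l q) => //; apply: exp_rel1; last by rewrite /x liebMl lz liebb !simp.
  by rewrite /x liebMl Ll pq l1 zl !simp.
- exact: vd_locnilp.
- move=> b /lieb0P bp /lieb0P bq; split; last exact: vlift_locnilp.
  have xb : lieb x (l b) = 0 by rewrite /x liebMl zl Ll (lieb_sym0 bp) l0 !simp.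
  have yb : lieb y (l b) = 0 by rewrite /y liebNl liebMl dl Ll (lieb_sym0 bq) l0 !simp.
  exists (l b); last exact: exp_rel0.
  exists (l b); last exact: exp_rel0.
  by exists (l b) => //; apply: exp_rel0.
Qed.
End WeylTransfer.

(** * Adjoining an inverse square root *)

Local Open Scope quotient_scope.

Section Adjoin.
Variable C : numClosedFieldType.
Variables (V : nzmod C) (x : End V).
Hypothesis x_inj : injop x.

Local Notation PV := (vpoly V).
Let z : End (PolyV V) := vz V.
Let l (a : End V) : End (PolyV V) := vlift a.

(** The submodule (1 - x z^2) V[z]. In the quotient z^2 inverts x, so this is the localisation of V
    at x with a square root of 1/x adjoined. *)
Definition adj_pred : {pred PV} := fun u => `[< exists w : PV, u = w - l x (z (z w)) >].

Fact adj_zmod : zmod_closed adj_pred.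
Proof.
split; first by apply/asboolP; exists 0; rewrite !efun0 subr0.
move=> u v /asboolP [w ->] /asboolP [w' ->]; apply/asboolP; exists (w - w').
by rewrite !efunB ![- (_ - _)]opprD !opprK addrACA.
Qed.
HB.instance Definition _ := GRing.isZmodClosed.Build PV adj_pred adj_zmod.

Definition adjQ := Quotient.quot adj_pred.
HB.instance Definition _ := GRing.Zmodule.on adjQ.
Notation pi := (\pi_adjQ : PV -> adjQ).

Lemma adj_piD u w : pi (u + w) = pi u + pi w. Proof. by rewrite /= !piE. Qed.
Lemma adj_piB u w : pi (u - w) = pi u - pi w. Proof. by rewrite /= !piE. Qed.
Lemma adj_pi_eq0 u : pi u = 0 <-> exists w : PV, u = w - l x (z (z w)).
Proof.
have -> : (0 : adjQ) = pi 0 by rewrite !piE.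
split=> [/eqP|h]; last apply/eqP; rewrite -Quotient.idealrBE subr0; first by move/asboolP.
by apply/asboolP.
Qed.
Lemma adj_pi_surj (v : adjQ) : exists u, v = pi u.
Proof. by exists (repr v); rewrite reprK. Qed.
Lemma adj_pi_eq u w : (exists t : PV, u - w = t - l x (z (z t))) -> pi u = pi w.
Proof. by move/adj_pi_eq0; rewrite adj_piB => /subr0_eq. Qed.

Lemma adj_descend (f : PV -> PV) : (forall u w, f (u - w) = f u - f w) ->
  (forall u, pi u = 0 -> pi (f u) = 0) -> forall u, pi (f (repr (pi u))) = pi (f u).
Proof.
move=> fB f0 u; apply: subr0_eq; rewrite -adj_piB -fB; apply: f0.
by rewrite adj_piB reprK subrr.
Qed.

Definition adjZ (a : C) (v : adjQ) : adjQ := pi (a *: repr v).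
Lemma adjZE a u : adjZ a (pi u) = pi (a *: u).
Proof.
apply: (adj_descend (f := fun u => a *: u)) => [u' w|u' /adj_pi_eq0 [w ->]].
  by rewrite scalerBr.
by apply/adj_pi_eq0; exists (a *: w); rewrite !efunZ scalerBr.
Qed.
Fact adjZA a b v : adjZ a (adjZ b v) = adjZ (a * b) v.
Proof. by have [u ->] := adj_pi_surj v; rewrite !adjZE scalerA. Qed.
Fact adj1Z : left_id 1 adjZ.
Proof. by move=> v; have [u ->] := adj_pi_surj v; rewrite adjZE scale1r. Qed.
Fact adjZDr : right_distributive adjZ +%R.
Proof.
move=> a v v'; have [u ->] := adj_pi_surj v; have [u' ->] := adj_pi_surj v'.
by rewrite -adj_piD !adjZE scalerDr adj_piD.
Qed.
Fact adjZDl v : {morph adjZ^~ v : a b / a + b}.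
Proof. by move=> a b; have [u ->] := adj_pi_surj v; rewrite !adjZE scalerDl adj_piD. Qed.
HB.instance Definition _ := GRing.Zmodule_isLmodule.Build C adjQ adjZA adj1Z adjZDr adjZDl.

Lemma adj_piZ a u : pi (a *: u) = a *: pi u. Proof. by rewrite -adjZE. Qed.

(* The relation [x z^2 = 1] forces the coefficients of a representative of zero
   to satisfy [w_{k+2} = x w_k]. *)
Lemma adj_pi_small (u : PV) : (forall k, (2 <= k)%N -> u k = 0) -> pi u = 0 -> u = 0.
Proof.
move=> u2 /adj_pi_eq0 [w uw].
have ws k : w k.+2 = x (w k).
  apply: subr0_eq; have := u2 k.+2 isT; rewrite uw vpDE vpNE vliftE !vzS; exact.
have w0 : w = 0.
  have [K HK] := vpolyP w.
  suff h k : forall j, (K <= j + k.*2)%N -> w j = 0.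
    apply: vpoly_ext => j; apply: (h K); rewrite -addnn addnA; exact: leq_addl.
  elim: k => [|k IH] j; first by rewrite addn0; apply: HK.
  by rewrite doubleS -addn2 addnC -addnA addnC => h; apply: x_inj; rewrite -ws IH // !addSn -!addnS addnC.
by rewrite uw w0 !efun0 subr0.
Qed.

Fact adj_nz : exists v : adjQ, v != 0.
Proof.
have [v v0] := nz_ex V; exists (pi (vconst v)); apply/eqP => /adj_pi_small E.
have /(congr1 (fun u : PV => u 0%N)) /= E' : vconst v = 0 by apply: E; case.
by rewrite E' eqxx in v0.
Qed.
Definition AdjV : nzmod C := NzMod adj_nz.

(** An operator commuting with x z^2 descends to the quotient. With this condition inside the
    existential, choice gives a total function, whose value on the other operators is the default
    0. *)
Lemma adj_op_ex (f : End (PolyV V)) : exists f' : End AdjV,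
  comm0 f (l x * z * z) -> forall u : PV, f' (pi u) = pi (f u).
Proof.
have [fx|nfx] := pselect (comm0 f (l x * z * z)); last by exists 0.
have fE u : pi (f (repr (pi u))) = pi (f u).
  apply: (adj_descend (f := f)) => [u' w|u' /adj_pi_eq0 [w ->]]; first exact: (efunB f u' w).
  apply/adj_pi_eq0; exists (f w); rewrite efunB; congr (_ - _).
  by have := congr1 (fun g : End (PolyV V) => g w) fx; rewrite !endME.
have lin : linear (fun v : AdjV => pi (f (repr v)) : AdjV).
  move=> a v v'; have [u ->] := adj_pi_surj v; have [u' ->] := adj_pi_surj v'.
  by rewrite -adj_piZ -adj_piD !fE efunP adj_piD adj_piZ.
by exists (MkEnd lin) => _ u /=; rewrite fE.
Qed.


(** [zeta] plays the role of x^(-1/2), and [L] extends the operators that commute with x. An inverse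
    of x alone would not normalise a row whose brackets are multiples of x. *)
Record adjoined (V' : nzmod C) (L : End V -> End V') (zeta : End V') : Prop := Adjoined {
  ad_corr : corr (fun a b => comm0 a x /\ b = L a);
  ad_zeta : forall a, comm0 a x -> comm0 (L a) zeta;
  ad_sq : zeta * zeta * L x = 1;
  ad_nil : forall a, comm0 a x -> locnilp a -> locnilp (L a);
  ad_inj : forall a, comm0 a x -> injop a -> injop (L a) }.

Lemma adjoin_ex : exists V' L zeta, @adjoined V' L zeta.
Proof.
have [T HT] := choice adj_op_ex.
pose L a := T (l a); pose zeta := T z.
have lz a : comm0 (l a) z by apply/lieb0P/vlift_vz.
have HL := vlift_corr V.
have cx a : comm0 a x -> comm0 (l a) (l x * z * z).
  move=> ax; apply: commrM; last exact: lz.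
  apply: commrM; last exact: lz.
  exact: (corr_comm HL (a := a) (a' := x)).
have LE a : comm0 a x -> forall u : PV, L a (pi u) = pi (l a u).
  by move=> ax u; rewrite HT //; apply: cx.
have cz : comm0 z (l x * z * z).
  apply: commrM => //; apply: commrM => //; exact/commr_sym/lz.
have zE u : zeta (pi u) = pi (z u) by rewrite HT.
have ext (f g : End AdjV) : (forall u : PV, f (pi u) = g (pi u)) -> f = g.
  by move=> h; apply: end_ext => v; have [u ->] := adj_pi_surj v.
have xx : comm0 x x by [].
have x1 : comm0 1 x by rewrite /comm0 mul1r mulr1.
have zzx : zeta * zeta * L x = 1.
  apply: ext => u; rewrite !endE LE // !zE; apply/esym/adj_pi_eq; exists u.
  congr (_ - _); have := congr1 (fun g : End (PolyV V) => g u) (commrM (lz x) (lz x)).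
  by rewrite !endE => ->.
have LM a b : comm0 a x -> comm0 b x -> L (a * b) = L a * L b.
  move=> ax bx; have abx : comm0 (a * b) x by apply/commr_sym/commrM; apply/commr_sym.
  apply: ext => u; rewrite endME !LE //; congr (pi _); exact: vpoly_ext.
have HR : corr (fun a b => comm0 a x /\ b = L a).
  split.
  - split=> //; apply: ext => u; rewrite LE //; congr (pi _); exact: vpoly_ext.
  - move=> a a' b b' [ax ->] [ax' ->].
    have abx : comm0 (a + a') x by rewrite /comm0 mulrDl mulrDr ax ax'.
    split=> //; apply: ext => u; rewrite endDE !LE // -adj_piD; congr (pi _); exact: vpoly_ext.
  - move=> a a' b b' [ax ->] [ax' ->]; split; last by rewrite LM.
    by apply/commr_sym/commrM; apply/commr_sym.
  - move=> c a b [ax ->].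
    have abx : comm0 (c *: a) x by rewrite /comm0 -scalerAl ax scalerAr.
    split=> //; apply: ext => u; rewrite endZE !LE // -adj_piZ; congr (pi _).
    exact: vpoly_ext.
  - move=> a b [ax ->]; split=> [a0|La0].
      rewrite a0; apply: ext => u; rewrite LE; last by rewrite /comm0 mulr0 mul0r.
      by apply/adj_pi_eq0; exists 0; rewrite !efun0 subr0; apply: vpoly_ext.
    apply: end_ext => v; have := congr1 (fun g : End AdjV => g (pi (vconst v))) La0.
    rewrite LE // => /adj_pi_small E.
    by have /(congr1 (fun u : PV => u 0%N)) : l a (vconst v) = 0 by apply: E => -[|k] // _; rewrite vliftE efun0.
have Lz a : comm0 a x -> comm0 (L a) zeta.
  move=> ax; apply: ext => u; rewrite !endME zE !LE // zE; congr (pi _).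
  by have := congr1 (fun g : End (PolyV V) => g u) (lz a).
exists AdjV, L, zeta; split=> //.
- move=> a ax an v; have [u ->] := adj_pi_surj v.
  have [k hk] := vlift_locnilp an u; exists k.
  have E j : (L a ^+ j) (pi u) = pi ((l a ^+ j) u).
    by elim: j => // j IH; rewrite !end_expS IH LE.
  by rewrite E hk; apply/adj_pi_eq0; exists 0; rewrite !efun0 subr0.
- move=> a ax ai v; have [u ->] := adj_pi_surj v => h.
  have Lax : comm0 (L a) (L x) by apply: (corr_comm HR (a := a) (a' := x)).
  (* multiplying by a power of [x] reduces to representatives of degree < 2 *)
  have red K : forall w : PV, (forall k, (K.+2 <= k)%N -> w k = 0) ->
      exists n (w' : PV), (L x ^+ n) (pi w) = pi w' /\ forall k, (2 <= k)%N -> w' k = 0.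
    elim: K => [|K IH] w hw; first by exists 0%N, w.
    (* In the quotient x w_{k+2} z^{k+2} equals w_{k+2} z^k. So the terms of x w of degree at least
       two drop by two degrees, while those of degree 0 and 1 keep their factor x. *)
    have fsb k : (K.+2 <= k)%N -> (if (k < 2)%N then x (w k) else 0) + w k.+2 = 0.
      move=> hk; rewrite ltnNge (leq_trans _ hk) //= add0r hw //.
      by apply: leq_trans (leqnSn _); rewrite ltnS.
    have [|n [w' [h1 h2]]] := IH (VPoly (ex_intro _ K.+2 fsb)) => //.
    exists n.+1, w'; split=> //; rewrite exprSr endME LE // -h1.
    apply: (congr1 (fun y => (L x ^+ n) y)).
    have fs2 : exists M, forall k, (M <= k)%N -> (fun k => - w k.+2) k = 0.
      by exists K.+2 => k hk; rewrite hw ?oppr0 // ltnS ltnW // ltnW.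
    apply: adj_pi_eq; exists (VPoly fs2).
    apply: vpoly_ext => -[|[|k]]; rewrite !vpDE !vpNE !vliftE /=.
    + by rewrite efun0 subr0 opprD addrA subrr add0r.
    + by rewrite efun0 subr0 opprD addrA subrr add0r.
    + by rewrite add0r efunN opprK addrC.
  have [K HK] := vpolyP u.
  have [|n [w' [h1 h2]]] := red K u; first by move=> k hk; apply: HK; do 2!apply: ltnW.
  have Lxi : injop (L x).
    by move=> v0 hv; rewrite -[v0]end1E -zzx endME hv efun0.
  apply: (injop_exp (k := n) Lxi); rewrite h1.
  have w0 : l a w' = 0.
    apply: adj_pi_small; first by move=> k hk; rewrite vliftE h2 ?efun0.
    rewrite -LE // -h1 -endME.
    by rewrite (commrX n Lax) endME h efun0.
  suff -> : w' = 0 by apply/adj_pi_eq0; exists 0; rewrite !efun0 subr0.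
  apply: vpoly_ext => k; apply: ai.
  by have /(congr1 (fun u : PV => u k)) := w0.
Qed.

End Adjoin.

(** * Bracket relations and shifts of indices *)

Section Forms.
Variable C : numClosedFieldType.
Variable sp : bool.

(** [form_sg i] is B(e_i, e_{-i}), the antidiagonal entry of F, and [form_eps] is the sign in B(e_j,
    e_i) = eps B(e_i, e_j). This symmetry is stated for nonzero i only: in the symplectic case it
    fails at the index 0. *)
Definition form_eps : C := if sp then -1 else 1.
Definition form_sg (i : int) : C := if sp && ~~ (i < 0) then -1 else 1.
Definition form_B (i j : int) : C := if j == - i then form_sg i else 0.
Local Notation eps := form_eps.
Local Notation sg := form_sg.
Local Notation Bf := form_B.

Lemma epsK : eps * eps = 1.
Proof. by rewrite /form_eps; case: sp; rewrite ?mulrNN mulr1. Qed.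
Lemma sgK i : sg i * sg i = 1.
Proof. by rewrite /form_sg; case: ifP => _; rewrite ?mulrNN mulr1. Qed.
Lemma sg_neq0 i : sg i != 0.
Proof. by rewrite /form_sg; case: ifP => _; rewrite ?oppr_eq0 oner_eq0. Qed.
Lemma sgN i : i != 0 -> sg (- i) = eps * sg i.
Proof.
rewrite /form_sg /form_eps; case: sp => /= i0; last by rewrite mulr1.
have -> : (- i < 0) = ~~ (i < 0) by lia.
by case: (i < 0); rewrite /= ?mulrNN ?mulr1.
Qed.
Lemma BfC i j : i != 0 -> Bf j i = eps * Bf i j.
Proof.
rewrite /form_B => i0; case: (eqVneq j (- i)) => [->|ji].
  by rewrite opprK eqxx sgN.
rewrite mulr0; case: eqP => // ij; by rewrite ij opprK eqxx in ji.
Qed.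
Lemma Bf_neg i : Bf i (- i) = sg i. Proof. by rewrite /form_B eqxx. Qed.
Lemma Bf0 i j : j != - i -> Bf i j = 0. Proof. by rewrite /form_B => /negbTE ->. Qed.

Section Families.
Variable A : algType C.
Implicit Types F : int -> int -> A.

(* The relations satisfied by the operators [v |-> e_i B(e_j, v) - eps e_j B(e_i, v)],
   which span the Lie algebra preserving the form [B]. *)
Record gfam (D : int -> Prop) F : Prop := Gfam {
  gf_sym : forall i j, D i -> D j -> F j i = - eps *: F i j;
  gf_br : forall a b c d, D a -> D b -> D c -> D d -> lieb (F a b) (F c d) =
    Bf b c *: F a d - (eps * Bf a c) *: F b d + Bf b d *: F c a - (eps * Bf a d) *: F c b }.

(** Formal combinations of basis vectors e_i. They let a flow move e_i to a sum of several vectors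
    inside the bilinear extension [Fb], and [eqv] compares them through their values only. *)
Definition vec := seq (C * int).
Definition ev (f : int -> A) (v : vec) : A := \sum_(p <- v) p.1 *: f p.2.
Definition Fb F (v w : vec) : A := ev (fun i => ev (F i) w) v.
Definition eqv (v w : vec) := forall f, ev f v = ev f w.

Lemma ev_cat f v w : ev f (v ++ w) = ev f v + ev f w.
Proof. by rewrite /ev big_cat. Qed.
Lemma ev_nil f : ev f [::] = 0. Proof. by rewrite /ev big_nil. Qed.
Lemma ev_cons f p v : ev f (p :: v) = p.1 *: f p.2 + ev f v.
Proof. by rewrite /ev big_cons. Qed.
Lemma evD f g v : ev (fun i => f i + g i) v = ev f v + ev g v.
Proof. by rewrite /ev -big_split; apply: eq_bigr => p _; rewrite scalerDr. Qed.
Lemma evZ c f v : ev (fun i => c *: f i) v = c *: ev f v.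
Proof. by rewrite /ev scaler_sumr; apply: eq_bigr => p _; rewrite !scalerA mulrC. Qed.
Lemma evN f v : ev (fun i => - f i) v = - ev f v.
Proof. by rewrite -scaleN1r -evZ; congr ev; apply/funext => i; rewrite scaleN1r. Qed.
Lemma Fb_eqv F v v' w w' : eqv v v' -> eqv w w' -> Fb F v w = Fb F v' w'.
Proof. by rewrite /Fb => hv hw; rewrite hv; congr ev; apply/funext => i; rewrite hw. Qed.
Lemma Fb_catl F v v' w : Fb F (v ++ v') w = Fb F v w + Fb F v' w.
Proof. exact: ev_cat. Qed.
Lemma Fb_catr F v w w' : Fb F v (w ++ w') = Fb F v w + Fb F v w'.
Proof. by rewrite /Fb -evD; congr ev; apply/funext => i; rewrite ev_cat. Qed.
Lemma Fb_nill F w : Fb F [::] w = 0. Proof. exact: ev_nil. Qed.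
Lemma Fb_nilr F v : Fb F v [::] = 0.
Proof. by rewrite /Fb /ev big1 // => p _; rewrite big_nil scaler0. Qed.
Lemma Fb11 F i j : Fb F [:: (1, i)] [:: (1, j)] = F i j.
Proof. by rewrite /Fb /ev !big_seq1 !scale1r. Qed.

(** The natural representation of k T_ab: e_p goes to k (B(b, p) e_a - eps B(a, p) e_b). *)
Definition act (k : C) (a b : int) (v : vec) : vec :=
  flatten [seq [:: (k * Bf b p.2 * p.1, a); (- (k * eps * Bf a p.2 * p.1), b)] | p <- v].

Lemma act_nil k a b : act k a b [::] = [::]. Proof. by []. Qed.
Lemma act_cons k a b p v : act k a b (p :: v) =
  (k * Bf b p.2 * p.1, a) :: (- (k * eps * Bf a p.2 * p.1), b) :: act k a b v.
Proof. by []. Qed.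
Lemma ev_act f k a b v : ev f (act k a b v) =
  ev (fun i => (k * Bf b i) *: f a - (k * eps * Bf a i) *: f b) v.
Proof.
elim: v => [|p v IH]; first by rewrite !ev_nil.
rewrite !ev_cons /= scaleNr IH addrA scalerBr !scalerA.
by rewrite mulrC [p.1 * (_ * _ * _)]mulrC.
Qed.

Lemma eq_ev f g v : (forall p, p \in v -> f p.2 = g p.2) -> ev f v = ev g v.
Proof. by move=> h; rewrite /ev; apply: eq_big_seq => p /h ->. Qed.

Lemma lieb_ev x f v : lieb x (ev f v) = ev (fun i => lieb x (f i)) v.
Proof. by rewrite /ev lieb_sumr; apply: eq_bigr => p _; rewrite liebZr. Qed.

Lemma lieb_Fb (D : int -> Prop) F k a b v w : gfam D F -> D a -> D b ->
  (forall p, p \in v -> D p.2) -> (forall p, p \in w -> D p.2) ->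
  lieb (k *: F a b) (Fb F v w) = Fb F (act k a b v) w + Fb F v (act k a b w).
Proof.
move=> [_ br] Da Db Dv Dw; rewrite /Fb ev_act -evD lieb_ev.
apply: eq_ev => p /Dv Dp; rewrite lieb_ev ev_act -!evZ -evN -!evD.
apply: eq_ev => q /Dw Dq; rewrite liebZl br // !scalerDr !scalerN !scalerA.
by rewrite !mulrA !addrA.
Qed.

(* One shear: the generator [k F a b] moves the vector [v c] by [w c] and kills [w c]. *)
Lemma shear (D : int -> Prop) F k a b (I : Type) (v w : I -> vec) :
  gfam D F -> D a -> D b ->
  (forall c p, p \in v c -> D p.2) -> (forall c p, p \in w c -> D p.2) ->
  (forall c, eqv (act k a b (v c)) (w c)) -> (forall c, eqv (act k a b (w c)) [::]) ->
  forall c d, exp_rel (k *: F a b) (Fb F (v c) (v d)) (Fb F (v c ++ w c) (v d ++ w d)).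
Proof.
move=> gF Da Db Dv Dw vw w0 c d.
have e : forall u u' t, eqv u u' -> Fb F u t = Fb F u' t by move=> u u' t h; apply: Fb_eqv.
have e' : forall u u' t, eqv u u' -> Fb F t u = Fb F t u' by move=> u u' t h; apply: Fb_eqv.
rewrite !Fb_catl !Fb_catr !addrA -[X in exp_rel _ _ (X + _)]addrA [X in exp_rel _ _ (_ + X + _)]addrC.
apply: exp_rel2; rewrite ?liebDr !(lieb_Fb _ gF) //; try exact: Dv; try exact: Dw.
- by rewrite !(e _ _ _ (vw _)) !(e' _ _ _ (vw _)).
- rewrite !(e _ _ _ (vw _)) !(e' _ _ _ (vw _)) !(e _ _ _ (w0 _)) !(e' _ _ _ (w0 _)).
  by rewrite Fb_nill Fb_nilr addr0 add0r mulr2n.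
- by rewrite !(e _ _ _ (w0 _)) !(e' _ _ _ (w0 _)) Fb_nill Fb_nilr addr0.
Qed.

(** Moving the hyperbolic plane of e_s, e_{-s} onto that of e_u, e_{-u} is a product of three
    unipotent elements of the group of B. Since [sigma] avoids u and -u, only e_s and e_{-s} have to
    be followed; the other vectors in use stay fixed. *)
Lemma swap_pair (D : int -> Prop) F (I : Type) (sigma : I -> int) (s u : int) :
  gfam D F -> (forall c, D (sigma c)) -> 0 < s -> 0 < u -> s != u ->
  D s -> D (- s) -> D u -> D (- u) ->
  (forall c, sigma c != u /\ sigma c != - u) ->
  let sigma' c := if sigma c == s then u else if sigma c == - s then - u else sigma c in
  exists2 Rl : A -> A -> Prop, corr Rl &
    forall c d, Rl (F (sigma c) (sigma d)) (F (sigma' c) (sigma' d)).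
Proof.
move=> gF Ds s0 u0 su D1 D2 D3 D4 su' sigma'.
have sN : sg (- s) = eps * sg s by apply: sgN; lia.
have uN : sg (- u) = eps * sg u by apply: sgN; lia.
have sgu : sg s = sg u by rewrite /form_sg !ltNge !ltW.
have B1 : Bf (- s) s = eps * sg s by rewrite -sN -[in RHS]Bf_neg opprK.
have B2 : Bf (- u) u = eps * sg s by rewrite sgu -uN -[in RHS]Bf_neg opprK.
have B3 : Bf s (- s) = sg s by apply: Bf_neg.
have B4 : Bf u (- u) = sg s by rewrite sgu; apply: Bf_neg.
have B0 (i j : int) : j != - i -> Bf i j = 0 by apply: Bf0.
(* This is B(e_{-s}, e_s), which is its own inverse; with it the first shear adds exactly e_u to
   e_s. *)
pose k := eps * sg s.
have kk : k * k = 1 by rewrite /k mulrACA epsK sgK mul1r.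
have ke : k * eps * sg s = 1 by rewrite -mulrA kk.
have k2 : k * (eps * sg s) = 1 by rewrite mulrA.
have ks : k * sg s = eps by rewrite /k -mulrA sgK mulr1.
have ek : eps * k = sg s by rewrite /k mulrA epsK mul1r.
(* The successive images are e_s, e_s + e_u, e_u, e_u and e_{-s}, e_{-s}, e_{-s} + e_{-u}, e_{-u}.
   Each [w] is the increment that one shear adds to the current vectors. *)
pose v0 c : vec := [:: (1, sigma c)].
pose w0 c : vec := if sigma c == s then [:: (1, u)] else [::].
pose w1 c : vec := if sigma c == s then [:: (-1, s)] else
  if sigma c == - s then [:: (1, - u)] else [::].
pose v2 c : vec := if sigma c == s then [:: (1, u)] else
  if sigma c == - s then [:: (1, - s); (1, - u)] else [:: (1, sigma c)].
pose w2 c : vec := if sigma c == - s then [:: (-1, - s)] else [::].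
have Dv0 c p : p \in v0 c -> D p.2 by rewrite inE => /eqP ->; apply: Ds.
have Dw0 c p : p \in w0 c -> D p.2 by rewrite /w0; case: ifP => _ //; rewrite inE => /eqP ->.
have Dw1 c p : p \in w1 c -> D p.2.
  by rewrite /w1; do 2?case: ifP => _ //; rewrite inE => /eqP ->.
have Dv1 c p : p \in v0 c ++ w0 c -> D p.2 by rewrite mem_cat => /orP [/Dv0|/Dw0].
have Dv2 c p : p \in v2 c -> D p.2.
  rewrite /v2; case: ifP => _; [|case: ifP => _]; rewrite !inE;
    [move/eqP-> | move=> /orP [] /eqP -> | move/eqP->] => /=; try assumption; apply: Ds.
have Dw2 c p : p \in w2 c -> D p.2 by rewrite /w2; case: ifP => _ //; rewrite inE => /eqP ->.
have sNs : (- s == s) = false by lia.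
pose simpl := (ev_cons, ev_nil, mulr1, mulr0, mul0r, mulrN, mulNr, oppr0, scale0r, scaleNr, scale1r, addr0, add0r, opprK).
have S1 := shear (k := k) gF D3 D2 Dv0 Dw0.
have {}S1 : forall c d, exp_rel (k *: F u (- s)) (Fb F (v0 c) (v0 d)) (Fb F (v0 c ++ w0 c) (v0 d ++ w0 d)).
  apply: S1 => c f; have [h1 h2] := su' c; rewrite /v0 /w0.
    rewrite act_cons act_nil !ev_cons ev_nil /= (B0 u) // !simpl.
    case: eqVneq => [->|h3]; first by rewrite B1 kk !simpl.
    by rewrite B0 ?opprK // !simpl.
  case: ifP => _; rewrite ?act_nil //.
  by rewrite act_cons act_nil !ev_cons /= !B0 ?opprK ?simpl //; lia.
have S2 := shear (k := - k) gF D1 D4 Dv1 Dw1.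
have {}S2 : forall c d, exp_rel ((- k) *: F s (- u)) (Fb F (v0 c ++ w0 c) (v0 d ++ w0 d))
    (Fb F ((v0 c ++ w0 c) ++ w1 c) ((v0 d ++ w0 d) ++ w1 d)).
  apply: S2 => c f; have [h1 h2] := su' c; rewrite /v0 /w0 /w1.
    case: eqVneq => [->|h3].
      by rewrite /= !act_cons act_nil /= B2 !B0 ?opprK // ?simpl ?k2 ?simpl //; lia.
    case: eqVneq => [->|h4].
      by rewrite /= !act_cons act_nil /= B3 !B0 ?opprK // ?simpl ?ke ?simpl //; lia.
    by rewrite /= !act_cons act_nil /= !B0 ?opprK // ?simpl.
  by do 2?case: ifP => _; rewrite ?act_nil // !act_cons act_nil /= !B0 ?opprK // ?simpl //; lia.
have S3 := shear (k := - sg s) gF D2 D3 Dv2 Dw2.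
have {}S3 : forall c d, exp_rel ((- sg s) *: F (- s) u) (Fb F (v2 c) (v2 d))
    (Fb F (v2 c ++ w2 c) (v2 d ++ w2 d)).
  apply: S3 => c f; have [h1 h2] := su' c; rewrite /v2 /w2.
    case: eqVneq => [e3|h3].
      by rewrite e3 [s == - s]eq_sym sNs /= !act_cons act_nil /= !B0 ?opprK // ?simpl //; lia.
    case: eqVneq => [e4|h4].
      by rewrite /= !act_cons act_nil /= B4 !B0 ?opprK // ?simpl ?sgK ?simpl //; lia.
    by rewrite /= !act_cons act_nil /= !B0 ?opprK // ?simpl.
  by case: ifP => _; rewrite ?act_nil // !act_cons act_nil /= !B0 ?opprK // ?simpl //; lia.
have E12 c d : Fb F ((v0 c ++ w0 c) ++ w1 c) ((v0 d ++ w0 d) ++ w1 d) = Fb F (v2 c) (v2 d).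
  apply: Fb_eqv => f; rewrite !ev_cat /w0 /w1 /v2 /v0.
    case: eqVneq => [e3|h3]; first by rewrite ?e3 !simpl /= addrAC subrr add0r.
    by case: eqVneq => [e4|h4]; rewrite ?e4 !simpl.
  case: eqVneq => [e3|h3]; first by rewrite ?e3 !simpl /= addrAC subrr add0r.
  by case: eqVneq => [e4|h4]; rewrite ?e4 !simpl.
have E3 c d : Fb F (v2 c ++ w2 c) (v2 d ++ w2 d) = F (sigma' c) (sigma' d).
  rewrite -Fb11; apply: Fb_eqv => f; rewrite !ev_cat /v2 /w2 /sigma'.
    case: eqVneq => [e3|h3]; first by rewrite ?e3 [s == - s]eq_sym sNs !simpl.
    by case: eqVneq => [e4|h4]; rewrite !simpl //= addrAC subrr add0r.
  case: eqVneq => [e3|h3]; first by rewrite ?e3 [s == - s]eq_sym sNs !simpl.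
  by case: eqVneq => [e4|h4]; rewrite !simpl //= addrAC subrr add0r.
exists (fun x y => exists2 e, (exists2 g, exp_rel (k *: F u (- s)) x g &
  exp_rel ((- k) *: F s (- u)) g e) & exp_rel ((- sg s) *: F (- s) u) e y).
  apply: corr_comp; last exact: exp_rel_corr.
  by apply: corr_comp; exact: exp_rel_corr.
move=> c d; exists (Fb F (v2 c) (v2 d)); last by rewrite -E3; exact: S3.
exists (Fb F (v0 c ++ w0 c) (v0 d ++ w0 d)); last by rewrite -E12; exact: S2.
by rewrite -(Fb11 F (sigma c)); exact: S1.
Qed.

Definition idx n := (bool * 'I_n)%type.
Definition io n (c : idx n) : int := if c.1 then - (c.2.+1)%:Z else (c.2.+1)%:Z.
Definition ishift m (i : int) : int := if i < 0 then i - m%:Z else i + m%:Z.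

(** The pairs of indices move one at a time, from j to j + m. The bound n <= m keeps the target of
    each move outside the indices in use, as [swap_pair] requires. *)
Lemma io_shift (D : int -> Prop) F n m : gfam D F -> (forall i : int, i != 0 -> D i) ->
  (n <= m)%N -> exists2 Rl : A -> A -> Prop, corr Rl &
    forall c d : idx n, Rl (F (io c) (io d)) (F (ishift m (io c)) (ishift m (io d))).
Proof.
move=> gF D0 nm.
pose sigma j (c : idx n) := if (c.2 < j)%N then ishift m (io c) else io c.
have H j : (j <= n)%N -> exists2 Rl : A -> A -> Prop, corr Rl &
    forall c d : idx n, Rl (F (io c) (io d)) (F (sigma j c) (sigma j d)).
  elim: j => [|j IH] jn; first by exists eq; first exact: corr_refl.
  have [R1 H1 H2] := IH (ltnW jn).
  have io0 (c : idx n) : io c != 0 by rewrite /io; case: c.1.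
  have bd (c : idx n) : (c.2 < n)%N by [].
  have h1 c : D (sigma j c).
    apply: D0; rewrite /sigma /ishift; move: (io0 c); rewrite /io.
    by case: (c.2 < j)%N; case: c.1 => //=; try case: ifP; lia.
  have h2 : j.+1%:Z != (j.+1 + m)%N%:Z by lia.
  have h3 c : sigma j c != (j.+1 + m)%N%:Z /\ sigma j c != - (j.+1 + m)%N%:Z.
    by have := bd c; rewrite /sigma /ishift /io; case: (boolP (c.2 < j)%N) => ?; case: c.1 => /=; split; try case: ifP; lia.
  have s0 : 0 < j.+1%:Z by [].
  have u0 : 0 < (j.+1 + m)%N%:Z by [].
  have [d1 d2] : D j.+1%:Z /\ D (- j.+1%:Z) by split; apply: D0.
  have [d3 d4] : D (j.+1 + m)%N%:Z /\ D (- (j.+1 + m)%N%:Z) by split; apply: D0.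
  have [R2 H3 H4] := swap_pair gF h1 s0 u0 h2 d1 d2 d3 d4 h3.
  exists (fun a b => exists2 e, R1 a e & R2 e b); first exact: corr_comp.
  move=> c d; exists (F (sigma j c) (sigma j d)) => //.
  have E (c' : idx n) : sigma j.+1 c' = if sigma j c' == j.+1 then (j.+1 + m)%N%:Z
      else if sigma j c' == - j.+1%:Z then - (j.+1 + m)%N%:Z else sigma j c'.
    have := bd c'; rewrite /sigma /ishift /io ltnS.
    by case: c'.1; case: (ltngtP c'.2 j) => ? /= ?; do ?[case: ifP => ? /=]; lia.
  by rewrite !E; apply: H4.
have [R1 H1 H2] := H n (leqnn n); exists R1 => // c d.
by have := H2 c d; rewrite /sigma !ltn_ord.
Qed.
End Families.
End Forms.

(** * Injective and locally nilpotent elements *)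

Definition Dm (m : nat) (i : int) : Prop := (m < absz i)%N.

Section Isotropic.
Variable C : numClosedFieldType.
Variable sp : bool.
Local Notation eps := (form_eps C sp).
Local Notation Bf := (form_B C sp).

Section Alg.
Variable A : algType C.
Variable rho : int -> int -> A.

Inductive isoP (I : int -> Prop) : A -> Prop :=
| iso_gen i j : I i -> I j -> isoP I (rho i j)
| iso_one : isoP I 1
| iso_add f g : isoP I f -> isoP I g -> isoP I (f + g)
| iso_mul f g : isoP I f -> isoP I g -> isoP I (f * g)
| iso_scale c f : isoP I f -> isoP I (c *: f).

(** The case i = j is included, so 0 is excluded too. The vectors e_i span an isotropic subspace,
    which makes the operators [rho i j] commute. *)
Definition isoset m (I : int -> Prop) :=
  (forall i, I i -> Dm m i) /\ (forall i j, I i -> I j -> j != - i).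

Lemma isoP_sub (I J : int -> Prop) f : (forall i, I i -> J i) -> isoP I f -> isoP J f.
Proof.
move=> IJ; elim=> [i j Ii Ij||f' g _ hf _ hg|f' g _ hf _ hg|c f' _ hf].
- by apply: iso_gen; apply: IJ.
- exact: iso_one.
- exact: iso_add.
- exact: iso_mul.
- exact: iso_scale.
Qed.

Lemma isoP_comm (I : int -> Prop) (z f : A) :
  (forall i j, I i -> I j -> comm0 z (rho i j)) -> isoP I f -> comm0 z f.
Proof.
move=> h; elim=> [i j Ii Ij||f' g _ hf _ hg|f' g _ hf _ hg|c f' _ hf].
- exact: h.
- exact: commr1.
- exact: commrD.
- exact: commrM.
- by rewrite /comm0 -scalerAl -scalerAr hf.
Qed.

Variable m : nat.
Hypothesis gr : gfam sp (Dm m) rho.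

Lemma iso_gen_comm I i j k l : isoset m I -> I i -> I j -> I k -> I l ->
  lieb (rho i j) (rho k l) = 0.
Proof.
move=> [h1 h2] Ii Ij Ik Il; rewrite (gf_br gr); try exact: h1.
by rewrite !(@Bf0 C) ?h2 // !mulr0 !scale0r subrr addr0 subr0.
Qed.

Lemma isoP_commP I f g : isoset m I -> isoP I f -> isoP I g -> comm0 f g.
Proof.
move=> hI hf; apply: isoP_comm => k l Ik Il; apply/commr_sym.
apply: isoP_comm hf => i j Ii Ij; apply/lieb0P; exact: (iso_gen_comm hI).
Qed.

(** The index is one less than the number of brackets with generators after which 0 is reached. *)
Fixpoint adnil (I : int -> Prop) (n : nat) (Z : A) : Prop :=
  if n is n'.+1 then forall i j, I i -> I j -> adnil I n' (lieb (rho i j) Z)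
  else forall i j, I i -> I j -> lieb (rho i j) Z = 0.

Lemma adnilD I n Z Z' : adnil I n Z -> adnil I n Z' -> adnil I n (Z + Z').
Proof.
elim: n Z Z' => [|n IH] Z Z' h h' i j Ii Ij; rewrite liebDr; first by rewrite h ?h' ?addr0.
by apply: IH; [apply: h | apply: h'].
Qed.
Lemma adnilZ I n c Z : adnil I n Z -> adnil I n (c *: Z).
Proof.
elim: n Z => [|n IH] Z h i j Ii Ij; rewrite liebZr; first by rewrite h ?scaler0.
by apply: IH; apply: h.
Qed.
Lemma adnilMl I n f Z : isoset m I -> isoP I f -> adnil I n Z -> adnil I n (f * Z).
Proof.
move=> hI hf; elim: n Z => [|n IH] Z h i j Ii Ij.
  rewrite liebMr h // mulr0 add0r (_ : lieb _ _ = 0) ?mul0r //.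
  by apply/lieb0P; apply: isoP_commP hI _ hf; apply: iso_gen.
rewrite liebMr (_ : lieb _ f = 0) ?mul0r ?addr0; first by apply: IH; apply: h.
by apply/lieb0P; apply: isoP_commP hI _ hf; apply: iso_gen.
Qed.
Lemma adnilMr I n f Z : isoset m I -> isoP I f -> adnil I n Z -> adnil I n (Z * f).
Proof.
move=> hI hf; elim: n Z => [|n IH] Z h i j Ii Ij.
  rewrite liebMr h // mul0r addr0 (_ : lieb _ _ = 0) ?mulr0 //.
  by apply/lieb0P; apply: isoP_commP hI _ hf; apply: iso_gen.
rewrite liebMr (_ : lieb _ f = 0) ?mulr0 ?add0r; first by apply: IH; apply: h.
by apply/lieb0P; apply: isoP_commP hI _ hf; apply: iso_gen.
Qed.
Lemma adnil0P I f Z : isoset m I -> isoP I f -> adnil I 0 Z -> lieb f Z = 0.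
Proof.
move=> hI hf h; apply/lieb_sym0/lieb0P; apply: isoP_comm hf => i j Ii Ij.
by apply/lieb0P/lieb_sym0/h.
Qed.
Lemma adnilSP I n f Z : isoset m I -> isoP I f -> adnil I n.+1 Z -> adnil I n (lieb f Z).
Proof.
move=> hI hf h; elim: hf => [i j Ii Ij||f' g hf IHf hg IHg|f' g hf IHf hg IHg|c f' hf IHf].
- exact: h.
- rewrite lieb1l -(scale0r Z).
  have z0 k : adnil I k 0 by elim: k => [|k IH] i j Ii Ij; rewrite lieb0r.
  by rewrite scale0r.
- by rewrite liebDl; apply: adnilD.
- by rewrite liebMl; apply: adnilD; [apply: adnilMl | apply: adnilMr].
- by rewrite liebZl; apply: adnilZ.
Qed.

(** Viewed on vectors, a bracket with a generator moves one of the two arguments of [rho a b] into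
    the span of I and kills an argument that is already there. After two brackets both arguments lie
    in that span, and the third bracket gives 0. *)
Lemma adnil_fam I a b : isoset m I -> Dm m a -> Dm m b -> adnil I 2 (rho a b).
Proof.
move=> hI Da Db; have [I1 I2] := hI.
pose inI (v : vec C) := forall p, p \in v -> I p.2.
pose inD (v : vec C) := forall p, p \in v -> Dm m p.2.
have ID v : inI v -> inD v by move=> h p /h /I1.
have actI k i j v : I i -> I j -> inI (act sp k i j v).
  move=> Ii Ij; elim: v => [|q v IH] p //; rewrite act_cons !inE => /orP [/eqP ->|/orP [/eqP ->|/IH]] //.
have act0 k i j v : I i -> I j -> inI v -> eqv A (act sp k i j v) [::].
  move=> Ii Ij; elim: v => [|q v IH] h f; first by rewrite act_nil.
  rewrite act_cons !ev_cons IH; last by move=> p pv; apply: h; rewrite inE pv orbT.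
  have Iq : I q.2 by apply: h; rewrite inE eqxx.
  by rewrite /= !(@Bf0 C) ?I2 // !(mulr0, mul0r, oppr0, scale0r, addr0, ev_nil).
have lb i j v w : I i -> I j -> inD v -> inD w ->
    lieb (rho i j) (Fb rho v w) = Fb rho (act sp 1 i j v) w + Fb rho v (act sp 1 i j w).
  move=> Ii Ij hv hw; rewrite -(lieb_Fb 1 gr) ?scale1r //; exact: I1.
have K0 v w : inI v -> inI w -> adnil I 0 (Fb rho v w).
  move=> hv hw i j Ii Ij; rewrite lb //; try exact: ID.
  rewrite (Fb_eqv _ (act0 _ _ _ _ Ii Ij hv) (fun f => erefl)).
  by rewrite (Fb_eqv _ (fun f => erefl) (act0 _ _ _ _ Ii Ij hw)) Fb_nill Fb_nilr addr0.
have K1 v w : inI v -> inD w -> adnil I 1 (Fb rho v w).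
  move=> hv hw i j Ii Ij; rewrite lb //; try exact: ID.
  rewrite (Fb_eqv _ (act0 _ _ _ _ Ii Ij hv) (fun f => erefl)) Fb_nill add0r.
  by apply: K0 => //; apply: actI.
have K1' v w : inD v -> inI w -> adnil I 1 (Fb rho v w).
  move=> hv hw i j Ii Ij; rewrite lb //; try exact: ID.
  rewrite [X in _ + X](Fb_eqv _ (fun f => erefl) (act0 _ _ _ _ Ii Ij hw)) Fb_nilr addr0.
  by apply: K0 => //; apply: actI.
have hs c : Dm m c -> inD [:: (1, c)] by move=> Dc p; rewrite inE => /eqP ->.
rewrite -(Fb11 rho a b) => i j Ii Ij; rewrite lb //; try exact: hs.
apply: (@adnilD I 1); [apply: K1; [exact: actI | exact: hs] | apply: K1'; [exact: hs | exact: actI]].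
Qed.

End Alg.

Section Dichotomy.
Definition dich (V : nzmod C) m (rho : int -> int -> End V) :=
  forall I f, isoset m I -> isoP rho I f -> injop f \/ locnilp f.

(** From f Z = Z f + [f, Z], by induction on n, which drops for [f, Z], and then on k, which drops
    for f v. *)
Lemma adnil_torsion (V : nzmod C) m (rho : int -> int -> End V) I (f : End V) :
  gfam sp (Dm m) rho -> isoset m I -> isoP rho I f ->
  forall n Z k v, adnil rho I n Z -> (f ^+ k) v = 0 -> (f ^+ (k + n)) (Z v) = 0.
Proof.
move=> gr hI hf; elim=> [|n IHn] Z k; elim: k => [|k IHk] v hZ hv.
- by rewrite /= in hv; rewrite hv efun0.
- rewrite addn0 end_expSr; have /lieb0P := adnil0P hI hf hZ.
  move/(congr1 (fun g : End V => g v)); rewrite !endME => ->.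
  by have := IHk (f v) hZ; rewrite addn0 -end_expSr; apply.
- by rewrite expr0 in hv; rewrite (_ : v = 0) ?efun0.
- rewrite addSn end_expSr.
  have -> : f (Z v) = Z (f v) + (lieb f Z) v by rewrite endBE !endME addrC subrK.
  rewrite efunD IHk //; last by rewrite -end_expSr.
  by rewrite add0r addnS -addSn IHn //; exact: (adnilSP gr hI hf hZ).
Qed.

Lemma dich_simple (V : nzmod C) m (rho : int -> int -> End V) : gfam sp (Dm m) rho ->
  (forall S : V -> Prop, (forall v w, S v -> S w -> S (v + w)) ->
    (forall c v, S v -> S (c *: v)) ->
    (forall a b v, Dm m a -> Dm m b -> S v -> S (rho a b v)) ->
    (exists v, S v /\ v != 0) -> forall w, S w) -> dich m rho.
Proof.
move=> gr simpl I f hI hf.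
have [[v [v0 [k hk]]]|nex] := pselect (exists v, v != 0 /\ exists k, (f ^+ k) v = 0); last first.
  left=> v hv; apply: contrapT => v0; apply: nex; exists v; split; first exact/eqP.
  by exists 1%N.
right; apply: (simpl (fun v => exists k, (f ^+ k) v = 0)); last by exists v; split; first exists k.
- move=> u w [i hi] [j hj]; exists (maxn i j); rewrite efunD.
  by rewrite (end_exp_le (leq_maxl i j) hi) (end_exp_le (leq_maxr i j) hj) addr0.
- by move=> c u [i hi]; exists i; rewrite efunZ hi scaler0.
- move=> a b u Da Db [i hi]; exists (i + 2)%N.
  exact: (adnil_torsion gr hI hf (adnil_fam gr hI Da Db) hi).
Qed.

End Dichotomy.
End Isotropic.

(** * Splitting off canonical variables *)

(** The quadratic expressions through which the Lie algebra acts on canonical variables: [om2] for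
    two conjugate rows, [om1] for one self-conjugate row, where the two orders of a product differ
    by a scalar and are averaged. *)
Definition om2 (C : numClosedFieldType) (sp : bool) (A : algType C) (I : Type) (ep em : I -> A) (k l : I) : A :=
  ep l * em k - form_eps C sp *: (ep k * em l).
Definition om1 (C : numClosedFieldType) (A : algType C) (I : Type) (th : I -> A) (k l : I) : A :=
  2^-1 *: (th k * th l + th l * th k).

Lemma om2_comm (C : numClosedFieldType) (sp : bool) (A : algType C) (I : Type) (ep em : I -> A) k l (y : A) :
  comm0 y (ep k) -> comm0 y (ep l) -> comm0 y (em k) ->
  comm0 y (em l) -> comm0 y (om2 sp ep em k l).
Proof.
move=> h1 h2 h3 h4; apply: commrD; first exact: commrM.
by apply: commrN; rewrite /GRing.comm -scalerAl -scalerAr; congr (_ *: _); apply: commrM.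
Qed.

Section Splitting.
Variable C : numClosedFieldType.
Variable sp : bool.
Local Notation eps := (form_eps C sp).
Local Notation Bf := (form_B C sp).
Variable A : algType C.
Variable D : int -> Prop.
Hypothesis D0 : forall i, D i -> i != 0.
Variable r : int -> int -> A.
Hypothesis gr : gfam sp D r.

(* [t] transforms under [r] like the standard basis of the natural module *)
Definition vecfam (t : int -> A) := forall k l p, D k -> D l -> D p ->
  lieb (r k l) (t p) = Bf l p *: t k - (eps * Bf k p) *: t l.

(** Since om commutes with r - om, the bracket of two differences r - om equals [r, r - om], and r
    acts on r and on om by the same formula. *)
Lemma split_gfam (om : int -> int -> A) :
  (forall k l, D k -> D l -> om l k = - eps *: om k l) ->
  (forall a b c d, D a -> D b -> D c -> D d -> lieb (r a b) (om c d) =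
    Bf b c *: om a d - (eps * Bf a c) *: om b d + Bf b d *: om c a - (eps * Bf a d) *: om c b) ->
  (forall a b c d, D a -> D b -> D c -> D d -> lieb (om a b) (r c d - om c d) = 0) ->
  gfam sp D (fun k l => r k l - om k l).
Proof.
move=> h1 h2 h3; split=> [i j Di Dj|a b c d Da Db Dc Dd].
  by rewrite (gf_sym gr) // h1 // scalerBr.
rewrite liebBl h3 // subr0 liebBr h2 // (gf_br gr) //.
rewrite !scalerBr; set x1 := _ *: r a d; set x2 := _ *: r b d; set x3 := _ *: r c a.
set x4 := _ *: r c b; set y1 := _ *: om a d; set y2 := _ *: om b d; set y3 := _ *: om c a.
set y4 := _ *: om c b.
ncr.
Qed.

Section Pair.
Variables ep em : int -> A.
Hypotheses (hp : vecfam ep) (hm : vecfam em).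
Hypothesis hpm : forall k l, D k -> D l -> lieb (ep k) (em l) = Bf k l *: 1.
Hypothesis hpp : forall k l, D k -> D l -> lieb (ep k) (ep l) = 0.
Hypothesis hmm : forall k l, D k -> D l -> lieb (em k) (em l) = 0.

Local Notation omp := (om2 sp ep em).

Lemma om2_ep k l p : D k -> D l -> D p -> lieb (omp k l) (ep p) = lieb (r k l) (ep p).
Proof.
move=> Dk Dl Dp; rewrite hp // /om2 liebBl liebZl !liebMl !hpp // !mul0r !addr0.
rewrite ![lieb (em _) _]liebC !hpm // !mulrN -!scalerAr !mulr1.
rewrite !(BfC C sp _ (D0 Dp)) mulrA epsK mul1r scalerN scalerA; ncr.
Qed.

Lemma om2_em k l p : D k -> D l -> D p -> lieb (omp k l) (em p) = lieb (r k l) (em p).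
Proof.
move=> Dk Dl Dp; rewrite hm // /om2 liebBl liebZl !liebMl !hmm // !mulr0 !add0r.
by rewrite !hpm // -!scalerAl !mul1r scalerA.
Qed.

Lemma om2_sym k l : D k -> D l -> omp l k = - eps *: omp k l.
Proof.
move=> Dk Dl; rewrite /om2 scalerBr !scaleNr opprK scalerA epsK scale1r addrC //.
Qed.

Lemma om2_br a b c d : D a -> D b -> D c -> D d -> lieb (r a b) (omp c d) =
    Bf b c *: omp a d - (eps * Bf a c) *: omp b d + Bf b d *: omp c a - (eps * Bf a d) *: omp c b.
Proof.
move=> Da Db Dc Dd; rewrite /om2 liebBr liebZr !liebMr !hp // !hm //.
have [->|->] : eps = 1 \/ eps = -1 by rewrite /form_eps; case: sp; [right | left].
  rewrite !mul1r !scale1r !mulrBr !mulrBl -!scalerAr -!scalerAl !scalerBr.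
  do ?[move: (_ *: (_ * _)) => ?].
  by ncr.
rewrite !mulN1r !scaleN1r !scaleNr !opprK !mulrDr !mulrDl -!scalerAr -!scalerAl !scalerDr.
do ?[move: (_ *: (_ * _)) => ?].
by ncr.
Qed.

Lemma pair_split : [/\ gfam sp D (fun k l => r k l - omp k l),
  forall k l p, D k -> D l -> D p -> comm0 (r k l - omp k l) (ep p) &
  forall k l p, D k -> D l -> D p -> comm0 (r k l - omp k l) (em p)].
Proof.
have c1 k l p : D k -> D l -> D p -> comm0 (r k l - omp k l) (ep p).
  by move=> Dk Dl Dp; apply/lieb0P; rewrite liebBl om2_ep // subrr.
have c2 k l p : D k -> D l -> D p -> comm0 (r k l - omp k l) (em p).
  by move=> Dk Dl Dp; apply/lieb0P; rewrite liebBl om2_em // subrr.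
split=> //; apply: split_gfam; [exact: om2_sym | exact: om2_br |].
move=> a b c d Da Db Dc Dd; apply/lieb_sym0/lieb0P.
by apply: om2_comm; [apply: c1 | apply: c1 | apply: c2 | apply: c2].
Qed.

End Pair.

Section Single.
Hypothesis sp_true : sp.
Variable th : int -> A.
Hypothesis hth : vecfam th.
Hypothesis htt : forall k l, D k -> D l -> lieb (th k) (th l) = Bf k l *: 1.

Local Notation oms := (om1 th).

Let epsN : eps = -1. Proof. by rewrite /form_eps sp_true. Qed.

Lemma om1_th k l p : D k -> D l -> D p -> lieb (oms k l) (th p) = lieb (r k l) (th p).
Proof.
move=> Dk Dl Dp; rewrite hth // /om1 liebZl liebDl !liebMl !htt // epsN mulN1r scaleNr opprK.
rewrite -!scalerAr -!scalerAl !mulr1 !mul1r.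
set x := _ *: th k; set y := _ *: th l.
have -> : x + y + (y + x) = 2 *: (x + y) by rewrite scaler_nat mulr2n; ncr.
by rewrite scalerA mulVf ?scale1r // pnatr_eq0.
Qed.

Lemma om1_sym k l : oms l k = - eps *: oms k l.
Proof. by rewrite epsN opprK scale1r /om1 addrC. Qed.

Lemma om1_br a b c d : D a -> D b -> D c -> D d -> lieb (r a b) (oms c d) =
    Bf b c *: oms a d - (eps * Bf a c) *: oms b d + Bf b d *: oms c a - (eps * Bf a d) *: oms c b.
Proof.
move=> Da Db Dc Dd; rewrite /om1 liebZr liebDr !liebMr !hth // epsN.
rewrite !mulN1r !scaleNr !opprK ![_ *: (2^-1 *: _)]scalerA ![_ / 2]mulrC -![(2^-1 * _) *: _]scalerA.
rewrite -!scalerDr; congr (_ *: _).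
rewrite !mulrDr !mulrDl -!scalerAr -!scalerAl !scalerDr.
do ?[move: (_ *: (_ * _)) => ?].
by ncr.
Qed.

Lemma om1_comm k l (y : A) : comm0 y (th k) -> comm0 y (th l) -> comm0 y (oms k l).
Proof.
move=> h1 h2; rewrite /comm0 -scalerAl -scalerAr; congr (_ *: _).
by apply: commrD; apply: commrM.
Qed.

Lemma single_split : gfam sp D (fun k l => r k l - oms k l) /\
  forall k l p, D k -> D l -> D p -> comm0 (r k l - oms k l) (th p).
Proof.
have c1 k l p : D k -> D l -> D p -> comm0 (r k l - oms k l) (th p).
  by move=> Dk Dl Dp; apply/lieb0P; rewrite liebBl om1_th // subrr.
split=> //; apply: split_gfam; [move=> k l _ _; exact: om1_sym | exact: om1_br |].
move=> a b c d Da Db Dc Dd; apply/lieb_sym0/lieb0P.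
by apply: om1_comm; apply: c1.
Qed.
End Single.
End Splitting.

Section Rows.
Variable C : numClosedFieldType.
Variable sp : bool.
Local Notation eps := (form_eps C sp).
Local Notation Bf := (form_B C sp).

Lemma Dm_neq0 m i : Dm m i -> i != 0. Proof. by rewrite /Dm; lia. Qed.

Lemma gfam_corr (A A' : algType C) (Rl : A -> A' -> Prop) (D D' : int -> Prop) r r' :
  corr Rl -> (forall i, D' i -> D i) ->
  (forall k l, D' k -> D' l -> Rl (r k l) (r' k l)) -> gfam sp D r -> gfam sp D' r'.
Proof.
move=> HR DD h gr; split=> [i j Di Dj|a b c d Da Db Dc Dd].
  apply/(corr_eq HR (h _ _ Dj Di) (corrZ HR _ (h _ _ Di Dj))).
  by apply: (gf_sym gr); apply: DD.
have R1 := corrL HR (h _ _ Da Db) (h _ _ Dc Dd).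
have R2 := corrB HR (corrD HR (corrB HR (corrZ HR (Bf b c) (h _ _ Da Dd))
  (corrZ HR (eps * Bf a c) (h _ _ Db Dd))) (corrZ HR (Bf b d) (h _ _ Dc Da)))
  (corrZ HR (eps * Bf a d) (h _ _ Dc Db)).
by apply/(corr_eq HR R1 R2); apply: (gf_br gr); apply: DD.
Qed.

Section Alg.
Variables (A : algType C) (m m' : nat) (rho : int -> int -> A) (I : int -> Prop).
Hypothesis gr : gfam sp (Dm m) rho.
Hypothesis hI : isoset m I.
Hypothesis Im : forall i, I i -> (absz i <= m')%N.
Hypothesis mm : (m <= m')%N.

Definition frow (w : vec C) (k : int) : A := ev (fun i => rho i k) w.
Definition inI (w : vec C) := forall p, p \in w -> I p.2.

Lemma Dm_le k : Dm m' k -> Dm m k. Proof. by rewrite /Dm; apply: leq_ltn_trans. Qed.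
Lemma BfI i k : I i -> Dm m' k -> Bf i k = 0.
Proof. by move=> /Im h1 h2; apply: Bf0; move: h1 h2; rewrite /Dm; lia. Qed.
Lemma BfI' i k : I i -> Dm m' k -> Bf k i = 0.
Proof. by move=> /Im h1 h2; apply: Bf0; move: h1 h2; rewrite /Dm; lia. Qed.
Lemma BfII i j : I i -> I j -> Bf i j = 0.
Proof. by move=> h1 h2; apply: Bf0; apply: (hI.2). Qed.

Lemma lieb_evl x f (v : vec C) : lieb (ev f v) x = ev (fun i => lieb (f i : A) x) v.
Proof. by rewrite /ev lieb_suml; apply: eq_bigr => p _; rewrite liebZl. Qed.
(** B pairs no index of I with an index beyond m', so a bracket with [rho k l] acts on the outer
    index of the row alone. *)
Lemma row_vecfam w : inI w -> vecfam sp (Dm m') rho (frow w).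
Proof.
move=> hw k l p Dk Dl Dp; rewrite /frow lieb_ev -!evZ -evN -evD.
apply: eq_ev => q /hw Iq; rewrite (gf_br gr) ?(BfI' Iq Dk) ?(BfI' Iq Dl) //; try exact: (hI.1); try exact: Dm_le.
by rewrite mulr0 !scale0r subrr add0r.
Qed.

(** All pairings within I, and between I and the outer indices, vanish. The one surviving term
    carries a polynomial over I, which by [iso_comm_row] commutes with the rows and can be divided
    out when it is invertible. *)
Lemma row_row w w' k l : inI w -> inI w' -> Dm m' k -> Dm m' l ->
  lieb (frow w k) (frow w' l) = Bf k l *: ev (frow w') w.
Proof.
move=> hw hw' Dk Dl; rewrite -evZ /frow lieb_evl.
apply: eq_ev => p /hw Ip; rewrite lieb_ev -evZ.
apply: eq_ev => q /hw' Iq; rewrite (gf_br gr) ?(BfI' Iq Dk) ?(BfII Ip Iq) ?(BfI Ip Dl) //;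
  try exact: (hI.1); try exact: Dm_le.
by rewrite !mulr0 !scale0r !(subr0, add0r, addr0).
Qed.

Lemma iso_comm_out f k l : isoP rho I f -> Dm m' k -> Dm m' l -> comm0 f (rho k l).
Proof.
move=> hf Dk Dl; apply/commr_sym; apply: isoP_comm hf => i j Ii Ij.
apply/commr_sym/lieb0P; rewrite (gf_br gr) ?(BfI Ii) ?(BfI Ij) //;
  try exact: (hI.1); try exact: Dm_le.
by rewrite !mulr0 !scale0r !(subr0, add0r, addr0).
Qed.

Lemma iso_comm_row f w k : isoP rho I f -> inI w -> Dm m' k -> comm0 f (frow w k).
Proof.
move=> hf hw Dk; apply/commr_sym; apply: isoP_comm hf => i j Ii Ij.
apply/commr_sym/lieb0P; rewrite lieb_ev /ev big1_seq // => p /andP [_ /hw Ip].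
rewrite (gf_br gr) ?(BfI _ Dk) ?BfII //; try exact: (hI.1); try exact: Dm_le.
by rewrite !mulr0 !scale0r !(subr0, add0r, addr0) scaler0.
Qed.

Lemma isoP_ev (J : int -> Prop) f (w : vec C) : (forall p, p \in w -> isoP rho J (f p.2)) ->
  isoP rho J (ev f w).
Proof.
move=> h; rewrite /ev big_seq; elim/big_rec: _ => [|p z /h hp hz].
  by rewrite -(scale0r 1); apply/iso_scale/iso_one.
by apply: iso_add => //; apply: iso_scale.
Qed.

Lemma isoP_row w k : inI w -> isoP rho (fun i => I i \/ i = k) (frow w k).
Proof. by move=> hw; apply: isoP_ev => p /hw Ip; apply: iso_gen; [left | right]. Qed.

End Alg.

(* [rho] is identified with [rho' + om] outside the indices bounded by [m'], where [om] is
   built from the new canonical variables [E]; [L] lifts the variables found earlier. *)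
Record extension (V : nzmod C) m (rho : int -> int -> End V) (V' : nzmod C) m'
    (rho' om : int -> int -> End V') (E : End V' -> Prop)
    (Rl : End V -> End V' -> Prop) (L : End V -> End V') : Prop := Extension {
  ex_m : (m <= m')%N;
  ex_gf : gfam sp (Dm m') rho';
  ex_dich : dich m' rho';
  ex_corr : corr Rl;
  ex_rel : forall k l, Dm m' k -> Dm m' l -> Rl (rho k l) (rho' k l + om k l);
  ex_lift : forall b, (forall k l, Dm m k -> Dm m l -> comm0 b (rho k l)) ->
    [/\ Rl b (L b), forall k l, Dm m' k -> Dm m' l -> comm0 (L b) (rho' k l) &
      forall e, E e -> comm0 (L b) e];
  ex_comm : forall e, E e -> forall k l, Dm m' k -> Dm m' l -> comm0 e (rho' k l) }.

Section Step.
Variables (V : nzmod C) (m m' : nat) (rho : int -> int -> End V) (I : int -> Prop).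
Hypothesis gr : gfam sp (Dm m) rho.
Hypothesis hD : dich m rho.
Hypothesis hI : isoset m I.
Hypothesis Im : forall i, I i -> (absz i <= m')%N.
Hypothesis mm : (m <= m')%N.
Variable x : End V.
Hypothesis hx : isoP rho I x.
Variables (V' : nzmod C) (L : End V -> End V') (z : End V').
Hypothesis ad : adjoined x L z.
Let HR := ad_corr ad.
Let Rl a b := comm0 a x /\ b = L a.

Lemma ad_intro a : comm0 a x -> Rl a (L a). Proof. by []. Qed.
Lemma ad_commL a b : comm0 a x -> comm0 b x -> comm0 a b -> comm0 (L a) (L b).
Proof. by move=> ha hb; apply: (corr_comm HR (a := a) (a' := b)). Qed.
Lemma adM a b : comm0 a x -> comm0 b x -> L (a * b) = L a * L b.
Proof. by move=> ha hb; have [_ <-] := corrM HR (ad_intro ha) (ad_intro hb). Qed.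
Lemma adD a b : comm0 a x -> comm0 b x -> L (a + b) = L a + L b.
Proof. by move=> ha hb; have [_ <-] := corrD HR (ad_intro ha) (ad_intro hb). Qed.
Lemma adZ c a : comm0 a x -> L (c *: a) = c *: L a.
Proof. by move=> ha; have [_ <-] := corrZ HR c (ad_intro ha). Qed.
Lemma ad1 : L 1 = 1. Proof. by have [_ <-] := corr1 HR. Qed.

(** Multiplied by a power of the invertible [L x], a polynomial in [rho'] over J becomes the lift of
    a polynomial in [rho] over the union of I and J. That union is isotropic because J lies beyond
    m', so the dichotomy for [rho] applies. *)
Lemma dich_step (rho' : int -> int -> End V') :
  (forall k l, Dm m' k -> Dm m' l -> exists2 y, isoP rho (fun i => I i \/ i = k \/ i = l) y &
     L x * rho' k l = L y) ->
  (forall k l, Dm m' k -> Dm m' l -> comm0 (L x) (rho' k l)) -> dich m' rho'.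
Proof.
move=> hy hc J f hJ hf; pose K i := I i \/ J i.
have hK : isoset m K.
  have cross i j : I i -> J j -> j != - i /\ i != - j.
    by move=> /Im h1 /(proj1 hJ); rewrite /Dm; split; lia.
  split=> [i [/(proj1 hI)//|/(proj1 hJ)]|i j]; first exact: leq_ltn_trans.
  move=> [hi|hi] [hj|hj]; [exact: (proj2 hI) | by have [] := cross i j | by have [] := cross j i |].
  exact: (proj2 hJ).
have xK g : isoP rho K g -> comm0 g x.
  by move=> hg; apply: (isoP_commP gr hK hg); apply: isoP_sub hx; left.
have LxLx : comm0 (L x) (L x) by [].
have cf : comm0 (L x) f.
  by apply: isoP_comm hf => i j Ji Jj; apply: hc; apply: (proj1 hJ).
have [n [g hg eg]] : exists n, exists2 g, isoP rho K g & L x ^+ n * f = L g.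
  have xg n g : isoP rho K g -> isoP rho K (x ^+ n * g) /\ L (x ^+ n * g) = L x ^+ n * L g.
    move=> hg; have hxK : isoP rho K x by apply: isoP_sub hx; left.
    elim: n => [|n [IH1 IH2]]; first by rewrite !expr0 !mul1r.
    by rewrite !exprS -!mulrA -IH2; split; [exact: iso_mul | apply: adM => //; exact: xK].
  elim: hf cf => {f} [i j Ji Jj||f g hf IHf hg IHg|f g hf IHf hg IHg|c f hf IHf] _.
  - have [y h1 h2] := hy i j (proj1 hJ _ Ji) (proj1 hJ _ Jj); exists 1%N, y => //.
    by apply: isoP_sub h1 => c [|[->|->]]; [left | right | right].
  - by exists 0%N, 1; [apply: iso_one | rewrite mulr1 ad1].
  - have cc h : isoP rho' J h -> comm0 (L x) h.
      by apply: isoP_comm => i j Ji Jj; apply: hc; apply: (proj1 hJ).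
    have [n [f' hf' ef]] := IHf (cc _ hf); have [k [g' hg' eg]] := IHg (cc _ hg).
    have [h1 e1] := xg k f' hf'; have [h2 e2] := xg n g' hg'.
    exists (k + n)%N, (x ^+ k * f' + x ^+ n * g'); first exact: iso_add.
    by rewrite adD; [|exact: xK|exact: xK]; rewrite e1 e2 -ef -eg !mulrA -!exprD mulrDr [(n + k)%N]addnC.
  - have cc h : isoP rho' J h -> comm0 (L x) h.
      by apply: isoP_comm => i j Ji Jj; apply: hc; apply: (proj1 hJ).
    have [n [f' hf' ef]] := IHf (cc _ hf); have [k [g' hg' eg]] := IHg (cc _ hg).
    exists (n + k)%N, (f' * g'); first exact: iso_mul.
    rewrite adM; [|exact: xK|exact: xK]; rewrite -ef -eg exprD !mulrA; congr (_ * _); rewrite -!mulrA; congr (_ * _).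
    exact: (esym (commrX k (commr_sym (cc _ hf)))).
  - have cc h : isoP rho' J h -> comm0 (L x) h.
      by apply: isoP_comm => i j Ji Jj; apply: hc; apply: (proj1 hJ).
    have [n [f' hf' ef]] := IHf (cc _ hf); exists n, (c *: f'); first exact: iso_scale.
    by rewrite adZ; [rewrite -ef scalerAr | exact: xK].
have cxn : comm0 (L x ^+ n) f := commr_sym (commrX n (commr_sym cf)).
have [gi|gn] := hD hK hg.
- left=> v hv; apply: (ad_inj ad (xK _ hg) gi); rewrite -eg.
  by rewrite endME hv efun0.
- right=> v; have [k hk] := ad_nil ad (xK _ hg) gn v; exists k.
  have Lxi : injop (L x ^+ n).
    by apply: injop_exp => u hu; rewrite -[u]end1E -(ad_sq ad) endME hu efun0.
  apply: (injop_exp (k := k) Lxi).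
  by rewrite -endME -exprMn_comm // eg.
Qed.

End Step.

Section Extensions.
Variables (V : nzmod C) (m : nat) (rho : int -> int -> End V).
Hypothesis gr : gfam sp (Dm m) rho.
Hypothesis hD : dich m rho.

(** F(w, w) for w = e_i + e_j. By polarisation these squares control all symplectic root
    operators. *)
Definition sqv (i j : int) : End V := let w := [:: (1, i); (1, j)] in ev (frow rho w) w.

Lemma ext_base (m' : nat) (I : int -> Prop) (x : End V) (V' : nzmod C) L (z : End V')
   om (E : End V' -> Prop) :
  isoset m I -> (forall i, I i -> (absz i <= m')%N) -> (m <= m')%N -> isoP rho I x ->
  (exists i, I i) ->
  adjoined x L z -> gfam sp (Dm m') (fun k l => L (rho k l) - om k l) ->
  dich m' (fun k l => L (rho k l) - om k l) ->
  (forall e, E e -> (forall b, (forall k l, Dm m k -> Dm m l -> comm0 b (rho k l)) -> comm0 (L b) e) /\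
     (forall k l, Dm m' k -> Dm m' l -> comm0 e (L (rho k l) - om k l))) ->
  (forall b, (forall k l, Dm m k -> Dm m l -> comm0 b (rho k l)) ->
     forall k l, Dm m' k -> Dm m' l -> comm0 (L b) (om k l)) ->
  extension m rho m' (fun k l => L (rho k l) - om k l) om E
     (fun a b => comm0 a x /\ b = L a) L.
Proof.
move=> hI Im mm hx Iex ad h1 h2 h3 h4.
have bx b : (forall k l, Dm m k -> Dm m l -> comm0 b (rho k l)) -> comm0 b x.
  by move=> hb; apply: isoP_comm hx => i j Ii Ij; apply: hb; apply: (proj1 hI).
have rx k l : Dm m' k -> Dm m' l -> comm0 (rho k l) x.
  by move=> Dk Dl; apply/commr_sym; apply: (iso_comm_out gr hI Im mm hx).
split=> //; first exact: (ad_corr ad).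
- by move=> k l Dk Dl; rewrite subrK; split=> //; apply: rx.
- move=> b hb; split; first by split=> //; apply: bx.
    move=> k l Dk Dl; apply: commrB; last exact: h4.
    apply: (ad_commL ad); [exact: bx | exact: rx |].
    by apply: hb; apply: (Dm_le mm).
  by move=> e /h3 [h _]; apply: h.
- by move=> e /h3 [].
Qed.

(** The row t_k = F(w, k) satisfies [t_k, t_l] = B(k, l) x with x = F(w, w). By the dichotomy x is
    injective, and the row x^(-1/2) t_k of the enlarged module is canonical. *)
Lemma ext_single (i j : int) : sp -> Dm m i -> Dm m j -> j != - i -> ~ locnilp (sqv i j) ->
  exists (V' : nzmod C) m' (rho' : int -> int -> End V') (th : int -> End V') Rl L,
    extension m rho m' rho' (om1 th) (fun e => exists2 k, Dm m' k & e = th k) Rl L /\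
    forall k l, Dm m' k -> Dm m' l -> lieb (th k) (th l) = Bf k l *: 1.
Proof.
move=> spt Di Dj ij nx; pose w : vec C := [:: (1, i); (1, j)]; pose I k := k = i \/ k = j.
have Iw : inI I w by move=> p; rewrite !inE => /orP [] /eqP ->; [left | right].
have hI : isoset m I.
  split=> [k [->|->]|k l [->|->] [->|->]] //; move: Di Dj ij; rewrite /Dm; lia.
pose m' := maxn (absz i) (absz j).
have Im k : I k -> (absz k <= m')%N by move=> [->|->]; rewrite /m'; lia.
have mm : (m <= m')%N by move: Di; rewrite /Dm /m'; lia.
set x := sqv i j in nx.
have hx : isoP rho I x.
  apply: isoP_ev => p /Iw Ip; apply: isoP_ev => q /Iw Iq; exact: iso_gen.
have xi : injop x by case: (hD hI hx).
have [V' [L [z ad]]] := adjoin_ex xi.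
pose t0 := frow rho w; pose th k := z * L (t0 k).
have HR := ad_corr ad.
have rx k l : Dm m' k -> Dm m' l -> comm0 (rho k l) x.
  by move=> Dk Dl; apply/commr_sym; apply: (iso_comm_out gr hI Im mm hx).
have tx k : Dm m' k -> comm0 (t0 k) x.
  by move=> Dk; apply/commr_sym; apply: (iso_comm_row gr hI Im mm hx).
have Lz a : comm0 a x -> lieb (L a) z = 0 by move=> ax; apply/lieb0P/(ad_zeta ad).
have zL a : comm0 a x -> lieb z (L a) = 0 by move=> ax; apply/lieb_sym0/Lz.
pose r k l := L (rho k l).
have gr' : gfam sp (Dm m') r.
  by apply: (gfam_corr HR (D := Dm m)) gr => [k|k l Dk Dl]; [exact: Dm_le | split; first exact: rx].
have D0 := @Dm_neq0 m'.
have vth : vecfam sp (Dm m') r th.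
  move=> k l p Dk Dl Dp; rewrite /th liebMr (Lz _ (rx _ _ Dk Dl)) mul0r addr0.
  have := row_vecfam gr hI Im mm Iw Dk Dl Dp.
  have R1 := corrL HR (ad_intro L (rx _ _ Dk Dl)) (ad_intro L (tx _ Dp)).
  have R2 := corrB HR (corrZ HR (Bf l p) (ad_intro L (tx _ Dk))) (corrZ HR (eps * Bf k p) (ad_intro L (tx _ Dl))).
  by move/(corr_eq HR R1 R2) ->; rewrite mulrBr !scalerAr.
have thth k l : Dm m' k -> Dm m' l -> lieb (th k) (th l) = Bf k l *: 1.
  move=> Dk Dl; rewrite /th (lieb_scaled (zL _ (tx _ Dk)) (zL _ (tx _ Dl))).
  have := row_row gr hI Im mm Iw Iw Dk Dl.
  have xx : comm0 x x by [].
  have R1 := corrL HR (ad_intro L (tx _ Dk)) (ad_intro L (tx _ Dl)).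
  have R2 := corrZ HR (Bf k l) (ad_intro L xx).
  by move/(corr_eq HR R1 R2) ->; rewrite -!scalerAr (ad_sq ad).
have zzx : L x * (z * z) = 1.
  by rewrite -[RHS](ad_sq ad); apply: commrM; exact: (ad_zeta ad).
have Lxtt k l : Dm m' k -> Dm m' l -> L x * (th k * th l) = L (t0 k) * L (t0 l).
  move=> Dk Dl; rewrite /th -!mulrA [L (t0 k) * (z * _)]mulrA (ad_zeta ad (tx _ Dk)) -!mulrA.
  by rewrite [z * (z * _)]mulrA mulrA zzx mul1r.
have Lxth k : Dm m' k -> comm0 (L x) (th k).
  move=> Dk; apply: commrM; first exact: (ad_zeta ad).
  by apply: (ad_commL ad) => //; [exact: tx | exact/commr_sym/tx].
have [gs cs] := single_split gr' spt vth thth.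
have lb b : (forall k l, Dm m k -> Dm m l -> comm0 b (rho k l)) -> forall k, Dm m' k -> comm0 (L b) (th k).
  move=> hb k Dk.
  have bx : comm0 b x by apply: isoP_comm hx => a c Ia Ic; apply: hb; apply: (proj1 hI).
  apply: commrM; first exact: (ad_zeta ad).
  apply: (ad_commL ad); [exact: bx | exact: tx |].
  rewrite /t0 /frow /ev big_seq; apply: commr_sum => p /Iw Ip.
  by rewrite /GRing.comm -scalerAl -scalerAr hb //; [exact: (proj1 hI) | exact: (Dm_le mm)].
exists V', m', (fun k l => r k l - om1 th k l), th, (fun a b => comm0 a x /\ b = L a), L.
split=> //; apply: (ext_base hI Im mm hx _ ad gs).
- by exists i; left.
- apply: (dich_step gr hD hI Im mm hx ad).
    (* One factor x cancels the two factors x^(-1/2) of the quadratic term, so the corrected family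
       becomes polynomial in [rho]. *)
    move=> k l Dk Dl; exists (x * rho k l - 2^-1 *: (t0 k * t0 l + t0 l * t0 k)).
      have sub f : isoP rho I f -> isoP rho (fun c => I c \/ c = k \/ c = l) f.
        by apply: isoP_sub => c; left.
      have tk : isoP rho (fun c => I c \/ c = k \/ c = l) (t0 k).
        by apply: (isoP_sub _ (isoP_row rho k Iw)) => c [|->]; [left | right; left].
      have tl : isoP rho (fun c => I c \/ c = k \/ c = l) (t0 l).
        by apply: (isoP_sub _ (isoP_row rho l Iw)) => c [|->]; [left | right; right].
      apply: iso_add; first by apply: iso_mul; [exact: sub | apply: iso_gen; right; [left | right]].
      by rewrite -scaleN1r; apply/iso_scale/iso_scale/iso_add; apply: iso_mul.
    have xx : comm0 x x by [].
    have R1 := corrM HR (ad_intro L xx) (ad_intro L (rx _ _ Dk Dl)).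
    have tkl a b (Da : Dm m' a) (Db : Dm m' b) := corrM HR (ad_intro L (tx _ Da)) (ad_intro L (tx _ Db)).
    have R2 := corrB HR R1 (corrZ HR 2^-1 (corrD HR (tkl _ _ Dk Dl) (tkl _ _ Dl Dk))).
    by rewrite -(proj2 R2) mulrBr /om1 -scalerAr mulrDr !Lxtt.
  move=> k l Dk Dl; apply: commrB; first by apply: (ad_commL ad) => //; [exact: rx | exact/commr_sym/rx].
  by apply: om1_comm; exact: Lxth.
- move=> e [k Dk ->]; split; first by move=> b hb; apply: lb.
  by move=> a b Da Db; apply/commr_sym/cs.
- by move=> b hb k l Dk Dl; apply: om1_comm; apply: lb.
Qed.
End Extensions.
End Rows.

Section Pairs.
Variable C : numClosedFieldType.
Variable sp : bool.
Local Notation eps := (form_eps C sp).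
Local Notation Bf := (form_B C sp).

Record weyl_pair (A : algType C) (D : int -> Prop) (ep em : int -> A) : Prop := WeylPair {
  wp_pm : forall k l, D k -> D l -> lieb (ep k) (em l) = Bf k l *: 1;
  wp_pp : forall k l, D k -> D l -> lieb (ep k) (ep l) = 0;
  wp_mm : forall k l, D k -> D l -> lieb (em k) (em l) = 0 }.

Definition pairE (A : algType C) m (ep em : int -> A) (e : A) :=
  exists2 k, Dm m k & e = ep k \/ e = em k.

Variables (V : nzmod C) (m : nat) (rho : int -> int -> End V).
Hypothesis gr : gfam sp (Dm m) rho.
Hypothesis hD : dich m rho.

(** Here F_ii = 0, so the variables within row i commute, and likewise within row j. Their mutual
    brackets are B(k, l) F_ji = - B(k, l) x, hence the second row is divided by -x; [y] is the
    inverse of [L x]. *)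
Lemma ext_pair_o (i j : int) : ~~ sp -> Dm m i -> Dm m j -> j != - i -> ~ locnilp (rho i j) ->
  exists (V' : nzmod C) m' (rho' : int -> int -> End V') (ep em : int -> End V') Rl L,
    extension sp m rho m' rho' (om2 sp ep em) (pairE m' ep em) Rl L /\ weyl_pair (Dm m') ep em.
Proof.
move=> spf Di Dj ij nx; pose I k := k = i \/ k = j.
have epsE : eps = 1 by rewrite /form_eps (negbTE spf).
pose w1 : vec C := [:: (1, i)]; pose w2 : vec C := [:: (1, j)].
have Iw1 : inI I w1 by move=> p; rewrite !inE => /eqP ->; left.
have Iw2 : inI I w2 by move=> p; rewrite !inE => /eqP ->; right.
have hI : isoset m I.
  split=> [k [->|->]|k l [->|->] [->|->]] //; move: Di Dj ij; rewrite /Dm; lia.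
pose m' := maxn (absz i) (absz j).
have Im k : I k -> (absz k <= m')%N by move=> [->|->]; rewrite /m'; lia.
have mm : (m <= m')%N by move: Di; rewrite /Dm /m'; lia.
set x := rho i j in nx.
have hx : isoP rho I x by apply: iso_gen; [left | right].
have xi : injop x by case: (hD hI hx).
have [V' [L [z ad]]] := adjoin_ex xi.
pose t1 := frow rho w1; pose t2 := frow rho w2.
have [y yE] : exists y, y = z * z by exists (z * z).
pose ep k := L (t1 k); pose em k := - (y * L (t2 k)).
have HR := ad_corr ad.
have rx k l : Dm m' k -> Dm m' l -> comm0 (rho k l) x.
  by move=> Dk Dl; apply/commr_sym; apply: (iso_comm_out gr hI Im mm hx).
have tx1 k : Dm m' k -> comm0 (t1 k) x.
  by move=> Dk; apply/commr_sym; apply: (iso_comm_row gr hI Im mm hx).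
have tx2 k : Dm m' k -> comm0 (t2 k) x.
  by move=> Dk; apply/commr_sym; apply: (iso_comm_row gr hI Im mm hx).
have cy a : comm0 a x -> comm0 (L a) y by move=> ax; rewrite yE; apply: commrM; exact: (ad_zeta ad).
have Ly a : comm0 a x -> lieb (L a) y = 0 by move=> ax; apply/lieb0P/cy.
have yL a : comm0 a x -> lieb y (L a) = 0 by move=> ax; apply/lieb_sym0/Ly.
have xx : comm0 x x by [].
have yx : y * L x = 1 by rewrite yE (ad_sq ad).
have xy : L x * y = 1 by rewrite cy.
pose r k l := L (rho k l).
have gr' : gfam sp (Dm m') r.
  by apply: (gfam_corr HR (D := Dm m)) gr => [k|k l Dk Dl]; [exact: Dm_le | split; first exact: rx].
have D0 := @Dm_neq0 m'.
have v1 : vecfam sp (Dm m') r ep.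
  move=> k l p Dk Dl Dp; have := row_vecfam gr hI Im mm Iw1 Dk Dl Dp.
  have R1 := corrL HR (ad_intro L (rx _ _ Dk Dl)) (ad_intro L (tx1 _ Dp)).
  have R2 := corrB HR (corrZ HR (Bf l p) (ad_intro L (tx1 _ Dk))) (corrZ HR (eps * Bf k p) (ad_intro L (tx1 _ Dl))).
  by move/(corr_eq HR R1 R2).
have v2 : vecfam sp (Dm m') r em.
  move=> k l p Dk Dl Dp; rewrite /em liebNr liebMr (Ly _ (rx _ _ Dk Dl)) mul0r addr0.
  have := row_vecfam gr hI Im mm Iw2 Dk Dl Dp.
  have R1 := corrL HR (ad_intro L (rx _ _ Dk Dl)) (ad_intro L (tx2 _ Dp)).
  have R2 := corrB HR (corrZ HR (Bf l p) (ad_intro L (tx2 _ Dk))) (corrZ HR (eps * Bf k p) (ad_intro L (tx2 _ Dl))).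
  by move/(corr_eq HR R1 R2) ->; rewrite mulrBr opprB !scalerN !scalerAr opprK addrC.
have rr0 a : Dm m a -> rho a a = 0.
  move=> Da; have := gf_sym gr Da Da; rewrite epsE scaleN1r => /eqP.
  by rewrite -addr_eq0 -mulr2n -scaler_nat scaler_eq0 pnatr_eq0 => /eqP.
have ev1 (f : int -> End V) c : ev f [:: (1, c)] = f c by rewrite ev_cons ev_nil scale1r addr0.
have ev21 : ev (frow rho w2) w1 = rho j i by rewrite ev1 /frow ev1.
have ev11 : ev (frow rho w1) w1 = 0 by rewrite ev1 /frow ev1 rr0.
have ev22 : ev (frow rho w2) w2 = 0 by rewrite ev1 /frow ev1 rr0.
have wp : weyl_pair (Dm m') ep em.
  split=> k l Dk Dl.
  - rewrite /em liebNr liebMr (Ly _ (tx1 _ Dk)) mul0r addr0.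
    have := row_row gr hI Im mm Iw1 Iw2 Dk Dl.
    rewrite ev21 (gf_sym gr Di Dj) epsE scaleN1r.
    have R1 := corrL HR (ad_intro L (tx1 _ Dk)) (ad_intro L (tx2 _ Dl)).
    have R2 := corrZ HR (Bf k l) (corrN HR (ad_intro L xx)).
    move/(corr_eq HR R1 R2) ->; by rewrite -scalerAr mulrN yx scalerN opprK.
  - have := row_row gr hI Im mm Iw1 Iw1 Dk Dl.
    rewrite ev11 scaler0.
    have R1 := corrL HR (ad_intro L (tx1 _ Dk)) (ad_intro L (tx1 _ Dl)).
    by move/(corr_eq0 HR R1).
  - rewrite /em liebNr liebNl opprK (lieb_scaled (yL _ (tx2 _ Dk)) (yL _ (tx2 _ Dl))).
    have := row_row gr hI Im mm Iw2 Iw2 Dk Dl.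
    rewrite ev22 scaler0.
    have R1 := corrL HR (ad_intro L (tx2 _ Dk)) (ad_intro L (tx2 _ Dl)).
    by move/(corr_eq0 HR R1) => /= ->; rewrite mulr0.
have [gs cs1 cs2] := pair_split D0 gr' v1 v2 (wp_pm wp) (wp_pp wp) (wp_mm wp).
have lb b : (forall k l, Dm m k -> Dm m l -> comm0 b (rho k l)) -> forall k, Dm m' k ->
    comm0 (L b) (ep k) /\ comm0 (L b) (em k).
  move=> hb k Dk.
  have bx : comm0 b x by apply: hb.
  have b1 : comm0 b (t1 k) by rewrite /t1 /frow ev1; apply: hb => //; exact: (Dm_le mm).
  have b2 : comm0 b (t2 k) by rewrite /t2 /frow ev1; apply: hb => //; exact: (Dm_le mm).
  split; first by apply: (ad_commL ad) => //; exact: tx1.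
  by apply: commrN; apply: commrM; [exact: cy | apply: (ad_commL ad) => //; exact: tx2].
have Lxe k : Dm m' k -> comm0 (L x) (ep k) /\ comm0 (L x) (em k).
  move=> Dk; split; first by apply: (ad_commL ad) => //; [exact: tx1 | exact/commr_sym/tx1].
  apply: commrN; apply: commrM; first exact: cy.
  by apply: (ad_commL ad) => //; [exact: tx2 | exact/commr_sym/tx2].
have cmp k l (b : End V') : Dm m' k -> Dm m' l -> (forall k, Dm m' k -> comm0 b (ep k) /\ comm0 b (em k)) ->
    comm0 b (om2 sp ep em k l).
  by move=> Dk Dl h; have [? ?] := h k Dk; have [? ?] := h l Dl; apply: om2_comm.
exists V', m', (fun k l => r k l - om2 sp ep em k l), ep, em, (fun a b => comm0 a x /\ b = L a), L.
split=> //; apply: (ext_base gr hI Im mm hx _ ad gs).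
- by exists i; left.
- apply: (dich_step gr hD hI Im mm hx ad).
    move=> k l Dk Dl; exists (x * rho k l + (t1 l * t2 k - t1 k * t2 l)).
      have sub f : isoP rho I f -> isoP rho (fun c => I c \/ c = k \/ c = l) f.
        by apply: isoP_sub => c; left.
      have sN f J : isoP rho J f -> isoP rho J (- f).
        by move=> h; rewrite -scaleN1r; apply: iso_scale.
      have tk w : inI I w -> isoP rho (fun c => I c \/ c = k \/ c = l) (frow rho w k).
        by move=> h; apply: (isoP_sub _ (isoP_row rho k h)) => c [|->]; [left | right; left].
      have tl w : inI I w -> isoP rho (fun c => I c \/ c = k \/ c = l) (frow rho w l).
        by move=> h; apply: (isoP_sub _ (isoP_row rho l h)) => c [|->]; [left | right; right].
      apply: iso_add; first by apply: iso_mul; [exact: sub | apply: iso_gen; right; [left | right]].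
      apply: iso_add; [|apply: sN]; apply: iso_mul; by [exact: tk | exact: tl].
    have R1 := corrM HR (ad_intro L xx) (ad_intro L (rx _ _ Dk Dl)).
    have tkl a b (Da : Dm m' a) (Db : Dm m' b) := corrM HR (ad_intro L (tx1 _ Da)) (ad_intro L (tx2 _ Db)).
    have R2 := corrD HR R1 (corrB HR (tkl _ _ Dl Dk) (tkl _ _ Dk Dl)).
    rewrite -(proj2 R2) mulrBr /om2 epsE scale1r mulrBr.
    have tt1 a b : Dm m' a -> Dm m' b -> L x * (ep a * em b) = - (L (t1 a) * L (t2 b)).
      move=> Da Db; have -> : em b = - (y * L (t2 b)) by [].
      rewrite !mulrN; congr (- _).
      have e : ep a * y = y * ep a := cy _ (tx1 _ Da).
      by rewrite [ep a * (y * _)]mulrA e !mulrA xy mul1r.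
    by rewrite !tt1 // opprB opprK; congr (_ + _); rewrite addrC.
  move=> k l Dk Dl; apply: commrB; first by apply: (ad_commL ad) => //; [exact: rx | exact/commr_sym/rx].
  by apply: cmp.
- move=> e [k Dk ke]; split.
    by move=> b hb; have [? ?] := lb b hb k Dk; case: ke => ->.
  by move=> a b Da Db; case: ke => ->; apply/commr_sym; [exact: cs1 | exact: cs2].
- by move=> b hb k l Dk Dl; apply: cmp => // ? ?; apply: lb.
Qed.

(** The factorisation a^2 + b^2 = (a + i b)(a - i b), with the factor 1/2 placed in the second row;
    the mixed terms cancel because the two rows commute. *)
Lemma om2_of_om1 (A : algType C) (t1 t2 : int -> A) k l : sp -> comm0 (t1 k) (t2 l) -> comm0 (t1 l) (t2 k) ->
  om2 sp (fun k => t1 k + 'i *: t2 k) (fun k => 2^-1 *: (t1 k - 'i *: t2 k)) k l = om1 t1 k l + om1 t2 k l.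
Proof.
move=> spt h1 h2; rewrite /om2 /om1 /form_eps spt scaleN1r opprK -!scalerAr -!scalerDr; congr (_ *: _).
rewrite !mulrDl !mulrBr -!scalerAr -!scalerAl !scalerA -expr2 sqrCi !scaleN1r -h1 -h2.
do ?[move: (_ *: (_ * _)) => ?]; do ?[move: (_ * _) => ?].
by ncr.
Qed.

Lemma weyl_pair_of_singles (A : algType C) D (t1 t2 : int -> A) :
  (forall k l, D k -> D l -> lieb (t1 k) (t1 l) = Bf k l *: 1) ->
  (forall k l, D k -> D l -> lieb (t2 k) (t2 l) = Bf k l *: 1) ->
  (forall k l, D k -> D l -> lieb (t1 k) (t2 l) = 0) ->
  weyl_pair D (fun k => t1 k + 'i *: t2 k) (fun k => 2^-1 *: (t1 k - 'i *: t2 k)).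
Proof.
move=> h1 h2 h3.
have h4 k l : D k -> D l -> lieb (t2 k) (t1 l) = 0 by move=> Dk Dl; apply/lieb_sym0/h3.
have ii : 'i * 'i = -1 :> C by rewrite -expr2 sqrCi.
split=> k l Dk Dl; rewrite !(liebDl, liebDr, liebNl, liebNr, liebZl, liebZr) h1 // h2 // h3 // h4 //.
- move: (_%:A) => B; rewrite scaler0 subr0 sub0r !scalerN !scalerA -scalerBl.
  by rewrite -mulrA mulrCA ii mulrN1 opprK (_ : 2^-1 + 2^-1 = 1) ?scale1r // [RHS]splitr !mul1r.
- by move: (_%:A) => B; rewrite !scaler0 addr0 add0r scalerA ii scaleN1r subrr.
- move: (_%:A) => B; rewrite !scaler0 subr0 sub0r !scalerN opprK !scalerA -scalerDl.
  by rewrite -mulrA mulrCA ii mulrN1 subrr scale0r scaler0.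
Qed.

End Pairs.

Section PairsSp.
Variable C : numClosedFieldType.
Variable sp : bool.
Local Notation eps := (form_eps C sp).
Local Notation Bf := (form_B C sp).

(** The first row commutes with [rho1], so [L2] lifts it to a row that commutes with the second one.
    Over the complex numbers two commuting self-conjugate rows recombine into a conjugate pair. *)
Lemma ext_two_singles (V V1 V2 : nzmod C) m m1 m2 rho (rho1 : int -> int -> End V1)
   (rho2 : int -> int -> End V2) th1 th2 R1 L1 R2 L2 : sp ->
  extension sp (V := V) m rho m1 rho1 (om1 th1) (fun e => exists2 k, Dm m1 k & e = th1 k) R1 L1 ->
  (forall k l, Dm m1 k -> Dm m1 l -> lieb (th1 k) (th1 l) = Bf k l *: 1) ->
  extension sp m1 rho1 m2 rho2 (om1 th2) (fun e => exists2 k, Dm m2 k & e = th2 k) R2 L2 ->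
  (forall k l, Dm m2 k -> Dm m2 l -> lieb (th2 k) (th2 l) = Bf k l *: 1) ->
  exists ep em Rl L,
    extension sp m rho m2 rho2 (om2 sp ep em) (pairE m2 ep em) Rl L /\ weyl_pair sp (Dm m2) ep em.
Proof.
move=> spt X1 h1 X2 h2; pose t1 k := L2 (th1 k).
pose ep k := t1 k + 'i *: th2 k; pose em k := 2^-1 *: (t1 k - 'i *: th2 k).
have le12 := ex_m X2; have D21 k : Dm m2 k -> Dm m1 k by apply: Dm_le.
have [C1 C2] := (ex_corr X1, ex_corr X2).
have lt1 k : Dm m2 k -> [/\ R2 (th1 k) (t1 k), forall k' l, Dm m2 k' -> Dm m2 l -> comm0 (t1 k) (rho2 k' l) &
      forall e, (exists2 k, Dm m2 k & e = th2 k) -> comm0 (t1 k) e].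
  move=> Dk; apply: (ex_lift X2) => a b Da Db; apply: (ex_comm X1) => //.
  by exists k => //; apply: D21.
have t12 k l : Dm m2 k -> Dm m2 l -> comm0 (t1 k) (th2 l).
  by move=> Dk Dl; have [_ _ h] := lt1 k Dk; apply: h; exists l.
have tt1 k l : Dm m2 k -> Dm m2 l -> lieb (t1 k) (t1 l) = Bf k l *: 1.
  move=> Dk Dl; have [r1 _ _] := lt1 k Dk; have [r2 _ _] := lt1 l Dl.
  by apply/(corr_eq C2 (corrL C2 r1 r2) (corrZ C2 _ (corr1 C2))); apply: h1; apply: D21.
have cz c (b f : End V2) : comm0 b f -> comm0 b (c *: f).
  by move=> h; rewrite /comm0 -scalerAl -scalerAr h.
have cE e : pairE m2 ep em e -> exists2 k, Dm m2 k & forall b, comm0 b (t1 k) -> comm0 b (th2 k) -> comm0 b e.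
  move=> [k Dk ke]; exists k => // b b1 b2; case: ke => ->.
    by apply: commrD => //; apply: cz.
  by apply: (cz); apply: commrB => //; apply: cz.
exists ep, em, (fun a c => exists2 b, R1 a b & R2 b c), (fun a => L2 (L1 a)); split; last first.
  by apply: weyl_pair_of_singles => // k l Dk Dl; apply/lieb0P/t12.
split.
- exact: leq_trans (ex_m X1) le12.
- exact: (ex_gf X2).
- exact: (ex_dich X2).
- exact: corr_comp.
- move=> k l Dk Dl; exists (rho1 k l + om1 th1 k l); first by apply: (ex_rel X1); apply: D21.
  have -> : om2 sp ep em k l = om1 t1 k l + om1 th2 k l by apply: om2_of_om1 => //; apply: t12.
  rewrite [om1 t1 k l + _]addrC addrA; apply: (corrD C2); first exact: (ex_rel X2).
  have [r1 _ _] := lt1 k Dk; have [r2 _ _] := lt1 l Dl.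
  apply: (corrZ C2); apply: (corrD C2); exact: (corrM C2).
- move=> b hb; have [rb cb1 cb2] := ex_lift X1 hb.
  have hb1 : forall k l, Dm m1 k -> Dm m1 l -> comm0 (L1 b) (rho1 k l) by [].
  have [rb' cb1' cb2'] := ex_lift X2 hb1; split=> //; first by exists (L1 b).
  move=> e /cE [k Dk]; apply; last by apply: cb2'; exists k.
  have [r1 _ _] := lt1 k Dk; apply: (corr_comm C2 rb' r1).
  by apply: cb2; exists k => //; apply: D21.
- move=> e /cE [k Dk h] a b Da Db; apply/commr_sym; apply: h.
    by apply/commr_sym; have [_ h _] := lt1 k Dk; apply: h.
  by apply/commr_sym; apply: (ex_comm X2) => //; exists k.
Qed.
End PairsSp.

(** * Iterating the splitting *)

Section Stages.
Variable C : numClosedFieldType.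
Variable sp : bool.
Local Notation eps := (form_eps C sp).
Local Notation Bf := (form_B C sp).

Lemma locnilpD (V : nzmod C) (a b : End V) : comm0 a b -> locnilp a -> locnilp b -> locnilp (a + b).
Proof.
move=> ab ha hb v; have [i hi] := ha v; have [j hj] := hb v; exists (i + j)%N.
rewrite exprDn_comm // end_sumE big1 // => k _.
rewrite -scaler_nat endZE endME.
have [kj|jk] := leqP j k; first by rewrite (end_exp_le kj hj) efun0 scaler0.
have c : comm0 (a ^+ (i + j - k)) (b ^+ k) by apply: commrX; apply/commr_sym/commrX/commr_sym.
have ik : (i <= i + j - k)%N by lia.
by rewrite -endME c endME (end_exp_le ik hi) efun0 scaler0.
Qed.

Lemma comm0Z (A : algType C) c (a b : A) : comm0 a b -> comm0 a (c *: b).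
Proof. by move=> h; rewrite /comm0 -scalerAl -scalerAr h. Qed.

Definition rootnil (V : nzmod C) m (rho : int -> int -> End V) :=
  forall k l, Dm m k -> Dm m l -> l != - k -> locnilp (rho k l).

(** Polarisation: 2 F_kl = F(w, w) - F_kk - F_ll with w = e_k + e_l. The three terms commute since k
    and l are isotropic, so local nilpotence passes to the sum. *)
Lemma rootnil_sq (V : nzmod C) m (rho : int -> int -> End V) : sp -> gfam sp (Dm m) rho ->
  (forall i j, Dm m i -> Dm m j -> j != - i -> locnilp (sqv rho i j)) -> rootnil m rho.
Proof.
move=> spt gr h k l Dk Dl kl.
have sym a b : Dm m a -> Dm m b -> rho b a = rho a b.
  by move=> Da Db; rewrite (gf_sym gr Da Db) /form_eps spt opprK scale1r.
have sqE i j : Dm m i -> Dm m j -> sqv rho i j = rho i i + 2 *: rho i j + rho j j.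
  move=> Di Dj; rewrite /sqv /frow !ev_cons !ev_nil !scale1r !addr0 (sym i j) //.
  by rewrite scaler_nat mulr2n; ncr.
have diag i : Dm m i -> locnilp (rho i i).
  move=> Di; have ii : i != - i by have := Dm_neq0 Di; lia.
  (* For equal indices w is 2 e_i, whence the factor 4. *)
  have := h i i Di Di ii; rewrite sqE // => /(locnilpZ 4^-1).
  suff -> : 4^-1 *: (rho i i + 2 *: rho i i + rho i i) = rho i i by [].
  rewrite (_ : _ + _ = 4 *: rho i i); last by rewrite !scaler_nat addrAC -mulr2n -mulrnDr.
  by rewrite scalerA mulVf ?scale1r // pnatr_eq0.
have hI : isoset m (fun c => c = k \/ c = l).
  split=> [c [->|->]|a b [->|->] [->|->]] //; move: Dk Dl kl; rewrite /Dm; lia.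
have ckk : comm0 (rho k l) (rho k k) by apply/lieb0P; apply: (iso_gen_comm gr hI); auto.
have cll : comm0 (rho k l) (rho l l) by apply/lieb0P; apply: (iso_gen_comm gr hI); auto.
have ckl : comm0 (rho k k) (rho l l) by apply/lieb0P; apply: (iso_gen_comm gr hI); auto.
have -> : rho k l = 2^-1 *: (sqv rho k l + -1 *: (rho k k + rho l l)).
  rewrite sqE // scaleN1r (_ : _ - _ = 2 *: rho k l); last by ncr.
  by rewrite scalerA mulVf ?scale1r // pnatr_eq0.
apply: locnilpZ; apply: locnilpD; [|exact: h|apply: locnilpZ; apply: locnilpD => //; exact: diag].
apply: comm0Z; rewrite sqE //; apply/commr_sym.
have c2 := comm0Z 2 (commr_sym ckk); have c3 := comm0Z 2 (commr_sym cll).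
apply: commrD; [apply: commrD|]; apply/commr_sym; apply: commrD => //; apply/commr_sym => //.
Qed.

Section Chain.
Variables (V0 : nzmod C) (F0 : int -> int -> End V0).

Record stage r (V : nzmod C) m (rho : int -> int -> End V) (eta : bool -> nat -> int -> End V)
    (Rl : End V0 -> End V -> Prop) : Prop := Stage {
  st_gf : gfam sp (Dm m) rho;
  st_dich : dich m rho;
  st_corr : corr Rl;
  st_pair : forall j, (j < r)%N -> weyl_pair sp (Dm m) (eta true j) (eta false j);
  st_cross : forall i j b b' k l, (i < r)%N -> (j < r)%N -> i != j -> Dm m k -> Dm m l ->
     comm0 (eta b i k) (eta b' j l);
  st_comm : forall j b p k l, (j < r)%N -> Dm m p -> Dm m k -> Dm m l ->
     comm0 (eta b j p) (rho k l);
  st_rel : forall k l, Dm m k -> Dm m l ->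
     Rl (F0 k l) (rho k l + \sum_(j < r) om2 sp (eta true j) (eta false j) k l) }.

Lemma corr_om2 (A A' : algType C) (Rl : A -> A' -> Prop) (I : Type) (ep em : I -> A) (ep' em' : I -> A') k l :
  corr Rl -> (forall c, c = k \/ c = l -> Rl (ep c) (ep' c)) ->
  (forall c, c = k \/ c = l -> Rl (em c) (em' c)) -> Rl (om2 sp ep em k l) (om2 sp ep' em' k l).
Proof.
move=> HR h1 h2; apply: (corrB HR); [|apply: (corrZ HR)];
  apply: (corrM HR); (apply: h1 || apply: h2); by [left | right].
Qed.

Lemma weyl_pair_corr (A A' : algType C) (Rl : A -> A' -> Prop) (D D' : int -> Prop)
   (ep em : int -> A) (ep' em' : int -> A') : corr Rl -> (forall c, D' c -> D c) ->
  (forall c, D' c -> Rl (ep c) (ep' c)) -> (forall c, D' c -> Rl (em c) (em' c)) ->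
  weyl_pair sp D ep em -> weyl_pair sp D' ep' em'.
Proof.
move=> HR DD h1 h2 [w1 w2 w3]; split=> k l Dk Dl.
- apply/(corr_eq HR (corrL HR (h1 _ Dk) (h2 _ Dl)) (corrZ HR _ (corr1 HR))).
  by apply: w1; apply: DD.
- by apply/(corr_eq0 HR (corrL HR (h1 _ Dk) (h1 _ Dl))); apply: w2; apply: DD.
- by apply/(corr_eq0 HR (corrL HR (h2 _ Dk) (h2 _ Dl))); apply: w3; apply: DD.
Qed.

Lemma stage_ext r V m rho eta Rl V' m' (rho' : int -> int -> End V') ep em R' L :
  @stage r V m rho eta Rl -> extension sp m rho m' rho' (om2 sp ep em) (pairE m' ep em) R' L ->
  weyl_pair sp (Dm m') ep em ->
  @stage r.+1 V' m' rho' (fun b j k => if (j < r)%N then L (eta b j k) else if b then ep k else em k)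
     (fun a c => exists2 b, Rl a b & R' b c).
Proof.
move=> S X W; have HR' := ex_corr X; have le := ex_m X.
have DD k : Dm m' k -> Dm m k by apply: Dm_le.
have lift b j p : (j < r)%N -> Dm m' p ->
    [/\ R' (eta b j p) (L (eta b j p)), forall k l, Dm m' k -> Dm m' l -> comm0 (L (eta b j p)) (rho' k l) &
      forall e, pairE m' ep em e -> comm0 (L (eta b j p)) e].
  by move=> jr Dp; apply: (ex_lift X) => k l Dk Dl; apply: (st_comm S) => //; apply: DD.
split.
- exact: (ex_gf X).
- exact: (ex_dich X).
- exact: corr_comp (st_corr S) HR'.
- move=> j _; have [jr|jr] := ltnP j r.
    by apply: (weyl_pair_corr HR' DD _ _ (st_pair S jr)) => c Dc; [have [] := lift true _ _ jr Dc | have [] := lift false _ _ jr Dc].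
  by apply: (weyl_pair_corr (corr_refl _) _ _ _ W) => // c Dc.
- move=> i j b b' k l i1 j1 ij Dk Dl.
  have [ir|ir] := ltnP i r; have [jr|jr] := ltnP j r.
  + have [h1 _ _] := lift b _ _ ir Dk; have [h2 _ _] := lift b' _ _ jr Dl.
    by apply: (corr_comm HR' h1 h2); apply: (st_cross S) => //; apply: DD.
  + have [_ _ h] := lift b _ _ ir Dk; apply: h; exists l => //; case: b'; [by left | by right].
  + have [_ _ h] := lift b' _ _ jr Dl; apply/commr_sym; apply: h; exists k => //.
    by case: b; [left | right].
  + by case/eqP: ij; lia.
- move=> j b p k l _ Dp Dk Dl; case: ifP => jr; first by have [_ h _] := lift b _ _ jr Dp; apply: h.
  by apply: (ex_comm X) => //; exists p => //; case: b; [left | right].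
- move=> k l Dk Dl; exists (rho k l + \sum_(j < r) om2 sp (eta true j) (eta false j) k l).
    by apply: (st_rel S); apply: DD.
  rewrite big_ord_recr /= ltnn [X in R' _ (_ + X)]addrC addrA; apply: (corrD HR').
    exact: (ex_rel X).
  apply: (corr_sum HR') => j _; rewrite ltn_ord.
  apply: (corr_om2 HR') => c ckl; have Dc : Dm m' c by case: ckl => ->.
    by have [] := lift true _ _ (ltn_ord j) Dc.
  by have [] := lift false _ _ (ltn_ord j) Dc.
Qed.

(** In the symplectic case one splitting gives a single row. It is counted only together with a
    second one; if there is none, all root operators left are locally nilpotent and the single row
    is kept apart. *)
Lemma stage_progress r V m rho eta Rl : @stage r V m rho eta Rl ->
  [\/ exists V' m' rho' eta' Rl', @stage r.+1 V' m' rho' eta' Rl',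
      rootnil m rho |
      sp /\ exists V' m' (rho' : int -> int -> End V') th R' L,
        [/\ extension sp m rho m' rho' (om1 th) (fun e => exists2 k, Dm m' k & e = th k) R' L,
          forall k l, Dm m' k -> Dm m' l -> lieb (th k) (th l) = Bf k l *: 1 & rootnil m' rho']].
Proof.
move=> S; have [spb|spb] : ~~ sp \/ sp by case: sp; [right | left].
  have [|nex] := pselect (exists i j, [/\ Dm m i, Dm m j, j != - i & ~ locnilp (rho i j)]).
    move=> [i [j [Di Dj ij nx]]]; constructor 1.
    have [V' [m' [rho' [ep [em [R' [L [X W]]]]]]]] := ext_pair_o (st_gf S) (st_dich S) spb Di Dj ij nx.
    by do 5!eexists; exact: (stage_ext S X W).
  constructor 2 => i j Di Dj ij; apply: contrapT => nx; apply: nex.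
  by exists i, j.
have [|nex] := pselect (exists i j, [/\ Dm m i, Dm m j, j != - i & ~ locnilp (sqv rho i j)]); last first.
  constructor 2; apply: (rootnil_sq spb (st_gf S)) => i j Di Dj ij; apply: contrapT => nx; apply: nex.
  by exists i, j.
move=> [i [j [Di Dj ij nx]]].
have [V1 [m1 [rho1 [th1 [R1 [L1 [X1 h1]]]]]]] := ext_single (st_gf S) (st_dich S) spb Di Dj ij nx.
have [|nex] := pselect (exists i j, [/\ Dm m1 i, Dm m1 j, j != - i & ~ locnilp (sqv rho1 i j)]); last first.
  constructor 3; split=> //; exists V1, m1, rho1, th1, R1, L1; split=> //.
  apply: (rootnil_sq spb (ex_gf X1)) => a b Da Db ab; apply: contrapT => nx'; apply: nex.
  by exists a, b.
move=> [a [b [Da Db ab nx']]].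
have [V2 [m2 [rho2 [th2 [R2 [L2 [X2 h2]]]]]]] := ext_single (ex_gf X1) (ex_dich X1) spb Da Db ab nx'.
have [ep [em [R' [L [X W]]]]] := ext_two_singles spb X1 h1 X2 h2.
by constructor 1; do 5!eexists; exact: (stage_ext S X W).
Qed.

Definition chain_end (V : nzmod C) m (rho : int -> int -> End V) :=
  rootnil m rho \/ sp /\ exists V' m' (rho' : int -> int -> End V') th R' L,
        [/\ extension sp m rho m' rho' (om1 th) (fun e => exists2 k, Dm m' k & e = th k) R' L,
          forall k l, Dm m' k -> Dm m' l -> lieb (th k) (th l) = Bf k l *: 1 & rootnil m' rho'].

Lemma chain_outcome N : gfam sp (Dm 0) F0 -> dich 0 F0 ->
  exists r V m rho eta Rl, @stage r V m rho eta Rl /\ ((N <= r)%N \/ chain_end m rho).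
Proof.
move=> g0 d0; elim: N => [|N [r [V [m [rho [eta [Rl [S]]]]]]]].
  exists 0%N, V0, 0%N, F0, (fun _ _ _ => 0), eq; split; last by left.
  by split=> // [|k l _ _]; [exact: corr_refl | rewrite big_ord0 addr0].
case=> [le|he]; last by exists r, V, m, rho, eta, Rl; split=> //; right.
have [[V' [m' [rho' [eta' [Rl' S']]]]]|h|h] := stage_progress S.
- by exists r.+1, V', m', rho', eta', Rl'; split=> //; left.
- by exists r, V, m, rho, eta, Rl; split=> //; right; left.
- by exists r, V, m, rho, eta, Rl; split=> //; right; right.
Qed.

End Chain.

Section Datum.
Variable n : nat.
Definition ineg (c : idx n) : idx n := (~~ c.1, c.2).
Definition Bi (c d : idx n) : C := Bf (io c) (io d).

Lemma io_neg c : io (ineg c) = - io c.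
Proof. by case: c => [[] i] //=; rewrite /io /= opprK. Qed.
Lemma io_inj : injective (@io n).
Proof.
move=> [b i] [b' j]; rewrite /io /=; case: b; case: b' => /= h; try lia;
  by congr (_, _); apply: val_inj => /=; lia.
Qed.
Lemma BiE c d : Bi c d = if d == ineg c then form_sg C sp (io c) else 0.
Proof. by rewrite /Bi /form_B -io_neg (inj_eq io_inj). Qed.
Lemma ishiftN M i : i != 0 -> ishift M (- i) = - ishift M i.
Proof. by rewrite /ishift => i0; case: ifP; case: ifP; lia. Qed.
Lemma io_neq0 (c : idx n) : io c != 0. Proof. by rewrite /io; case: c.1. Qed.
Lemma ishift_neg M i : i != 0 -> (ishift M i < 0) = (i < 0).
Proof. by rewrite /ishift => i0; case: ifP; lia. Qed.
Lemma Bf_shift M (c d : idx n) : Bf (ishift M (io c)) (ishift M (io d)) = Bi c d.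
Proof.
rewrite BiE /form_B /form_sg ishift_neg ?io_neq0 // -ishiftN ?io_neq0 // -io_neg.
have -> : (ishift M (io d) == ishift M (io (ineg c))) = (d == ineg c); last by [].
apply/eqP/eqP => [|->] // h; apply: io_inj.
by have := (io_neq0 d, io_neq0 (ineg c)); move: h; rewrite /ishift; case: ifP; case: ifP; lia.
Qed.
Lemma Dm_shift M (c : idx n) : Dm M (ishift M (io c)).
Proof. by have := io_neq0 c; rewrite /Dm /ishift; case: ifP; lia. Qed.

(* [eta true j] and [eta false j] are canonically conjugate rows of variables; a row [th i]
   is conjugate to itself, and in the symplectic case two such rows combine into a
   conjugate pair, so that at most one of them is left over. *)
Record datum r s (A : algType C) (rho : idx n -> idx n -> A) (eta : bool -> 'I_r -> idx n -> A)
    (th : 'I_s -> idx n -> A) : Prop := Datum {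
  dt_sym : forall c d, rho d c = - eps *: rho c d;
  dt_br : forall a b c d, lieb (rho a b) (rho c d) =
    Bi b c *: rho a d - (eps * Bi a c) *: rho b d + Bi b d *: rho c a - (eps * Bi a d) *: rho c b;
  dt_pair : forall j k l, lieb (eta true j k) (eta false j l) = Bi k l *: 1;
  dt_same : forall b j k l, lieb (eta b j k) (eta b j l) = 0;
  dt_cross : forall i j b b' k l, i != j -> comm0 (eta b i k) (eta b' j l);
  dt_comm : forall b j p k l, comm0 (eta b j p) (rho k l);
  dt_th : forall i j k l, lieb (th i k) (th j l) = Bi k l *: 1;
  dt_th_eta : forall i b j k l, comm0 (th i k) (eta b j l);
  dt_th_rho : forall i p k l, comm0 (th i p) (rho k l) }.

Definition totop r s (A : algType C) (rho : idx n -> idx n -> A) (eta : bool -> 'I_r -> idx n -> A)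
    (th : 'I_s -> idx n -> A) c d : A :=
  rho c d + \sum_j om2 sp (eta true j) (eta false j) c d + \sum_i om1 (th i) c d.

Lemma datum_corr r s (A A' : algType C) Rl rho eta th rho' eta' th' : corr Rl ->
  (forall c d, Rl (rho c d) (rho' c d)) -> (forall b j k, Rl (eta b j k) (eta' b j k)) ->
  (forall i k, Rl (th i k) (th' i k)) ->
  @datum r s A rho eta th -> @datum r s A' rho' eta' th'.
Proof.
move=> HR h1 h2 h3 [d1 d2 d3 d4 d5 d6 d7 d8 d9]; split.
- by move=> c d; apply/(corr_eq HR (h1 _ _) (corrZ HR _ (h1 _ _))).
- move=> a b c d; have R1 := corrL HR (h1 a b) (h1 c d).
  have R2 := corrB HR (corrD HR (corrB HR (corrZ HR (Bi b c) (h1 a d))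
    (corrZ HR (eps * Bi a c) (h1 b d))) (corrZ HR (Bi b d) (h1 c a))) (corrZ HR (eps * Bi a d) (h1 c b)).
  by apply/(corr_eq HR R1 R2).
- by move=> j k l; apply/(corr_eq HR (corrL HR (h2 _ _ _) (h2 _ _ _)) (corrZ HR _ (corr1 HR))).
- by move=> b j k l; apply/(corr_eq0 HR (corrL HR (h2 _ _ _) (h2 _ _ _))).
- by move=> i j b b' k l ij; apply: (corr_comm HR (h2 _ _ _) (h2 _ _ _)); apply: d5.
- by move=> *; apply: (corr_comm HR (h2 _ _ _) (h1 _ _)); apply: d6.
- by move=> i j k l; apply/(corr_eq HR (corrL HR (h3 _ _) (h3 _ _)) (corrZ HR _ (corr1 HR))).
- by move=> *; apply: (corr_comm HR (h3 _ _) (h2 _ _ _)); apply: d8.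
- by move=> *; apply: (corr_comm HR (h3 _ _) (h1 _ _)); apply: d9.
Qed.

Lemma total_corr r s (A A' : algType C) Rl rho eta th rho' eta' th' : corr Rl ->
  (forall c d, Rl (rho c d) (rho' c d)) -> (forall b j k, Rl (eta b j k) (eta' b j k)) ->
  (forall i k, Rl (th i k) (th' i k)) ->
  forall c d, Rl (@totop r s A rho eta th c d) (@totop r s A' rho' eta' th' c d).
Proof.
move=> HR h1 h2 h3 c d; apply: (corrD HR); first apply: (corrD HR) => //.
  by apply: (corr_sum HR) => j _; apply: (corr_om2 HR).
by apply: (corr_sum HR) => j _; apply/(corrZ HR)/(corrD HR); apply: (corrM HR).
Qed.

(** The chain is run for at most 2n pairs, then read on a copy of g(2n) placed beyond the spoilt
    indices. The bound on [s] reads the boolean [sp] as 0 or 1. *)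
Theorem reduction (V0 : nzmod C) (F0 : int -> int -> End V0) : gfam sp (Dm 0) F0 -> dich 0 F0 ->
  exists r s (V : nzmod C) (rho : idx n -> idx n -> End V) (eta : bool -> 'I_r -> idx n -> End V)
    (th : 'I_s -> idx n -> End V) Rl,
    [/\ corr Rl, datum rho eta th, forall c d, Rl (F0 (io c) (io d)) (totop rho eta th c d),
      (s <= sp)%N &
      (forall c d, d != ineg c -> locnilp (rho c d)) \/ s = 0%N /\ (n + n <= r)%N].
Proof.
move=> g0 d0; have [r [V [m [rho [eta [Rl [S hS]]]]]]] := chain_outcome (n + n) g0 d0.
have shift M : (n <= M)%N -> exists2 R0, corr R0 & forall c d : idx n,
    R0 (F0 (io c) (io d)) (F0 (ishift M (io c)) (ishift M (io d))).
  by move=> nM; apply: (io_shift g0) => // i; rewrite /Dm; lia.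
have DmM m1 M (c : idx n) : (m1 <= M)%N -> Dm m1 (ishift M (io c)).
  by move=> le; apply: (Dm_le le); apply: Dm_shift.
have neg1 M (c d : idx n) : d != ineg c -> ishift M (io d) != - ishift M (io c).
  move=> h; apply/eqP => e; have := Bf_shift M c d; rewrite BiE (negbTE h) /form_B e eqxx => /eqP.
  by rewrite (negbTE (sg_neq0 _ _ _)).
(* The bound m avoids the indices spoilt by the splittings, and n is what [io_shift] requires. *)
pose M := maxn m n; have [mM nM] : (m <= M)%N /\ (n <= M)%N by rewrite leq_maxl leq_maxr.
have [case1|[spt [V' [m' [rho' [th [R' [L [X ht root]]]]]]]]] : (rootnil m rho \/ (n + n <= r)%N) \/
    sp /\ exists V' m' (rho' : int -> int -> End V') th R' L,
        [/\ extension sp m rho m' rho' (om1 th) (fun e => exists2 k, Dm m' k & e = th k) R' L,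
          forall k l, Dm m' k -> Dm m' l -> lieb (th k) (th l) = Bf k l *: 1 & rootnil m' rho'].
- by case: hS => [|[]]; [left; right | left; left | right].
- have [R0 C0 H0] := shift M nM; pose f (c : idx n) := ishift M (io c).
  have Df c : Dm m (f c) by apply: DmM.
  exists r, 0%N, V, (fun c d => rho (f c) (f d)), (fun b (j : 'I_r) c => eta b j (f c)),
    (fun (i : 'I_0) c => 0), (fun a c => exists2 b, R0 a b & Rl b c); split.
  + exact: corr_comp C0 (st_corr S).
  + split=> //; try by case.
    * by move=> c d; apply: (gf_sym (st_gf S)).
    * by move=> a b c d; rewrite (gf_br (st_gf S)) // !Bf_shift.
    * by move=> j k l; rewrite (wp_pm (st_pair S (ltn_ord j))) // Bf_shift.
    * move=> [] j k l; first by rewrite (wp_pp (st_pair S (ltn_ord j))).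
      by rewrite (wp_mm (st_pair S (ltn_ord j))).
    * by move=> i j b b' k l ij; apply: (st_cross S).
    * by move=> b j p k l; apply: (st_comm S).
  + move=> c d; exists (F0 (f c) (f d)); first exact: H0.
    by rewrite /totop big_ord0 addr0; apply: (st_rel S).
  + by [].
  + by case: case1 => [root|le]; [left=> c d h; apply: root => //; apply: neg1 | right].
pose M' := maxn m' n; have [mM' nM'] : (m' <= M')%N /\ (n <= M')%N by rewrite leq_maxl leq_maxr.
have [R0 C0 H0] := shift M' nM'; pose f (c : idx n) := ishift M' (io c).
have Df c : Dm m' (f c) by apply: DmM.
have Df' c : Dm m (f c) by apply: (Dm_le (ex_m X)).
have CX := ex_corr X.
have lift b j c : (j < r)%N -> [/\ R' (eta b j (f c)) (L (eta b j (f c))),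
    forall k l, Dm m' k -> Dm m' l -> comm0 (L (eta b j (f c))) (rho' k l) &
    forall e, (exists2 k, Dm m' k & e = th k) -> comm0 (L (eta b j (f c))) e].
  by move=> jr; apply: (ex_lift X) => k l Dk Dl; apply: (st_comm S).
exists r, 1%N, V', (fun c d => rho' (f c) (f d)), (fun b (j : 'I_r) c => L (eta b j (f c))),
    (fun (i : 'I_1) c => th (f c)), (fun a c => exists2 b, (exists2 e, R0 a e & Rl e b) & R' b c); split.
- exact: corr_comp (corr_comp C0 (st_corr S)) CX.
- split.
  + by move=> c d; apply: (gf_sym (ex_gf X)).
  + by move=> a b c d; rewrite (gf_br (ex_gf X)) // !Bf_shift.
  + move=> j k l; have [h1 _ _] := lift true j k (ltn_ord j); have [h2 _ _] := lift false j l (ltn_ord j).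
    apply/(corr_eq CX (corrL CX h1 h2) (corrZ CX _ (corr1 CX))).
    by rewrite (wp_pm (st_pair S (ltn_ord j))) // Bf_shift.
  + move=> b j k l; have [h1 _ _] := lift b j k (ltn_ord j); have [h2 _ _] := lift b j l (ltn_ord j).
    apply/(corr_eq0 CX (corrL CX h1 h2)); case: b {h1 h2}.
      by rewrite (wp_pp (st_pair S (ltn_ord j))).
    by rewrite (wp_mm (st_pair S (ltn_ord j))).
  + move=> i j b b' k l ij; have [h1 _ _] := lift b i k (ltn_ord i).
    have [h2 _ _] := lift b' j l (ltn_ord j).
    by apply: (corr_comm CX h1 h2); apply: (st_cross S).
  + by move=> b j p k l; have [_ h _] := lift b j p (ltn_ord j); apply: h.
  + by move=> i j k l; rewrite ht // Bf_shift.
  + by move=> i b j k l; have [_ _ h] := lift b j l (ltn_ord j); apply/commr_sym/h; exists (f k).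
  + by move=> i p k l; apply: (ex_comm X) => //; exists (f p).
- move=> c d; exists (rho (f c) (f d) + \sum_(j < r) om2 sp (eta true j) (eta false j) (f c) (f d)).
    by exists (F0 (f c) (f d)); [exact: H0 | exact: (st_rel S)].
  rewrite /totop big_ord_recl big_ord0 addr0 addrAC; apply: (corrD CX); first exact: (ex_rel X).
  apply: (corr_sum CX) => j _.
  rewrite -[om2 _ (eta true j) _ _ _]/(om2 sp (fun c => eta true j (f c)) (fun c => eta false j (f c)) c d).
  apply: (corr_om2 CX) => e _; first by have [h1 _ _] := lift true j e (ltn_ord j).
  by have [h1 _ _] := lift false j e (ltn_ord j).
- by rewrite spt.
- by left=> c d h; apply: root => //; apply: neg1.
Qed.

End Datum.
End Stages.

(** * Replacing canonical pairs by differentiations and multiplications *)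

Section Transfer.
Variable C : numClosedFieldType.
Variable sp : bool.
Local Notation eps := (form_eps C sp).

(** A canonical pair up to a nonzero scalar, commuting with all other operators of the system. The
    operators are named by [G] so that they can be followed through successive changes of module. *)
Definition weyl_entry (G : eqType) (V : nzmod C) (psi : G -> End V) (x : G * G) :=
  [/\ exists2 c : C, c != 0 & lieb (psi x.1) (psi x.2) = c *: 1,
    x.1 != x.2 &
    forall g, g != x.1 -> g != x.2 -> comm0 (psi g) (psi x.1) /\ comm0 (psi g) (psi x.2)].

(** A transfer preserves the local nilpotence of the operators outside the pair it replaces. As no
    first member is a second member, a first member once made locally nilpotent remains so. *)
Lemma transfer_list (G : eqType) (V : nzmod C) (psi : G -> End V) (l : seq (G * G)) :
  (forall x, x \in l -> weyl_entry psi x) ->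
  (forall x y, x \in l -> y \in l -> x.1 != y.2) ->
  exists (V' : nzmod C) (psi' : G -> End V') Rl,
    [/\ corr Rl, forall g, Rl (psi g) (psi' g),
      forall x, x \in l -> locnilp (psi' x.1) &
      forall g, (forall x, x \in l -> g != x.2) -> locnilp (psi g) -> locnilp (psi' g)].
Proof.
elim: l V psi => [|[gp gq] l IH] V psi hl hd.
  by exists V, psi, eq; split=> //; exact: corr_refl.
have [[c c0 pq] npq cm] := hl (gp, gq) (mem_head _ _); rewrite /= in c0 pq npq cm.
have pq1 : lieb (c^-1 *: psi gp) (psi gq) = 1 by rewrite liebZl pq scalerA mulVf // scale1r.
have [V1 [R1 [d [z [L [C1 Rd Rz nd hL]]]]]] := weyl_transfer pq1.
pose psi1 g := if g == gp then c *: d else if g == gq then z else L (psi g).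
have hR g : R1 (psi g) (psi1 g).
  rewrite /psi1; have [->|n1] := eqVneq g gp.
    by have := corrZ C1 c Rd; rewrite scalerA mulfV // scale1r.
  have [->|n2] := eqVneq g gq; first exact: Rz.
  have [h1 h2] := cm g n1 n2.
  have h1' : comm0 (psi g) (c^-1 *: psi gp) by apply: comm0Z.
  by have [] := hL _ h1' h2.
have hl1 x : x \in l -> weyl_entry psi1 x.
  move=> xl; have [[e e0 h1] h2 h3] := hl x (mem_behead (s := _ :: _) xl).
  split=> //; first exists e => //.
    by apply/(corr_eq C1 (corrL C1 (hR _) (hR _)) (corrZ C1 _ (corr1 C1))).
  move=> g n1 n2; have [k1 k2] := h3 g n1 n2.
  by split; apply: (corr_comm C1 (hR _) (hR _)).
have [|V2 [psi2 [R2 [C2 hR2 n2 n2']]]] := IH V1 psi1 hl1.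
  by move=> x y xl yl; apply: hd; rewrite inE ?xl ?yl orbT.
exists V2, psi2, (fun a b => exists2 e, R1 a e & R2 e b); split.
- exact: corr_comp.
- by move=> g; exists (psi1 g).
- move=> x; rewrite inE => /orP [/eqP ->|/n2 //] /=.
  apply: n2'.
    move=> y yl; apply: (hd (gp, gq)); by rewrite ?mem_head // inE yl orbT.
  by rewrite /psi1 eqxx; apply: locnilpZ.
- move=> g hg ng; apply: n2'.
    by move=> y yl; apply: hg; rewrite inE yl orbT.
  rewrite /psi1; have [_|n1] := eqVneq g gp; first exact: locnilpZ.
  have ngq : g != gq by apply: (hg (gp, gq)); rewrite mem_head.
  rewrite (negbTE ngq); have [h1 h2] := cm g n1 ngq.
  have h1' : comm0 (psi g) (c^-1 *: psi gp) by apply: comm0Z.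
  by have [_] := hL _ h1' h2; apply.
Qed.

Lemma datum_transfer n r s (V : nzmod C) (rho : idx n -> idx n -> End V)
   (eta : bool -> 'I_r -> idx n -> End V) (th : 'I_s -> idx n -> End V) :
  (s <= 1)%N -> datum sp rho eta th ->
  exists (V' : nzmod C) (rho' : idx n -> idx n -> End V') (eta' : bool -> 'I_r -> idx n -> End V')
    (th' : 'I_s -> idx n -> End V') Rl,
    [/\ corr Rl, datum sp rho' eta' th',
      forall c d, Rl (totop sp rho eta th c d) (totop sp rho' eta' th' c d),
      forall c d, locnilp (rho c d) -> locnilp (rho' c d) &
      (forall j k, locnilp (eta' false j k)) /\ forall i (k : idx n), k.1 -> locnilp (th' i k)].
Proof.
move=> s1 D.
pose G := ((idx n * idx n) + ((bool * 'I_r * idx n) + ('I_s * idx n)))%type.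
pose psi (g : G) : End V := match g with
  | inl (c, d) => rho c d
  | inr (inl (b, j, k)) => eta b j k
  | inr (inr (i, k)) => th i k end.
pose gE b j k : G := inr (inl (b, j, k)).
pose gT i k : G := inr (inr (i, k)).
(* Each index is joined to its opposite, the only index that B pairs with it. A self-conjugate row
   is cut into halves: its negative indices become annihilation operators, its positive ones
   creation operators. *)
pose l1 : seq (G * G) := [seq (gE false p.1 (ineg p.2), gE true p.1 p.2) | p : 'I_r * idx n].
pose l2 : seq (G * G) := [seq (gT p.1 (true, p.2), gT p.1 (false, p.2)) | p : 'I_s * 'I_n].
have inegK (c : idx n) : ineg (ineg c) = c by case: c => b i; rewrite /ineg /= negbK.
have sg0 (c : idx n) : form_sg C sp (io c) != 0 := sg_neq0 _ _ _.
have B0 (c d : idx n) : d != ineg c -> Bi C sp c d = 0 by move=> h; rewrite BiE (negbTE h).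
have [||V' [psi' [Rl [CR hR h1 h2]]]] := @transfer_list G V psi (l1 ++ l2).
- move=> x; rewrite mem_cat => /orP [] /mapP [[j k] _ ->].
    split=> //=.
      exists (- form_sg C sp (io k)); first by rewrite oppr_eq0.
      by rewrite liebC (dt_pair D) BiE eqxx scaleNr.
    case=> [[c d]|[[[b i] c]|[i c]]] n1 n2.
    + by split; apply/commr_sym/(dt_comm D).
    + have [ij|ij] := eqVneq i j; last by split; apply: (dt_cross D).
      move: n1 n2; rewrite ij; case: b => n1 n2; split; apply/lieb0P; rewrite ?(dt_same D) ?(dt_pair D) //.
        rewrite B0 ?scale0r //; apply/eqP => /(congr1 (@ineg n)); rewrite !inegK => e.
        by move: n2; rewrite e eqxx.
      rewrite liebC (dt_pair D) B0 ?scale0r ?oppr0 //; apply/eqP => e; by move: n1; rewrite e eqxx.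
    + by split; apply: (dt_th_eta D).
  split=> //=.
    exists (form_sg C sp (io (true, k))); first exact: sg0.
    by rewrite (dt_th D) BiE /ineg /= eqxx.
    by apply/eqP.
  case=> [[c d]|[[[b i] c]|[i c]]] n1 n2.
  + by split; apply/commr_sym/(dt_th_rho D).
  + by split; apply/commr_sym/(dt_th_eta D).
  + have ij : i = j by apply: val_inj => /=; have := ltn_ord i; have := ltn_ord j; lia.
    move: n1 n2; rewrite {}ij => n1 n2; split; apply/lieb0P; rewrite (dt_th D) B0 ?scale0r //.
      apply/eqP => /(congr1 (@ineg n)); rewrite !inegK /ineg /= => e; by move: n2; rewrite -e eqxx.
    apply/eqP => /(congr1 (@ineg n)); rewrite !inegK /ineg /= => e; by move: n1; rewrite -e eqxx.
- by move=> x y; rewrite !mem_cat => /orP [] /mapP [[j k] _ ->] /orP [] /mapP [[j' k'] _ ->]; apply/eqP.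
exists V', (fun c d => psi' (inl (c, d))), (fun b j k => psi' (gE b j k)), (fun i k => psi' (gT i k)), Rl.
split=> //.
- by apply: (datum_corr CR) D => [c d|b j k|i k]; [exact: (hR (inl (c, d))) | exact: (hR (gE b j k)) | exact: (hR (gT i k))].
- by move=> c0 d0; apply: (total_corr sp CR) => [c d|b j k|i k]; [exact: (hR (inl (c, d))) | exact: (hR (gE b j k)) | exact: (hR (gT i k))].
- move=> c d; apply: (h2 (inl (c, d))) => x; rewrite mem_cat => /orP [] /mapP [[j k] _ ->] //.
- split=> [j k|i [b a] /= ->].
    apply: (h1 (gE false j k, gE true j (ineg k))); rewrite mem_cat; apply/orP; left.
    by apply/mapP; exists (j, ineg k) => //=; rewrite ?inegK // mem_enum.
  apply: (h1 (gT i (true, a), gT i (false, a))); rewrite mem_cat; apply/orP; right.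
  by apply/mapP; exists (i, a) => //=; rewrite mem_enum.
Qed.

End Transfer.

(** * Sorted words and locally finite actions *)

Section Span.
Variable C : numClosedFieldType.
Variable V : lmodType C.
Implicit Types (P Q : V -> Prop) (L s : seq V).

Inductive Spanp P : V -> Prop :=
| Span0 : Spanp P 0
| SpanC c u v : P u -> Spanp P v -> Spanp P (c *: u + v).

Lemma SpanD P u v : Spanp P u -> Spanp P v -> Spanp P (u + v).
Proof. by elim=> [|c a b Pa _ IH] hv; [rewrite add0r | rewrite -addrA; apply: SpanC => //; apply: IH]. Qed.
Lemma SpanG P u : P u -> Spanp P u.
Proof. by move=> h; rewrite -[u]scale1r -[_ *: _]addr0; apply: SpanC => //; apply: Span0. Qed.
Lemma SpanZ P c u : Spanp P u -> Spanp P (c *: u).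
Proof.
elim=> [|a x y Px _ IH]; first by rewrite scaler0; apply: Span0.
by rewrite scalerDr scalerA; apply: SpanC.
Qed.
Lemma SpanN P u : Spanp P u -> Spanp P (- u).
Proof. by move=> h; rewrite -scaleN1r; apply: SpanZ. Qed.
Lemma SpanB P u v : Spanp P u -> Spanp P v -> Spanp P (u - v).
Proof. by move=> h h'; apply: SpanD => //; apply: SpanN. Qed.
Lemma Span_sum P (I : Type) (r : seq I) (F : I -> V) :
  (forall i, Spanp P (F i)) -> Spanp P (\sum_(i <- r) F i).
Proof. by move=> h; elim/big_rec: _ => [|i x _ hx]; [apply: Span0 | apply: SpanD]. Qed.
Lemma Span_sub P Q u : (forall x, P x -> Spanp Q x) -> Spanp P u -> Spanp Q u.
Proof.
by move=> h; elim=> [|c a b Pa _ IH]; [apply: Span0 | apply: SpanD => //; apply: SpanZ; apply: h].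
Qed.
Lemma Span_min P (S : V -> Prop) : S 0 -> (forall u v, S u -> S v -> S (u + v)) ->
  (forall c u, S u -> S (c *: u)) -> (forall u, P u -> S u) -> forall u, Spanp P u -> S u.
Proof. by move=> s0 sD sZ sP u; elim=> // c a b Pa _ IH; apply: sD => //; apply: sZ; apply: sP. Qed.

Definition inL L : V -> Prop := fun u => u \in L.

Lemma Span_list L u : Spanp (inL L) u <-> exists a : 'I_(size L) -> C, u = \sum_i a i *: L`_i.
Proof.
split=> [|[a ->]]; last first.
  by apply: Span_sum => i; apply/SpanZ/SpanG/mem_nth.
elim=> [|c x y xL _ [a ->]].
  by exists (fun _ => 0); rewrite big1 // => i _; rewrite scale0r.
have iL : (index x L < size L)%N by rewrite index_mem.
exists (fun i => a i + (if i == Ordinal iL then c else 0)).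
under [RHS]eq_bigr => i _ do rewrite scalerDl.
rewrite big_split /= addrC; congr (_ + _); rewrite (bigD1 (Ordinal iL)) //= eqxx nth_index //.
by rewrite big1 ?addr0 // => i /negbTE ->; rewrite scale0r.
Qed.

Definition indep s := forall c : 'I_(size s) -> C, \sum_i c i *: s`_i = 0 -> forall i, c i = 0.

Lemma indep_dim s L : indep s -> (forall u, u \in s -> Spanp (inL L) u) -> (size s <= size L)%N.
Proof.
move=> hs hL; rewrite leqNgt; apply/negP => lt.
have /choice [a Ha] : forall i : 'I_(size s), exists a : 'I_(size L) -> C, s`_i = \sum_j a j *: L`_j.
  by move=> i; apply/Span_list/hL/mem_nth.
pose A : 'M_(size s, size L) := \matrix_(i, j) a i j.
have : ~~ row_free A by rewrite /row_free neq_ltn (leq_ltn_trans (rank_leq_col _) lt).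
rewrite -kermx_eq0 => /rowV0Pn [c /sub_kermxP cA cn0].
case/negP: cn0; apply/eqP/rowP => i; rewrite [RHS]mxE.
apply: (hs (fun i => c 0 i)).
under eq_bigr => k _ do rewrite Ha scaler_sumr.
rewrite exchange_big big1 //= => j _.
under eq_bigr => k _ do rewrite scalerA.
rewrite -scaler_suml; have := congr1 (fun M : 'M_(_, _) => M 0 j) cA; rewrite !mxE => e.
rewrite (_ : \sum_i _ = 0) ?scale0r //.
by rewrite -[RHS]e; apply: eq_bigr => k _; rewrite mxE.
Qed.

Lemma indep_cons v s : indep s -> ~ Spanp (inL s) v -> indep (v :: s).
Proof.
move=> hs nv c; rewrite big_ord_recl /= => e.
have c0 : c ord0 = 0.
  apply/eqP/negP => /negP c0; apply: nv; apply/Span_list.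
  exists (fun i => - (c ord0)^-1 * c (lift ord0 i)).
  under eq_bigr => i _ do rewrite -scalerA.
  rewrite -scaler_sumr; have := congr1 (fun x => (c ord0)^-1 *: x) e.
  rewrite scalerDr scalerA mulVf // scale1r scaler0 => /eqP.
  by rewrite addr_eq0 scaleNr => /eqP.
move: e; rewrite c0 scale0r add0r => /(hs (fun i => c (lift ord0 i))) h i.
by case: (unliftP ord0 i) => [j ->|->].
Qed.

Lemma subspace_basis (S : V -> Prop) L : (forall u, S u -> Spanp (inL L) u) ->
  exists b, [/\ indep b, (forall u, u \in b -> S u) & forall u, S u -> Spanp (inL b) u].
Proof.
move=> SL; pose Q k := `[< exists b, [/\ indep b, (forall u, u \in b -> S u) & size b = k] >].
have Q0 : exists k, Q k.
  by exists 0%N; apply/asboolP; exists [::]; split=> // c _ [].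
have Qb k : Q k -> (k <= size L)%N.
  by move=> /asboolP [b [b1 b2 <-]]; apply: indep_dim => // u /b2 /SL.
have [k /asboolP [b [b1 b2 b3]] kmax] := ex_maxnP Q0 Qb.
exists b; split=> // u Su; apply: contrapT => nu.
have : Q k.+1.
  apply/asboolP; exists (u :: b); split; [exact: indep_cons | | by rewrite /= b3].
  by move=> x; rewrite inE => /orP [/eqP ->|/b2].
by move=> /kmax; rewrite ltnn.
Qed.

End Span.

Section PBW.
Variable C : numClosedFieldType.
Variables (A : algType C) (D : nat) (y : 'I_D -> A).
Hypothesis ybr : forall a b, Spanp (fun z => exists c, z = y c) (lieb (y a) (y b)).

Definition yw (w : seq 'I_D) : A := \prod_(a <- w) y a.
Definition Wd (P : seq 'I_D -> Prop) : A -> Prop := Spanp (fun z => exists2 w, P w & z = yw w).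
Definition szlt d (w : seq 'I_D) : Prop := (size w < d)%N.
Definition sorted_word d (w : seq 'I_D) : Prop := (size w < d)%N /\ sorted leq (map val w).

Lemma yw_cons a w : yw (a :: w) = y a * yw w. Proof. by rewrite /yw big_cons. Qed.
Lemma yw_cat u w : yw (u ++ w) = yw u * yw w. Proof. by rewrite /yw big_cat. Qed.

Lemma WdG (P : seq 'I_D -> Prop) w : P w -> Wd P (yw w).
Proof. by move=> h; apply: SpanG; exists w. Qed.

Lemma Wd_mulw d u z : Wd (szlt d) z -> Wd (szlt (size u + d)) (yw u * z).
Proof.
elim=> [|c x v [w hw ->] _ IH]; first by rewrite mulr0; apply: Span0.
rewrite mulrDr -scalerAr -yw_cat; apply: SpanC => //; exists (u ++ w) => //.
by rewrite /szlt size_cat ltn_add2l.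
Qed.

Lemma Wd_le d e z : (d <= e)%N -> Wd (szlt d) z -> Wd (szlt e) z.
Proof.
move=> de; apply: Span_sub => x [w hw ->]; apply: WdG; exact: leq_trans hw de.
Qed.

(** Each transposition costs a commutator, which is a combination of generators; the error terms are
    therefore shorter than the word by at least one letter. *)
Lemma Wd_move u a v : Wd (szlt (size u + size v).+1) (yw (u ++ a :: v) - yw (a :: u ++ v)).
Proof.
elim: u => [|b u IH]; first by rewrite subrr; apply: Span0.
have -> : yw ((b :: u) ++ a :: v) - yw (a :: (b :: u) ++ v) =
    y b * (yw (u ++ a :: v) - yw (a :: u ++ v)) + lieb (y b) (y a) * yw (u ++ v).
  by rewrite /= !yw_cons /lieb mulrBr mulrBl !mulrA addrA subrK.
apply: SpanD; first by have := Wd_mulw [:: b] IH; rewrite /yw big_seq1.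
have {IH} : Spanp (fun z => exists c, z = y c) (lieb (y b) (y a)) := ybr b a.
elim=> [|c x z [e ->] _ IH]; first by rewrite mul0r; apply: Span0.
rewrite mulrDl -scalerAl -yw_cons; apply: SpanC => //; exists (e :: u ++ v) => //.
by rewrite /szlt /= size_cat !ltnS.
Qed.

Lemma Wd_perm u w : perm_eq u w -> Wd (szlt (size u)) (yw u - yw w).
Proof.
elim: u w => [|a u IH] w; first by rewrite perm_sym => /perm_nilP ->; rewrite subrr; apply: Span0.
move=> pw; have aw : a \in w by rewrite -(perm_mem pw) mem_head.
case/splitPr: aw pw => p q pw.
have pu : perm_eq u (p ++ q).
  rewrite -(perm_cons a); apply: (perm_trans pw).
  by rewrite (permEl (perm_catCA p [:: a] q)).
rewrite -[yw (a :: u)](subrK (yw (a :: p ++ q))) -addrA; apply: SpanD.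
  rewrite !yw_cons -mulrBr; have := Wd_mulw [:: a] (IH _ pu).
  by rewrite /yw big_seq1.
rewrite -opprB; apply: SpanN; have := Wd_move p a q.
by rewrite -size_cat -(perm_size pu).
Qed.

(** The spanning half of the Poincare-Birkhoff-Witt theorem: sort the letters and treat the shorter
    error terms by induction on the length. *)
Lemma Wd_sorted d z : Wd (szlt d) z -> Wd (sorted_word d) z.
Proof.
elim: d z => [|d IH] z; first by apply: Span_sub => x [w].
apply: Span_sub => x [w hw ->]; pose u := sort (fun a b : 'I_D => (a <= b)%N) w.
have pu : perm_eq w u by rewrite perm_sym perm_sort.
rewrite -[yw w](subrK (yw u)); apply: SpanD.
  apply: (Span_sub (P := fun z => exists2 w, sorted_word d w & z = yw w)).
    move=> t [v [hv1 hv2] ->]; apply: WdG; split=> //; exact: ltnW.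
  by apply: IH; apply: Wd_le (Wd_perm pu).
apply: WdG; split; first by rewrite /u size_sort.
rewrite sorted_map; apply: sort_sorted => a b; exact: leq_total.
Qed.

Inductive algp : A -> Prop :=
| alg_gen a : algp (y a)
| alg_one : algp 1
| alg_add f g : algp f -> algp g -> algp (f + g)
| alg_mul f g : algp f -> algp g -> algp (f * g)
| alg_scale c f : algp f -> algp (c *: f).

Lemma algp_Wd z : algp z -> exists d, Wd (szlt d) z.
Proof.
elim=> {z} [a||f g _ [d hf] _ [e hg]|f g _ [d hf] _ [e hg]|c f _ [d hf]].
- by exists 2; have := WdG (P := szlt 2) (w := [:: a]) isT; rewrite /yw big_seq1.
- by exists 1%N; have := WdG (P := szlt 1) (w := [::]) isT; rewrite /yw big_nil.
- exists (maxn d e); apply: SpanD; [apply: Wd_le hf | apply: Wd_le hg]; by rewrite ?leq_maxl ?leq_maxr.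
- exists (d + e)%N; elim: hf => [|c x v [w hw ->] _ IH]; first by rewrite mul0r; apply: Span0.
  rewrite mulrDl -scalerAl; apply: SpanD => //; apply: SpanZ.
  by apply: Wd_le (Wd_mulw w hg); rewrite leq_add2r ltnW.
- by exists d; apply: SpanZ.
Qed.

Lemma algp_sorted z : algp z -> exists d, Wd (sorted_word d) z.
Proof. by move=> /algp_Wd [d /Wd_sorted h]; exists d. Qed.

End PBW.

Section LocallyFinite.
Variable C : numClosedFieldType.
Variable V : nzmod C.

Definition locfin (a : End V) := forall v : V, exists L : seq V,
  Spanp (inL L) v /\ forall u, Spanp (inL L) u -> Spanp (inL L) (a u).

Lemma Span_stab (P Q : V -> Prop) (a : End V) : (forall u, P u -> Spanp Q (a u)) ->
  forall u, Spanp P u -> Spanp Q (a u).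
Proof.
move=> h u; elim=> [|c x w Px _ IH]; first by rewrite efun0; apply: Span0.
by rewrite efunP; apply: SpanD => //; apply: SpanZ; apply: h.
Qed.

Lemma locnilp_locfin a : locnilp a -> locfin a.
Proof.
move=> h v; have [k hk] := h v; exists [seq (a ^+ i) v | i <- iota 0 k.+1]; split.
  by apply: SpanG; apply/mapP; exists 0%N.
apply: Span_stab => x /mapP [i ik ->].
rewrite -end_expS; move: ik; rewrite mem_iota leq0n add0n ltnS leq_eqVlt => /orP [/eqP ->|ik].
  by rewrite end_expS hk efun0; apply: Span0.
by apply: SpanG; apply/mapP; exists i.+1 => //; rewrite mem_iota.
Qed.

Lemma eig_locfin (a : End V) : (forall v, Spanp (fun u : V => exists c, a u = c *: u) v) -> locfin a.
Proof.
move=> h v; elim: (h v) => [|c x w [e ae] _ [L [L1 L2]]].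
  by exists [::]; split=> [|u]; [apply: Span0 | apply: Span_stab].
exists (x :: L); have sub u : Spanp (inL L) u -> Spanp (inL (x :: L)) u.
  by apply: Span_sub => z zL; apply: SpanG; rewrite /inL inE zL orbT.
have xx : Spanp (inL (x :: L)) x by apply: SpanG; exact: mem_head.
split; first by apply: SpanD; [exact: SpanZ | exact: sub].
apply: Span_stab => z.
rewrite /inL inE => /orP [/eqP ->|zL]; first by rewrite ae; apply: SpanZ.
by apply/sub/L2/SpanG.
Qed.

Lemma locfin_list a (L0 : seq V) : locfin a -> exists L,
  (forall u, Spanp (inL L0) u -> Spanp (inL L) u) /\
  forall u, Spanp (inL L) u -> Spanp (inL L) (a u).
Proof.
move=> h; elim: L0 => [|v L0 [L [h1 h2]]].
  by exists [::]; split=> //; apply: Span_stab.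
have [L' [h3 h4]] := h v; exists (L' ++ L).
have s1 u : Spanp (inL L') u -> Spanp (inL (L' ++ L)) u.
  by apply: Span_sub => x xL; apply: SpanG; rewrite /inL mem_cat xL.
have s2 u : Spanp (inL L) u -> Spanp (inL (L' ++ L)) u.
  by apply: Span_sub => x xL; apply: SpanG; rewrite /inL mem_cat xL orbT.
split.
  move=> u; apply: Span_sub => x; rewrite /inL inE => /orP [/eqP ->|xL]; first exact: s1.
  by apply/s2/h1/SpanG.
apply: Span_stab => x.
by rewrite /inL mem_cat => /orP [xL|xL]; [apply/s1/h4/SpanG | apply/s2/h2/SpanG].
Qed.

(** A sorted word applies its letters of largest index first. One generator at a time, a
    finite-dimensional space is enlarged to one stable under that generator, which absorbs all its
    powers. *)
Lemma pbw_locfin D (y : 'I_D -> End V) :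
  (forall a b, Spanp (fun z => exists c, z = y c) (lieb (y a) (y b))) ->
  (forall a, locfin (y a)) ->
  forall v, exists L, forall z, algp y z -> Spanp (inL L) (z v).
Proof.
move=> ybr yf v.
have [k le] : exists k, (k >= D)%N by exists D.
(* [k0] counts the generators already treated, those of index at least D - k0. *)
suff H k0 : exists L, forall w : seq 'I_D, sorted leq (map val w) ->
    (forall a : 'I_D, a \in w -> (D - k0 <= a)%N) -> Spanp (inL L) (yw y w v).
  have [L HL] := H D; exists L => z /(algp_sorted ybr) [d].
  apply: (@Span_min _ _ _ (fun z : End V => Spanp (inL L) (z v))) => [|x w hx hw|c x hx|x [w [_ w2] ->]].
  - exact: Span0.
  - exact: SpanD.
  - exact: SpanZ.
  by apply: HL => // a _; rewrite subnn.
elim: k0 => [|k0 [L HL]].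
  exists [:: v] => -[|a w] _ h; first by rewrite /yw big_nil; apply: SpanG; exact: mem_head.
  by have := h a (mem_head _ _); rewrite subn0 leqNgt ltn_ord.
have [kD|Dk] := ltnP k0 D; last first.
  exists L => w h1 h2; apply: HL => // a aw; apply: leq_trans (h2 a aw).
  by move: Dk; rewrite -subn_eq0 => /eqP ->.
have aD : (D - k0.+1 < D)%N by lia.
pose a := Ordinal aD; have [L' [h1 h2]] := locfin_list L (yf a).
exists L'; elim=> [|b w IH] sw hw; first by apply/h1/HL.
have sw' : sorted leq (map val w) by move: sw => /= /path_sorted.
have hw' c : c \in w -> (D - k0.+1 <= c)%N by move=> cw; apply: hw; rewrite inE cw orbT.
have [->|ba] := eqVneq b a.
  by rewrite yw_cons endME; apply: h2; apply: IH.
have ab : (D - k0 <= b)%N.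
  by have := hw b (mem_head _ _); rewrite -val_eqE /= in ba; move: ba; lia.
apply/h1/HL => // c; rewrite inE => /orP [/eqP -> //|cw].
apply: (leq_trans ab); move: sw => /= /(order_path_min leq_trans) /allP; apply.
by apply/mapP; exists c.
Qed.

End LocallyFinite.

(** * Tools for the Kronecker substitution *)

Section Kronecker.
Variable C : numClosedFieldType.

Lemma poly_all_roots (p : {poly C}) : (forall t, p.[t] = 0) -> p = 0.
Proof.
move=> h; apply/eqP/negP => /negP p0.
have := @max_poly_roots _ p [seq i%:R | i <- iota 0 (size p)] p0.
rewrite size_map size_iota ltnn => H; suff: false by []; apply: H.
  by apply/allP => x _; apply/eqP/h.
rewrite map_inj_uniq ?iota_uniq // => i j /eqP; rewrite eqr_nat => /eqP //.
Qed.

(** Uniqueness of digits in base K. It keeps monomials whose exponents are below K distinct when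
    t^(K^a) is substituted for the variable number a. *)
Lemma digits_inj K D (f g : nat -> nat) : (forall a, (a < D)%N -> (f a < K)%N /\ (g a < K)%N) ->
  (\sum_(a < D) f a * K ^ a = \sum_(a < D) g a * K ^ a)%N -> forall a, (a < D)%N -> f a = g a.
Proof.
elim: D => [|D IH] h //.
have lt (u : nat -> nat) : (forall a, (a < D)%N -> (u a < K)%N) -> (\sum_(a < D) u a * K ^ a < K ^ D)%N.
  elim: D {IH h} => [|D IH] hu; first by rewrite big_ord0.
  rewrite big_ord_recr /= expnS; have := IH (fun a ha => hu a (ltnW ha)); have := hu D (leqnn _).
  move=> h1 h2; apply: (@leq_trans (K ^ D + u D * K ^ D)%N); first by rewrite ltn_add2r.
  by rewrite -mulSn leq_mul2r h1 orbT.
have lf := lt f (fun a ha => (h a (ltnW ha)).1); have lg := lt g (fun a ha => (h a (ltnW ha)).2).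
rewrite !big_ord_recr /= => e.
have K0 : (0 < K ^ D)%N by apply: leq_ltn_trans lf.
have eD : f D = g D.
  have := congr1 (fun x => x %/ K ^ D)%N e.
  by rewrite ![(_ + _ * K ^ D)%N]addnC !divnMDl // (divn_small lf) (divn_small lg) !addn0.
move=> a; rewrite ltnS leq_eqVlt => /orP [/eqP -> //|]; apply: IH.
  by move=> b bD; apply: h; apply: ltnW.
by move: e; rewrite eD => /addIn.
Qed.

End Kronecker.

(** * Discarding the part that commutes with the canonical variables *)

Section TopCoefficient.
Variable C : numClosedFieldType.
Variable A : algType C.

Lemma coefM_top (p q : {poly A}) m n : (size p <= m.+1)%N -> (size q <= n.+1)%N ->
  (p * q)`_(m + n) = p`_m * q`_n.
Proof.
move=> sp sq; rewrite coefM.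
have lt : (m < (m + n).+1)%N by rewrite ltnS leq_addr.
rewrite (bigD1 (Ordinal lt)) //= addKn big1 ?addr0 // => i.
rewrite -val_eqE /= => im; case: (ltngtP i m) im => // h _.
  rewrite [q`__]nth_default ?mulr0 //; apply: leq_trans sq _; lia.
by rewrite nth_default ?mul0r // (leq_trans sp).
Qed.

Lemma size_quad (a b c : A) : (size (quad a b c) <= 3)%N.
Proof.
rewrite /quad -['X]expr1 !mul_polyC; do 2?[apply: (leq_trans (size_polyD _ _)); rewrite geq_max; apply/andP; split].
- exact: leq_trans (size_polyC_leq1 _) _.
- by apply: leq_trans (size_scale_leq _ _) _; rewrite size_polyXn.
- by apply: leq_trans (size_scale_leq _ _) _; rewrite size_polyXn.
Qed.
Lemma quad2 (a b c : A) : (quad a b c)`_2 = c.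
Proof. by rewrite /quad !coefD !coefCM coefX coefXn coefC /= mulr0 mulr1 !add0r. Qed.
Lemma quad0 (a b c : A) : (quad a b c)`_0 = a.
Proof. by rewrite /quad !coefD !coefCM coefX coefXn coefC /= !mulr0 !addr0. Qed.

Lemma prod_quad (I : Type) (w : seq I) (a b : I -> A) (s : I -> C) :
  let p := \prod_(i <- w) quad (a i) (b i) (s i *: 1) in
  (size p <= (size w).*2.+1)%N /\ p`_(size w).*2 = (\prod_(i <- w) s i) *: 1.
Proof.
elim: w => [|i w [IH1 IH2]] /=; first by rewrite !big_nil size_poly1 coefC scale1r.
rewrite !big_cons; split.
  apply: leq_trans (size_polyMleq _ _) _.
  by have := size_quad (a i) (b i) (s i *: 1); move: IH1; set x := size _; set z := size _; lia.
rewrite doubleS -addn2 addnC coefM_top ?size_quad // IH2 quad2.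
by rewrite -scalerAl mul1r scalerA.
Qed.

(* The coefficient of highest degree along the flow of [x] sees only the scalars
   [s a] = half the second bracket of [x] with [y a]. *)
Lemma top_coefficient D (y : 'I_D -> A) (x : A) (s : 'I_D -> C)
   (ws : seq (seq 'I_D)) (c : seq 'I_D -> C) d :
  (forall a, lieb x (lieb x (y a)) = (s a *: 1) *+ 2) ->
  (forall w, w \in ws -> (size w <= d)%N) ->
  \sum_(w <- ws) c w *: yw y w = 0 ->
  \sum_(w <- ws | size w == d) c w * \prod_(a <- w) s a = 0.
Proof.
move=> hs hd e0.
pose P w := \prod_(a <- w) quad (y a) (lieb x (y a)) (s a *: 1).
pose F := \sum_(w <- ws) (c w *: 1)%:P * P w.
have cP w : curve x (P w).
  rewrite /P; elim/big_rec: _ => [|a p _ hp].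
    by have := curveC x 1; rewrite scale1r.
  by apply: curveM => //; apply: quad_curve; rewrite ?hs // liebZr lieb1r scaler0.
have cF : curve x F.
  rewrite /F; elim/big_rec: _ => [|w p _ hp]; first by have := curveC x 0; rewrite scale0r.
  by apply: curveD => //; apply: curveM => //; apply: curveC.
have F0 : F = 0.
  apply: (@exp_curve_eq0 C A x 0) => //; first by move=> a; rewrite /comm0 mulr0 mul0r.
  rewrite horner_coef0 /F coef_sum -[RHS]e0; apply: eq_bigr => w _.
  rewrite coefCM -scalerAl mul1r; congr (_ *: _); rewrite /P /yw.
  elim: w => [|a w IH]; first by rewrite !big_nil coefC.
  by rewrite !big_cons coef0M IH quad0.
have := congr1 (fun p : {poly A} => p`_d.*2) F0; rewrite coef0 /F coef_sum.
rewrite (bigID (fun w => size w == d)) /= [X in _ + X]big1_seq ?addr0; last first.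
  move=> w /andP [wd wws]; rewrite coefCM nth_default ?mulr0 //.
  have [h _] := prod_quad w y (fun a => lieb x (y a)) s.
  apply: leq_trans h _; have := hd w wws; move: wd; rewrite leq_eqVlt => /negbTE -> /= h.
  by rewrite ltn_double.
move=> h; have : (\sum_(w <- ws | size w == d) c w * \prod_(a <- w) s a) *: (1 : A) = 0.
  rewrite -[RHS]h scaler_suml; apply: eq_bigr => w /eqP wd.
  have [_ e] := prod_quad w y (fun a => lieb x (y a)) s.
  by rewrite coefCM -wd /P e -scalerAl mul1r scalerA.
by move/eqP; rewrite scaler_eq0 oner_eq0 orbF => /eqP.
Qed.

(** The coefficients of the longest words define a polynomial in the values [s a], and it vanishes
    for every choice of these values. Under s a = t^(K^a) distinct sorted words get distinct
    exponents of t, so each of these coefficients is zero. *)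
Lemma yw_independent D (y : 'I_D -> A) (ws : seq (seq 'I_D)) (c : seq 'I_D -> C) :
  (forall s : 'I_D -> C, exists x, forall a, lieb x (lieb x (y a)) = (s a *: 1) *+ 2) ->
  uniq ws -> (forall w, w \in ws -> sorted leq (map val w)) ->
  \sum_(w <- ws) c w *: yw y w = 0 -> forall w, w \in ws -> c w = 0.
Proof.
move=> hx uw sw e0.
pose ws' := [seq w <- ws | c w != 0].
suff E : ws' = [::].
  move=> w wws; apply/eqP/negP => /negP cw.
  have : w \in ws' by rewrite mem_filter cw.
  by rewrite E.
apply/eqP/negP => /negP; rewrite -size_eq0 -lt0n => sz.
have e0' : \sum_(w <- ws') c w *: yw y w = 0.
  rewrite -[RHS]e0 big_filter big_mkcond; apply: eq_bigr => w _.
  by case: eqP => // ->; rewrite scale0r.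
pose d := \max_(w <- ws') size w.
have hd w : w \in ws' -> (size w <= d)%N by move=> h; exact: (leq_bigmax_seq (F := size)).
have [w0 w0ws w0d] : exists2 w0, w0 \in ws' & size w0 = d.
  rewrite /d; elim: ws' sz {e0' hd d} => // w [|w' l] IH _.
    by exists w; rewrite ?mem_head // big_seq1.
  have [w1 h1 h2] := IH isT; rewrite big_cons.
  have [le|lt] := leqP (\max_(j <- w' :: l) size j) (size w).
    by exists w; rewrite ?mem_head.
  by exists w1; [rewrite in_cons h1 orbT | rewrite h2].
(* A letter occurs at most d times in a word of length d, so multiplicities are digits in base d +
   1. *)
pose K := d.+1; pose enc (w : seq 'I_D) := (\sum_(a <- w) K ^ a)%N.
have encE w : enc w = (\sum_(a < D) count_mem a w * K ^ a)%N.
  rewrite /enc; elim: w => [|b w IH]; first by rewrite big_nil big1.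
  rewrite big_cons IH (bigD1 b) //= [in RHS](bigD1 b) //= eqxx mulnDl mul1n addnA.
  by congr (_ + _)%N; apply: eq_bigr => a /negbTE ab; rewrite eq_sym ab.
have enc_inj w : w \in ws' -> size w = d -> enc w = enc w0 -> w = w0.
  move=> wws wd; rewrite !encE => e.
  pose cnt (u : seq 'I_D) k := if insub k is Some a then count_mem (a : 'I_D) u else 0%N.
  have cntE u (a : 'I_D) : cnt u a = count_mem a u by rewrite /cnt valK.
  have cb u a : size u = d -> (cnt u a < K)%N.
    by move=> ud; rewrite /cnt; case: insubP => // i _ _; rewrite ltnS -ud count_size.
  have := @digits_inj K D (cnt w) (cnt w0) (fun a _ => conj (cb w a wd) (cb w0 a w0d)).
  under eq_bigr do rewrite cntE; under [in X in _ = X -> _]eq_bigr do rewrite cntE.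
  move/(_ e) => h.
  have pw : perm_eq w w0.
    by apply/allP => a _ /=; rewrite -!cntE h.
  have [s1 s2] : sorted leq (map val w) /\ sorted leq (map val w0).
    by split; apply: sw; move: wws w0ws; rewrite !mem_filter => /andP [_ ?] /andP [_ ?].
  have : map val w = map val w0.
    by apply: (sorted_eq leq_trans anti_leq) => //; apply: perm_map.
  exact: (inj_map val_inj).
pose g : {poly C} := \sum_(w <- ws' | size w == d) c w *: 'X^(enc w).
have g0 : g = 0.
  apply: poly_all_roots => t; rewrite /g horner_sum.
  have [x hxs] := hx (fun a => t ^+ (K ^ a)).
  rewrite -[RHS](top_coefficient hxs hd e0'); apply: eq_bigr => w _.
  by rewrite hornerZ hornerXn /enc -prodrXr.
have := congr1 (fun p : {poly C} => p`_(enc w0)) g0; rewrite coef0 /g coef_sum.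
have uw' : uniq ws' by apply: filter_uniq.
rewrite -big_filter (bigD1_seq w0) /=; [|by rewrite mem_filter w0d eqxx|exact: filter_uniq].
rewrite coefZ coefXn eqxx mulr1 big1_seq ?addr0; last first.
  move=> w /andP [ne]; rewrite mem_filter => /andP [/eqP wd wws].
  rewrite coefZ coefXn; case: eqP => [e|_]; last by rewrite mulr0.
  by rewrite (enc_inj w wws wd) ?eqxx in ne.
by move: w0ws; rewrite mem_filter => /andP [/eqP].
Qed.

End TopCoefficient.

Section SortedExpansion.
Variable C : numClosedFieldType.
Variables (A : algType C) (D : nat) (y : 'I_D -> A).
Lemma sorted_expansion d z : Wd y (sorted_word d) z -> exists (ws : seq (seq 'I_D)) (c : seq 'I_D -> C),
  [/\ uniq ws, forall w, w \in ws -> sorted leq (map val w) & z = \sum_(w <- ws) c w *: yw y w].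
Proof.
elim=> [|a x v [w [w1 w2] ->] _ [ws [c [h1 h2 ->]]]].
  by exists [::], (fun _ => 0); split=> //; rewrite big_nil.
have [wws|nws] := boolP (w \in ws).
  exists ws, (fun u => c u + (if u == w then a else 0)); split=> //.
  under [RHS]eq_bigr => u _ do rewrite scalerDl.
  rewrite big_split /= addrC; congr (_ + _); rewrite (bigD1_seq w) //= eqxx big1 ?addr0 // => u /negbTE ->.
  by rewrite scale0r.
exists (w :: ws), (fun u => if u == w then a else c u); split=> [|u|].
- by rewrite /= nws.
- by rewrite inE => /orP [/eqP ->|/h2].
rewrite big_cons eqxx; congr (_ + _); apply: eq_big_seq => u uws.
by case: eqP => // e; rewrite -e uws in nws.
Qed.
End SortedExpansion.

Section Infinite.
Variable C : numClosedFieldType.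
Variable sp : bool.
Local Notation eps := (form_eps C sp).
Variable n : nat.
Local Notation Bi := (Bi C sp).

Record fam (A : algType C) (F : idx n -> idx n -> A) : Prop := Fam {
  fam_sym : forall c d, F d c = - eps *: F c d;
  fam_br : forall a b c d, lieb (F a b) (F c d) =
    Bi b c *: F a d - (eps * Bi a c) *: F b d + Bi b d *: F c a - (eps * Bi a d) *: F c b }.

Lemma fam_corr (A A' : algType C) Rl (F : idx n -> idx n -> A) (F' : idx n -> idx n -> A') :
  corr Rl -> (forall c d, Rl (F c d) (F' c d)) -> fam F -> fam F'.
Proof.
move=> HR h [d1 d2]; split=> [c d|a b c d].
  by apply/(corr_eq HR (h _ _) (corrZ HR _ (h _ _))).
have R1 := corrL HR (h a b) (h c d).
have R2 := corrB HR (corrD HR (corrB HR (corrZ HR (Bi b c) (h a d))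
  (corrZ HR (eps * Bi a c) (h b d))) (corrZ HR (Bi b d) (h c a))) (corrZ HR (eps * Bi a d) (h c b)).
by apply/(corr_eq HR R1 R2).
Qed.

Variables (r : nat) (V : nzmod C) (rho : idx n -> idx n -> End V) (eta : bool -> 'I_r -> idx n -> End V)
  (th : 'I_0 -> idx n -> End V).
Hypothesis D : datum sp rho eta th.
Hypothesis nr : (n + n <= r)%N.

Definition omsum c d : End V := \sum_j om2 sp (eta true j) (eta false j) c d.
Local Notation pi := (totop sp rho eta th).
Hypothesis fpi : fam pi.

Lemma pi_om c d : pi c d = rho c d + omsum c d.
Proof. by rewrite /totop big_ord0 addr0. Qed.

Lemma rho_om a b c d : comm0 (rho a b) (omsum c d).
Proof. by apply: commr_sum => j _; apply: om2_comm; apply/commr_sym/(dt_comm D). Qed.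

Lemma fam_om : fam omsum.
Proof.
have e c d : omsum c d = pi c d - rho c d by rewrite pi_om addrAC subrr add0r.
split=> [c d|a b c d].
  by rewrite !e (fam_sym fpi) (dt_sym D) scalerBr.
have -> : lieb (omsum a b) (omsum c d) = lieb (pi a b) (pi c d) - lieb (rho a b) (rho c d).
  rewrite !pi_om !liebDl !liebDr [lieb (rho a b) (omsum c d)](_ : _ = 0); last by apply/lieb0P/rho_om.
  rewrite [lieb (omsum a b) (rho c d)](_ : _ = 0); last by apply/lieb_sym0/lieb0P/rho_om.
  by rewrite addr0 add0r addrAC subrr add0r.
rewrite (fam_br fpi) (dt_br D) !e !scalerBr.
do ?[move: (_ *: pi _ _) => ?]; do ?[move: (_ *: rho _ _) => ?].
by ncr.
Qed.

Lemma sgB (c : idx n) : Bi c (ineg c) * Bi c (ineg c) = 1.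
Proof. by rewrite BiE eqxx sgK. Qed.
Lemma inegK (c : idx n) : ineg (ineg c) = c.
Proof. by case: c => b i; rewrite /ineg /= negbK. Qed.

(** Combinations of the canonical variables have arbitrary scalar brackets with them. The
    coefficients [x] and [z] invert B, whose nonzero entries, between opposite indices, are
    signs. *)
Lemma linear_form (U W : 'I_r -> idx n -> C) : exists ell : End V,
  [/\ forall j c, lieb ell (eta true j c) = U j c *: 1,
      forall j c, lieb ell (eta false j c) = W j c *: 1 & forall c d, lieb ell (rho c d) = 0].
Proof.
pose x j k := Bi k (ineg k) * W j (ineg k).
pose z j k := - (Bi (ineg k) k * U j (ineg k)).
exists (\sum_j \sum_k (x j k *: eta true j k + z j k *: eta false j k)); split=> [j c|j c|c d].
- rewrite lieb_suml (bigD1 j) //= [X in _ + X]big1 ?addr0 => [|i ij]; last first.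
    rewrite lieb_suml big1 // => k _; rewrite liebDl !liebZl.
    have -> : lieb (eta true i k) (eta true j c) = 0 by apply/lieb0P/(dt_cross D).
    have -> : lieb (eta false i k) (eta true j c) = 0 by apply/lieb0P/(dt_cross D).
    by rewrite !scaler0 addr0.
  rewrite lieb_suml (bigD1 (ineg c)) //= big1 ?addr0 => [|k kc].
    rewrite liebDl !liebZl (dt_same D) scaler0 add0r liebC (dt_pair D) scalerN scalerA -scaleNr.
    by rewrite /z inegK mulNr opprK mulrAC sgB mul1r.
  rewrite liebDl !liebZl (dt_same D) scaler0 add0r liebC (dt_pair D) BiE.
  by rewrite (negbTE kc) scale0r oppr0 scaler0.
- rewrite lieb_suml (bigD1 j) //= [X in _ + X]big1 ?addr0 => [|i ij]; last first.
    rewrite lieb_suml big1 // => k _; rewrite liebDl !liebZl.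
    have -> : lieb (eta true i k) (eta false j c) = 0 by apply/lieb0P/(dt_cross D).
    have -> : lieb (eta false i k) (eta false j c) = 0 by apply/lieb0P/(dt_cross D).
    by rewrite !scaler0 addr0.
  rewrite lieb_suml (bigD1 (ineg c)) //= big1 ?addr0 => [|k kc].
    rewrite liebDl !liebZl (dt_same D) scaler0 addr0 (dt_pair D) scalerA /x !inegK.
    have e : Bi (ineg c) c * Bi (ineg c) c = 1 by have := sgB (ineg c); rewrite inegK.
    by rewrite mulrAC e mul1r.
  rewrite liebDl !liebZl (dt_same D) scaler0 addr0 (dt_pair D) BiE.
  case: eqP => [e|_]; last by rewrite scale0r scaler0.
  by rewrite e inegK eqxx in kc.
- rewrite lieb_suml big1 // => j _; rewrite lieb_suml big1 // => k _; rewrite liebDl !liebZl.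
  have -> : lieb (eta true j k) (rho c d) = 0 by apply/lieb0P/(dt_comm D).
  have -> : lieb (eta false j k) (rho c d) = 0 by apply/lieb0P/(dt_comm D).
  by rewrite !scaler0 addr0.
Qed.

Lemma second_bracket (U W : 'I_r -> idx n -> C) (ell : End V) c d :
  (forall j c, lieb ell (eta true j c) = U j c *: 1) ->
  (forall j c, lieb ell (eta false j c) = W j c *: 1) ->
  lieb ell (lieb ell (omsum c d)) = ((\sum_j (U j d * W j c - eps * (U j c * W j d))) *: 1) *+ 2.
Proof.
move=> hU hW; rewrite /omsum !lieb_sumr scaler_suml -sumrMnl; apply: eq_bigr => j _.
have -> : lieb ell (om2 sp (eta true j) (eta false j) c d) =
    W j c *: eta true j d + U j d *: eta false j c - eps *: (W j d *: eta true j c + U j c *: eta false j d).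
  by rewrite /om2 liebBr liebZr !liebMr !hU !hW -!scalerAr -!scalerAl !mulr1 !mul1r.
rewrite liebBr liebZr !liebDr !liebZr !hU !hW !scalerA.
rewrite [W j c * _]mulrC [W j d * _]mulrC -!mulr2n -scalerMnr -mulrnBl scalerA.
by rewrite -scalerBl.
Qed.

(** One ordering of each pair of distinct indices, and the diagonal in the symplectic case only,
    where F_cc need not vanish: the labels of a basis of g(2n). *)
Definition Pset : {set idx n * idx n} :=
  [set p | (enum_rank p.1 < enum_rank p.2)%N || sp && (p.1 == p.2)].

(** With r >= 2n pairs, [U] can be an identity block, and then [W] realises any matrix [Z] as the
    sum over j of U_jd W_jc. This is where the number of pairs enters. *)
Lemma prescribe (s : 'I_#|Pset| -> C) : exists ell : End V,
  (forall a, lieb ell (lieb ell (omsum (enum_val a).1 (enum_val a).2)) = (s a *: 1) *+ 2) /\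
  forall c d, lieb ell (rho c d) = 0.
Proof.
pose sig (c d : idx n) := \sum_a (if enum_val a == (c, d) then s a else 0).
have sigE (a : 'I_#|Pset|) : sig (enum_val a).1 (enum_val a).2 = s a.
  rewrite /sig -surjective_pairing (bigD1 a) //= eqxx big1 ?addr0 // => b ba.
  by rewrite (inj_eq enum_val_inj) (negbTE ba).
have sig0 c d : (c, d) \notin Pset -> sig c d = 0.
  move=> h; rewrite /sig big1 // => a _; case: eqP => // e.
  by have := enum_valP a; rewrite e (negbTE h).
(* Only one order of each off-diagonal pair carries a value. On the diagonal, in the symplectic
   case, both terms of [second_bracket] contribute equally, hence the half. *)
pose Z (d c : idx n) := if c == d then 2^-1 * sig c d else sig c d.
have cardI : #|{: idx n}| = (n + n)%N by rewrite card_prod card_bool card_ord mul2n addnn.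
have le : (#|{: idx n}| <= r)%N by rewrite cardI.
pose U (j : 'I_r) (c : idx n) : C := (j == widen_ord le (enum_rank c))%:R.
pose W (j : 'I_r) (c : idx n) : C := \sum_d U j d * Z d c.
have UW c d : \sum_j U j d * W j c = Z d c.
  rewrite (bigD1 (widen_ord le (enum_rank d))) //= /U eqxx mul1r big1 ?addr0 => [|j /negbTE ->]; last by rewrite mul0r.
  rewrite /W /U (bigD1 d) //= eqxx mul1r big1 ?addr0 // => e ed.
  case: eqP => [/(congr1 val) /= /val_inj /enum_rank_inj e'|_]; last by rewrite mul0r.
  by rewrite e' eqxx in ed.
have [ell [h1 h2 h3]] := linear_form U W; exists ell; split=> // a.
rewrite (second_bracket _ _ h1 h2) sumrB -mulr_sumr !UW -[in RHS](sigE a); congr (_ *: _ *+ 2).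
have := enum_valP a; case: (enum_val a) => c d /=; rewrite inE /= /Z [d == c]eq_sym.
have [<-|cd] := eqVneq c d.
  rewrite ltnn andbT /= => h; rewrite /form_eps h mulN1r opprK -mulrDl.
  by rewrite (_ : 2^-1 + 2^-1 = 1) ?mul1r // [RHS]splitr !mul1r.
rewrite andbF orbF => h; rewrite [sig d c]sig0 ?mulr0 ?subr0 //.
by rewrite inE /= [d == c]eq_sym (negbTE cd) andbF orbF -leqNgt ltnW.
Qed.

(* A sorted polynomial vanishes at [pi], or at [omsum], only if all its coefficients do:
   the flows provided by [prescribe] separate its monomials of top degree. *)
Theorem infinite_corr : exists2 Rl, corr Rl & forall c d, Rl (pi c d) (omsum c d).
Proof.
(* In the product algebra both components of an element share one sorted expansion, so the vanishing
   of either reduces to the same coefficients. *)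
pose AA : algType C := (End V * End V)%type.
pose Y (a : 'I_#|Pset|) : AA := (pi (enum_val a).1 (enum_val a).2, omsum (enum_val a).1 (enum_val a).2).
have gen c d : Spanp (fun z => exists a, z = Y a) ((pi c d, omsum c d) : AA).
  have inP c0 d0 : (c0, d0) \in Pset -> Spanp (fun z => exists a, z = Y a) ((pi c0 d0, omsum c0 d0) : AA).
    move=> h; apply: SpanG; exists (enum_rank_in h (c0, d0)).
    by rewrite /Y enum_rankK_in.
  have [h|h] := boolP ((c, d) \in Pset); first exact: inP.
  have [h'|h'] := boolP ((d, c) \in Pset).
    have -> : ((pi c d, omsum c d) : AA) = - eps *: ((pi d c, omsum d c) : AA).
      by congr pair; [exact: (fam_sym fpi) | exact: (fam_sym fam_om)].
    by apply/SpanZ/inP.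
  have cd : c = d.
    move: h h'; rewrite !inE !negb_or -!leqNgt => /andP [h1 _] /andP [h2 _].
    by apply: enum_rank_inj; apply: val_inj; apply: anti_leq; rewrite h1 h2.
  move: h; rewrite cd inE eqxx andbT negb_or => /andP [_ spf].
  have z0 (F : idx n -> idx n -> End V) : fam F -> F d d = 0.
    move=> hF; have := fam_sym hF d d; rewrite /form_eps (negbTE spf) scaleN1r => /eqP.
    by rewrite -addr_eq0 -mulr2n -scaler_nat scaler_eq0 pnatr_eq0 => /eqP.
  by rewrite (z0 _ fpi) (z0 _ fam_om); apply: Span0.
have brY a b : Spanp (fun z => exists c, z = Y c) (lieb (Y a) (Y b)).
  rewrite /Y; case: (enum_val a) => a1 a2; case: (enum_val b) => b1 b2 /=.
  have -> : lieb ((pi a1 a2, omsum a1 a2) : AA) ((pi b1 b2, omsum b1 b2) : AA)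
     = (lieb (pi a1 a2) (pi b1 b2), lieb (omsum a1 a2) (omsum b1 b2)) by [].
  rewrite (fam_br fpi) (fam_br fam_om).
  pose G c d : AA := (pi c d, omsum c d).
  have -> : forall k1 k2 k3 k4, ((k1 *: pi a1 b2 - k2 *: pi a2 b2 + k3 *: pi b1 a1 - k4 *: pi b1 a2,
     k1 *: omsum a1 b2 - k2 *: omsum a2 b2 + k3 *: omsum b1 a1 - k4 *: omsum b1 a2) : AA) =
     k1 *: G a1 b2 - k2 *: G a2 b2 + k3 *: G b1 a1 - k4 *: G b1 a2 by [].
  by apply: SpanB; [apply: SpanD; [apply: SpanB|]|]; apply/SpanZ/gen.
have algG c d : algp Y ((pi c d, omsum c d) : AA).
  have z0 : algp Y 0 by rewrite -(scale0r 1); apply/alg_scale/alg_one.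
  apply: (Span_min (S := algp Y)) (gen c d) => [|u v|k u|u [a ->]] //.
  - exact: alg_add.
  - exact: alg_scale.
  - exact: alg_gen.
exists (fun z1 z2 => algp Y ((z1, z2) : AA)); last by move=> c d; apply: algG.
split.
- exact: alg_one.
- move=> a a' b b' h h'; exact: (alg_add h h').
- move=> a a' b b' h h'; exact: (alg_mul h h').
- move=> c a b h; exact: (alg_scale c h).
move=> z1 z2 /(algp_sorted brY) [d /sorted_expansion [ws [c [uw sw e]]]].
have e1 : z1 = \sum_(w <- ws) c w *: yw (fun a => (Y a).1) w.
  have := congr1 fst e; rewrite /= => ->; elim/big_rec2: _ => // w u v _ <-.
  rewrite /=; congr (_ *: _ + _); rewrite /yw; elim: w => [|b w IH]; first by rewrite !big_nil.
  by rewrite !big_cons /= IH.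
have e2 : z2 = \sum_(w <- ws) c w *: yw (fun a => (Y a).2) w.
  have := congr1 snd e; rewrite /= => ->; elim/big_rec2: _ => // w u v _ <-.
  rewrite /=; congr (_ *: _ + _); rewrite /yw; elim: w => [|b w IH]; first by rewrite !big_nil.
  by rewrite !big_cons /= IH.
have c0 (z : End V) : (forall w, w \in ws -> c w = 0) -> \sum_(w <- ws) c w *: yw (fun a => (Y a).1) w = 0
   /\ \sum_(w <- ws) c w *: yw (fun a => (Y a).2) w = 0.
  by move=> h; split; rewrite big1_seq // => w /andP [_ /h ->]; rewrite scale0r.
split=> h.
  rewrite e2; apply: (proj2 (c0 z1 _)); apply: (yw_independent (y := fun a => (Y a).1)) => //.
    move=> s; have [ell [l1 l2]] := prescribe s; exists ell => a /=.
    (* [ell] commutes with [rho], so its brackets with [pi] and [omsum] agree. *)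
    rewrite -l1; congr (lieb _ _).
    by rewrite pi_om -[RHS]add0r -(l2 (enum_val a).1 (enum_val a).2); apply: liebDr.
  by rewrite -e1.
rewrite e1; apply: (proj1 (c0 z1 _)); apply: (yw_independent (y := fun a => (Y a).2)) => //.
  by move=> s; have [ell [l1 l2]] := prescribe s; exists ell.
by rewrite -e2.
Qed.

End Infinite.

(** * Representations of sl2 and weights *)

Section Eigenvectors.
Variable C : numClosedFieldType.
Variable V : nzmod C.
Variable h : End V.

Definition eigop (cs : seq C) : End V := \prod_(c <- cs) (h - c *: 1).

Lemma eigop_cons c cs v : eigop (c :: cs) v = h (eigop cs v) - c *: eigop cs v.
Proof. by rewrite /eigop big_cons endME endBE endZE end1E. Qed.
Lemma eigop_cat c1 c2 v : eigop (c1 ++ c2) v = eigop c1 (eigop c2 v).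
Proof. by rewrite /eigop big_cat endME. Qed.
Lemma eigop_nil v : eigop [::] v = v.
Proof. by rewrite /eigop big_nil. Qed.

Lemma eigop_eig cs c v : h v = c *: v -> eigop cs v = (\prod_(d <- cs) (c - d)) *: v.
Proof.
move=> e; elim: cs => [|d cs IH]; first by rewrite eigop_nil big_nil scale1r.
by rewrite eigop_cons IH efunZ e big_cons !scalerA mulrBl scalerBl [c * _]mulrC.
Qed.

Lemma eigop_stab (S : V -> Prop) cs v : (forall u v, S u -> S v -> S (u + v)) ->
  (forall c u, S u -> S (c *: u)) -> (forall u, S u -> S (h u)) -> S v -> S (eigop cs v).
Proof.
move=> sD sZ sh sv; elim: cs => [|d cs IH]; first by rewrite eigop_nil.
by rewrite eigop_cons -scaleNr; apply: sD; [apply: sh | apply: sZ].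
Qed.

(** The image of v under the other factors is an eigenvector for c. Removing its multiple by the
    inverse of the product of the c - d leaves a vector killed by these other factors, and induction
    applies. *)
Lemma eigop_components (S : V -> Prop) cs v : (forall u v, S u -> S v -> S (u + v)) ->
  (forall c u, S u -> S (c *: u)) -> (forall u, S u -> S (h u)) -> uniq cs ->
  S v -> eigop cs v = 0 ->
  Spanp (fun w => S w /\ exists2 c, c \in cs & h w = c *: w) v.
Proof.
move=> sD sZ sh; elim: cs v => [|c cs IH] v /=.
  by rewrite eigop_nil => _ _ ->; apply: Span0.
move=> /andP [ncs ucs] sv; rewrite eigop_cons; set u := eigop cs v => /subr0_eq hu.
have su : S u by apply: eigop_stab.
set k := \prod_(d <- cs) (c - d).
have k0 : k != 0.
  rewrite prodf_seq_neq0; apply/allP => d dcs /=; rewrite subr_eq0.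
  by apply: contraNneq ncs => ->.
rewrite -[v](subrK (k^-1 *: u)); apply: SpanD; last first.
  by apply/SpanZ/SpanG; split=> //; exists c => //; exact: mem_head.
apply: (Span_sub (P := fun w => S w /\ exists2 c, c \in cs & h w = c *: w)).
  move=> w [sw [d dcs e]]; apply: SpanG; split=> //; exists d => //; by rewrite inE dcs orbT.
apply: IH => //; first by rewrite -scaleNr; apply: sD => //; apply: sZ.
by rewrite efunB efunZ (eigop_eig _ hu) scalerA mulVf // scale1r subrr.
Qed.

Lemma Span_eigop (K : C -> Prop) v : Spanp (fun w => exists2 c, K c & h w = c *: w) v ->
  exists cs, [/\ uniq cs, forall c, c \in cs -> K c & eigop cs v = 0].
Proof.
elim=> [|a x w [e Ke ex] _ [cs [h1 h2 h3]]].
  by exists [::]; rewrite eigop_nil.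
have [ecs|necs] := boolP (e \in cs).
  exists cs; split=> //; rewrite efunP h3 (eigop_eig _ ex) (big_rem e) //= subrr mul0r.
  by rewrite scale0r scaler0 addr0.
exists (e :: cs); split; first by rewrite /= necs.
  by move=> c; rewrite inE => /orP [/eqP ->|/h2].
by rewrite eigop_cons efunP h3 addr0 (eigop_eig _ ex) !efunZ ex !scalerA mulrC mulrA subrr.
Qed.

Definition diag := forall v, Spanp (fun w : V => exists c, h w = c *: w) v.

End Eigenvectors.

Section Commuting.
Variable C : numClosedFieldType.
Variable V : nzmod C.

Definition joint (I : Type) (hs : I -> End V) (w : V) := forall i, exists c, hs i w = c *: w.

Lemma joint_list (I : eqType) (hs : I -> End V) (L : seq I) (S : V -> Prop) v :
  (forall i j, comm0 (hs i) (hs j)) -> (forall i, diag (hs i)) ->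
  (forall u v, S u -> S v -> S (u + v)) -> (forall c u, S u -> S (c *: u)) ->
  (forall i u, S u -> S (hs i u)) -> S v ->
  Spanp (fun w => S w /\ forall i, i \in L -> exists c, hs i w = c *: w) v.
Proof.
move=> cm dg sD sZ sh sv; elim: L => [|i L IH]; first by apply: SpanG.
apply: Span_sub IH => u [su eu].
have [|cs [ucs _ ecs]] := @Span_eigop _ _ (hs i) (fun _ => True) u.
  by apply: Span_sub (dg i u) => w [c e]; apply: SpanG; exists c.
have /choice [ev Hev] : forall j, exists c, j \in L -> hs j u = c *: u.
  move=> j; case: (boolP (j \in L)) => [/eu [c e]|_]; [by exists c | by exists 0].
pose T w := S w /\ forall j, j \in L -> hs j w = ev j *: w.
apply: (Span_sub (P := fun w => T w /\ exists2 c, c \in cs & hs i w = c *: w)).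
  move=> w [[sw Tw] [c _ e]]; apply: SpanG; split=> // j.
  by rewrite inE => /orP [/eqP ->|/Tw e']; [exists c | exists (ev j)].
apply: eigop_components => //.
- move=> a b [sa ta] [sb tb]; split; first exact: sD.
  by move=> j jL; rewrite efunD ta // tb // scalerDr.
- move=> c a [sa ta]; split; first exact: sZ.
  by move=> j jL; rewrite efunZ ta // !scalerA mulrC.
- move=> a [sa ta]; split; first exact: sh.
  by move=> j jL; rewrite -endME (cm j i) endME ta // efunZ.
Qed.

Lemma joint_diag (I : finType) (hs : I -> End V) (S : V -> Prop) v :
  (forall i j, comm0 (hs i) (hs j)) -> (forall i, diag (hs i)) ->
  (forall u v, S u -> S v -> S (u + v)) -> (forall c u, S u -> S (c *: u)) ->
  (forall i u, S u -> S (hs i u)) -> S v ->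
  Spanp (fun w => S w /\ joint hs w) v.
Proof.
move=> cm dg sD sZ sh sv; have := joint_list (enum I) cm dg sD sZ sh sv.
apply: Span_sub => w [sw jw]; apply: SpanG; split=> // i.
by apply: jw; rewrite mem_enum.
Qed.

End Commuting.

Section SL2.
Variable C : numClosedFieldType.
Variable V : nzmod C.

Record sl2 (e f h : End V) : Prop := Sl2 {
  sl_ef : lieb e f = h;
  sl_he : lieb h e = 2 *: e;
  sl_hf : lieb h f = - (2 *: f);
  sl_e : locnilp e;
  sl_f : locnilp f }.

Lemma sl2_sym e f h : sl2 e f h -> sl2 f e (- h).
Proof.
case=> h1 h2 h3 h4 h5; split=> //; first by rewrite liebC h1.
  by rewrite liebNl h3 opprK.
by rewrite liebNl h2.
Qed.

Section Triple.
Variables e f h : End V.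
Hypothesis T : sl2 e f h.
Implicit Types (v w x u : V).

Lemma ef x : e (f x) = f (e x) + h x.
Proof. by rewrite -(sl_ef T) /lieb endBE !endME addrC subrK. Qed.
Lemma he x : h (e x) = e (h x) + 2 *: e x.
Proof. by rewrite -endZE -(sl_he T) /lieb endBE !endME addrC subrK. Qed.
Lemma hf x : h (f x) = f (h x) - 2 *: f x.
Proof. by rewrite -endZE -endNE -(sl_hf T) /lieb endBE !endME addrC subrK. Qed.

Lemma hfk k x : h ((f ^+ k) x) = (f ^+ k) (h x) - (2 * k%:R) *: (f ^+ k) x.
Proof.
elim: k => [|k IH]; first by rewrite mulr0 scale0r subr0.
rewrite !end_expS hf IH efunB efunZ -addrA -opprD -scalerDl; congr (_ - _ *: _).
ring.
Qed.

Lemma efk k x : e ((f ^+ k.+1) x) = (f ^+ k.+1) (e x) + k.+1%:R *: (f ^+ k) (h x - k%:R *: x).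
Proof.
elim: k x => [|k IH] x.
  by rewrite expr1 expr0 end1E scale0r subr0 scale1r ef.
rewrite end_expS ef IH efunD -end_expS efunZ -end_expS hfk -addrA; congr (_ + _).
rewrite !efunB !efunZ !scalerBr !scalerA.
have lin2 (a b c : C) (A B : V) : a *: A - b *: B + (A - c *: B) = (a + 1) *: A - (b + c) *: B.
  by rewrite addrACA -opprD !scalerDl scale1r.
rewrite lin2.
by congr (_ *: _ - _ *: _); ring.
Qed.

(** By [efk], e f^(k+1) w = (k + 1)(c - k) f^k w with a nonzero factor, so f^(k+1) w = 0 implies f^k
    w = 0; the descent starts from the local nilpotence of f. *)
Lemma low_eq0 w c : h w = c *: w -> (forall j : nat, c != j%:R) -> f (e w) = 0 -> w = 0.
Proof.
move=> hw cj fe; have [k] := sl_f T w; elim: k => [|k IH] // hk; apply: IH.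
have := efk k w; rewrite hk efun0 end_expSr fe efun0 add0r hw -scalerBl efunZ scalerA => /esym /eqP.
by rewrite scaler_eq0 mulf_eq0 pnatr_eq0 /= subr_eq0 (negbTE (cj k)) => /eqP.
Qed.
End Triple.

Section Diagonal.
Variables e f h : End V.
Hypothesis T : sl2 e f h.
Implicit Types (v w x u : V).

Definition nats k : seq C := [seq i%:R | i <- iota 0 k].
Lemma nats_uniq k : uniq (nats k).
Proof. by rewrite map_inj_uniq ?iota_uniq // => i j /eqP; rewrite eqr_nat => /eqP. Qed.

Lemma ker_eigop k x : e x = 0 -> (e ^+ k) ((f ^+ k) x) = k`!%:R *: eigop h (nats k) x.
Proof.
elim: k x => [|k IH] x ex; first by rewrite eigop_nil scale1r.
rewrite end_expSr (efk T) ex efun0 add0r efunZ IH; last first.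
  have := he T x; rewrite ex efun0 scaler0 addr0 => e0.
  by rewrite efunB efunZ ex scaler0 subr0 -e0.
rewrite /nats -addn1 iotaD map_cat eigop_cat addn1 factS natrM -scalerA add0n /=.
by rewrite eigop_cons eigop_nil.
Qed.

(** For u nonzero, the standard weight vectors f^j u of the simple sl2-module of highest weight
    l. *)
Definition string w := exists u (l j : nat),
  [/\ e u = 0, h u = l%:R *: u, (f ^+ l.+1) u = 0, (j <= l)%N & w = (f ^+ j) u].

Lemma neg_nat (l : nat) (j : nat) : - l.+2%:R != j%:R :> C.
Proof. by rewrite eq_sym -addr_eq0 -natrD pnatr_eq0 addnS. Qed.

(** By [ker_eigop], the local nilpotence of f makes a product of factors h - i kill x, so x splits
    into eigenvectors of e-kernel type with natural weights l. Then f^(l+1) u has weight -l-2 and is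
    killed by e, hence is 0 by [low_eq0]. *)
Lemma ker_string x : e x = 0 -> Spanp string x.
Proof.
move=> ex; have [k fk] := sl_f T x.
have z0 : eigop h (nats k) x = 0.
  have := ker_eigop k ex; rewrite fk efun0 => /esym /eqP.
  by rewrite scaler_eq0 pnatr_eq0 (gtn_eqF (fact_gt0 _)) => /eqP.
apply: Span_sub; last first.
  apply: (@eigop_components _ _ h (fun x => e x = 0) _ x _ _ _ (nats_uniq k) ex z0).
  - by move=> u v eu ev; rewrite efunD eu ev addr0.
  - by move=> c u eu; rewrite efunZ eu scaler0.
  - by move=> u eu; have := he T u; rewrite eu efun0 scaler0 addr0.
move => u [eu [_ /mapP [l _ ->] hu]]; apply: SpanG; exists u, l, 0%N; split=> //.
apply: (low_eq0 T (c := - l.+2%:R)); last 2 first.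
- exact: neg_nat.
- by rewrite (efk T) eu efun0 hu subrr !efun0 scaler0 addr0 efun0.
rewrite (hfk T) hu efunZ -scalerBl; congr (_ *: _).
ring.
Qed.

(** For j < l the vector f^j u is a multiple of e f^(j+1) u. What cannot be lifted through e are the
    lowest vectors f^l u, of weight -l. *)
Lemma string_step x : Spanp string x -> exists2 d, Spanp string d &
  Spanp (fun w => f w = 0 /\ exists l : nat, h w = - l%:R *: w) (x - e d).
Proof.
elim=> [|a _ w [u [l [j [eu hu fu jl ->]]]] _ [d d1 d2]].
  by exists 0; rewrite ?efun0 ?subr0; apply: Span0.
move: jl; rewrite leq_eqVlt => /orP [/eqP -> {j}|jl].
  exists d => //; rewrite -addrA; apply: SpanD => //; apply/SpanZ/SpanG; split.
    by rewrite -end_expS.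
  exists l; rewrite (hfk T) hu efunZ -scalerBl; congr (_ *: _); ring.
have k0 : j.+1%:R * (l%:R - j%:R) != 0 :> C.
  by rewrite mulf_neq0 ?pnatr_eq0 // subr_eq0 eqr_nat gtn_eqF.
exists ((a / (j.+1%:R * (l%:R - j%:R))) *: (f ^+ j.+1) u + d).
  by apply: SpanD => //; apply/SpanZ/SpanG; exists u, l, j.+1.
rewrite efunP (efk T) eu efun0 add0r hu -scalerBl efunZ !scalerA -[_ * _ * (l%:R - j%:R)]mulrA divfK //.
by rewrite opprD addrACA subrr add0r.
Qed.

Lemma eigop_shift (L : seq nat) v : e (eigop h [seq - i.+2%:R | i <- L] v) = eigop h [seq - i%:R | i <- L] (e v).
Proof.
elim: L => [|l L IH]; first by rewrite !eigop_nil.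
rewrite /= !eigop_cons -IH (he T) efunB efunZ -addrA; congr (_ + _).
by rewrite -scalerBl -scaleNr; congr (_ *: _); ring.
Qed.

(* Up to strings, [e v] is a sum of lowest weight vectors; a preimage of such a vector
   would have a negative weight [c], and [e f^(j+1)] acts on it as the nonzero multiple
   [(j + 1) (c - j)] of [f^j], which contradicts the local nilpotence of [f]. *)
Lemma string_up v : Spanp string (e v) -> Spanp string v.
Proof.
move=> /string_step [d dS hl]; rewrite -[v](subrK d); apply: SpanD => {dS} //.
move: hl; rewrite -efunB; move: (v - d) => {d} {}v hl.
have fev : f (e v) = 0.
  apply: (@Span_min _ _ _ (fun x => f x = 0) _ _ _ _ _ hl) => [|x y h1 h2|c x h1|x []] //.
  - exact: efun0.
  - by rewrite efunD h1 h2 addr0.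
  - by rewrite efunZ h1 scaler0.
have [|cs [ucs csn ecs]] := @Span_eigop _ _ h (fun c => exists l : nat, c = - l%:R) (e v).
  by apply: Span_sub hl => w [_ [l hw]]; apply: SpanG; exists (- l%:R) => //; exists l.
have [L defL] : exists L : seq nat, cs = [seq - i%:R | i <- L].
  elim: cs csn {ucs ecs} => [|c cs IH] h0; first by exists [::].
  have [|L ->] := IH; first by move=> c' h1; apply: h0; rewrite inE h1 orbT.
  by have [l ->] := h0 c (mem_head _ _); exists (l :: L).
have uL : uniq [seq - i.+2%:R : C | i <- L].
  move: ucs; rewrite defL => /map_uniq uL; rewrite map_inj_uniq // => i j /oppr_inj /eqP.
  by rewrite eqr_nat => /eqP [].
pose z := eigop h [seq - i.+2%:R | i <- L] v.
have ez : e z = 0 by rewrite /z eigop_shift -defL.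
have [k fk] := sl_f T z.
have z0 : eigop h (nats k) z = 0.
  have := ker_eigop k ez; rewrite fk efun0 => /esym /eqP.
  by rewrite scaler_eq0 pnatr_eq0 (gtn_eqF (fact_gt0 _)) => /eqP.
have un : uniq (nats k ++ [seq - i.+2%:R | i <- L]).
  rewrite cat_uniq nats_uniq uL andbT /=; apply/hasPn => _ /mapP [l _ ->]; apply/negP => /mapP [j _ /eqP].
  by rewrite (negbTE (neg_nat _ _)).
rewrite /z -eigop_cat in z0.
apply: Span_sub; last first.
  apply: (@eigop_components _ _ h (fun x => f (e x) = 0) _ v _ _ _ un fev z0).
  - by move=> x y eu ev; rewrite !efunD eu ev addr0.
  - by move=> c u eu; rewrite !efunZ eu scaler0.
  - move=> u eu; have : h (f (e u)) = 0 by rewrite eu efun0.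
    by rewrite (hf T) (he T) efunD efunZ eu scaler0 addr0 subr0.
move => w [few [c ccs hw]]; apply: ker_string; move: ccs.
rewrite mem_cat => /orP [] /mapP [l _ ec]; last first.
  by rewrite (low_eq0 T hw _ few) ?efun0 // => j; rewrite ec neg_nat.
apply: (low_eq0 (sl2_sym T) (c := - l.+2%:R)); last 2 first.
- exact: neg_nat.
- by rewrite few efun0.
rewrite endNE (he T) hw ec efunZ -scalerDl scaleNr; congr (- (_ *: _)).
by rewrite -natrD addn2.
Qed.

(** Strings consist of weight vectors, and they span the module: by [string_up] this follows by
    induction on the power of e that kills v. *)
Theorem sl2_diag : diag h.
Proof.
move=> v; have : Spanp string v.
  have [k] := sl_e T v; elim: k v => [|k IH] v.
    by rewrite expr0 end1E => ->; apply: Span0.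
  by rewrite end_expSr => /IH /string_up.
apply: Span_sub => _ [u [l [j [_ hu _ _ ->]]]]; apply: SpanG.
by exists (l%:R - 2 * j%:R); rewrite (hfk T) hu efunZ -scalerBl.
Qed.
End Diagonal.
End SL2.

Section Weights.
Variable C : numClosedFieldType.
Variable sp : bool.
Local Notation eps := (form_eps C sp).
Variable n : nat.
Local Notation Bi := (Bi C sp).
Local Notation fam := (@fam C sp n _).

(** The weight of e_a for the Cartan element [hop c], which acts by 1 on e_c and by -1 on the
    opposite vector. *)
Definition wt (c a : idx n) : C := (a == c)%:R - (a == ineg c)%:R.

Lemma ineg_neq (c : idx n) : (ineg c == c) = false.
Proof. by case: c => b i; rewrite /ineg xpair_eqE; case: b. Qed.
Lemma ineg_eq (c d : idx n) : (ineg c == d) = (c == ineg d).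
Proof. by rewrite -[d in LHS]inegK (inj_eq (can_inj (@inegK n))). Qed.
Lemma wtN c a : wt c (ineg a) = - wt c a.
Proof. by rewrite /wt ineg_eq (inj_eq (can_inj (@inegK n))) opprB. Qed.
Lemma BiC (c d : idx n) : Bi d c = eps * Bi c d.
Proof. by apply/BfC/io_neq0. Qed.
Lemma sgB' (c : idx n) : Bi (ineg c) c * Bi (ineg c) c = 1.
Proof. by have := sgB C sp (ineg c); rewrite inegK. Qed.
Section Family.
Variables (A : algType C) (F : idx n -> idx n -> A).
Hypothesis hF : fam F.

Definition hop c : A := Bi (ineg c) c *: F c (ineg c).

Lemma wt_row (t : idx n -> A) c a :
  Bi (ineg c) c *: (Bi (ineg c) a *: t c - (eps * Bi c a) *: t (ineg c)) = wt c a *: t a.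
Proof.
rewrite scalerBr !scalerA /wt.
have -> : Bi (ineg c) c * Bi (ineg c) a = (a == c)%:R.
  rewrite [Bi _ a]BiE inegK; case: eqP => _; rewrite ?mulr0 //.
  by have := sgB' c; rewrite {2}BiE inegK eqxx.
have -> : Bi (ineg c) c * (eps * Bi c a) = (a == ineg c)%:R.
  rewrite [Bi c a]BiE; case: eqP => _; rewrite ?mulr0 //.
  by have := sgB C sp c; rewrite {2}BiE eqxx (BiC c) mulrACA epsK mul1r.
rewrite scalerBl; congr (_ - _); first by case: eqP => [->|]; rewrite ?scale0r.
by case: eqP => [->|]; rewrite ?scale0r.
Qed.

Lemma hop_vec (t : idx n -> A) c a :
  (forall p, lieb (F c (ineg c)) (t p) = Bi (ineg c) p *: t c - (eps * Bi c p) *: t (ineg c)) ->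
  lieb (hop c) (t a) = wt c a *: t a.
Proof. by move=> h; rewrite /hop liebZl h wt_row. Qed.

Lemma hop_root c a b : lieb (hop c) (F a b) = (wt c a + wt c b) *: F a b.
Proof.
by rewrite scalerDl -(wt_row (fun p => F p b)) -(wt_row (fun p => F a p)) -scalerDr /hop liebZl
  (fam_br hF) addrA.
Qed.

Lemma hop_comm c d : comm0 (hop c) (hop d).
Proof.
apply/lieb0P; rewrite {2}/hop liebZr hop_root wtN subrr scale0r scaler0 //.
Qed.

Lemma hopN c : hop (ineg c) = - hop c.
Proof.
by rewrite /hop inegK (fam_sym hF) (BiC (ineg c)) scaleNr scalerN scalerA mulrAC epsK mul1r.
Qed.

Lemma triple_o a b : ~~ sp -> b != a -> b != ineg a ->
  lieb (F a b) (- F (ineg a) (ineg b)) = hop a + hop b.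
Proof.
move=> spf ba bna; rewrite liebNr (fam_br hF) /hop.
have e1 : eps = 1 by rewrite /form_eps (negbTE spf).
have -> : Bi b (ineg a) = 0 by rewrite BiE (inj_eq (can_inj (@inegK n))) eq_sym (negbTE ba).
have -> : Bi a (ineg b) = 0 by rewrite BiE (inj_eq (can_inj (@inegK n))) (negbTE ba).
rewrite mulr0 !scale0r subr0 sub0r (fam_sym hF a) e1 scaleN1r scalerN !mul1r opprD opprK addrC.
by rewrite (BiC a (ineg a)) (BiC b (ineg b)) e1 !mul1r opprK !BiE !eqxx /form_sg (negbTE spf).
Qed.

(** The four terms of the bracket coincide and B(c, -c) = - B(-c, c), whence the factor -1/4. *)
Lemma triple_sp c : sp -> lieb (F c c) (- 4^-1 *: F (ineg c) (ineg c)) = hop c.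
Proof.
move=> spt; rewrite liebZr (fam_br hF) /hop.
have e1 : eps = -1 by rewrite /form_eps spt.
rewrite (fam_sym hF c) (BiC c (ineg c)) e1 !mulN1r opprK scale1r !scaleNr !opprK; congr (- _).
rewrite -!scalerDl scalerA. congr (_ *: _).
by field.
Qed.

End Family.

Section Module.
Variables (V : nzmod C) (F : idx n -> idx n -> End V).
Hypothesis hF : fam F.
Hypothesis nilF : forall c d, d != ineg c -> locnilp (F c d).
Hypothesis n2 : sp || (2 <= n)%N.

Lemma sl2_o a b : ~~ sp -> b != a -> b != ineg a ->
  sl2 (F a b) (- F (ineg a) (ineg b)) (hop F a + hop F b).
Proof.
move=> spf ba bna.
have ww : wt a a + wt a b + (wt b a + wt b b) = 2.
  rewrite /wt !eqxx (eq_sym a b) (negbTE ba) (negbTE bna) (eq_sym a (ineg b)) ineg_eq (negbTE bna).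
  by rewrite (eq_sym a (ineg a)) (eq_sym b (ineg b)) !ineg_neq !subr0 addr0 add0r.
split; first exact: triple_o.
- by rewrite liebDl !(hop_root hF) -scalerDl ww.
- by rewrite liebDl !liebNr !(hop_root hF) -opprD -scalerDl !wtN -!opprD ww scalerN scaleNr.
- by apply: nilF.
- have : locnilp (F (ineg a) (ineg b)) by apply: nilF; rewrite inegK ineg_eq.
  by move/(locnilpZ (-1)); rewrite scaleN1r.
Qed.

Lemma sl2_sp c : sp -> sl2 (F c c) (- 4^-1 *: F (ineg c) (ineg c)) (hop F c).
Proof.
move=> spt; have ww : wt c c + wt c c = 2.
  by rewrite /wt eqxx eq_sym ineg_neq subr0.
split; first exact: triple_sp.
- by rewrite (hop_root hF) ww.
- by rewrite liebZr (hop_root hF) !wtN -opprD ww !scalerA !mulrN !mulNr opprK [2 * _]mulrC scaleNr opprK.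
- by apply: nilF; rewrite eq_sym ineg_neq.
- by apply/locnilpZ/nilF; rewrite eq_sym ineg_neq.
Qed.

Lemma other_index (a : idx n) : (2 <= n)%N -> exists2 b : idx n, b != a & b != ineg a.
Proof.
case: a => x i h.
have [j ji] : exists j : 'I_n, j != i.
  have h0 : (0 < n)%N by apply: ltnW.
  case: (eqVneq (val i) 0%N) => [e|ne]; first by exists (Ordinal h); rewrite -val_eqE /= e.
  by exists (Ordinal h0); rewrite -val_eqE /= eq_sym.
by exists (x, j); rewrite /ineg xpair_eqE (negbTE ji) andbF.
Qed.

Lemma weight_decomposition (S : V -> Prop) v :
  (forall u w, S u -> S w -> S (u + w)) -> (forall k u, S u -> S (k *: u)) ->
  (forall c d u, S u -> S (F c d u)) -> S v ->
  Spanp (fun w => S w /\ joint (hop F) w) v.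
Proof.
move=> sD sZ sF sv.
(* In the orthogonal case the triples of [sl2_o] give only sums h_c + h_b with b different from c
   and -c, and h_c is half of (h_c + h_b) + (h_c - h_b). This needs a second pair of indices, hence
   n >= 2; the excluded b get the operator 0. *)
pose hs (p : idx n * idx n) : End V := if sp then hop F p.1 else
  if (p.2 != p.1) && (p.2 != ineg p.1) then hop F p.1 + hop F p.2 else 0.
have hcm := hop_comm hF.
have cm p q : comm0 (hs p) (hs q).
  have h1 c : comm0 (hop F c) (hs q).
    rewrite /hs; case: ifP => _; first exact: hcm.
    by case: ifP => _; [apply: commrD; apply: hcm | apply: commr0].
  rewrite {1}/hs; case: ifP => _; first exact: h1.
  case: ifP => _; apply: commr_sym; last exact: commr0.
  by apply: commrD; apply: commr_sym; apply: h1.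
have dg p : diag (hs p).
  rewrite /hs; case: ifPn => [spt|spf]; first by apply: sl2_diag (sl2_sp _ spt).
  case: ifPn => [/andP [h1 h2]|_]; first by apply: sl2_diag (sl2_o spf h1 h2).
  by move=> w; apply: SpanG; exists 0; rewrite scale0r.
have s0 : S 0 by rewrite -(scale0r v); apply: sZ.
have sH c u : S u -> S (hop F c u) by move=> su; rewrite /hop endZE; apply/sZ/sF.
have sh p u : S u -> S (hs p u).
  move=> su; rewrite /hs; case: ifP => _; first exact: sH.
  case: ifP => _; first by rewrite endDE; apply: sD; apply: sH.
  by rewrite end0E.
apply: Span_sub (@joint_diag _ _ _ hs S v cm dg sD sZ sh sv) => w [sw jw]; apply: SpanG; split=> // c.
have [spt|spf] := boolP sp; first by have := jw (c, c); rewrite /hs spt.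
have [|b h1 h2] := @other_index c; first by move: n2; rewrite (negbTE spf).
have hs1 : hs (c, b) = hop F c + hop F b by rewrite /hs (negbTE spf) /= h1 h2.
have hs2 : hs (c, ineg b) = hop F c - hop F b.
  by rewrite /hs (negbTE spf) /= (inj_eq (can_inj (@inegK n))) ineg_eq h1 h2 (hopN hF).
have [k1] := jw (c, b); have [k2] := jw (c, ineg b); rewrite hs1 hs2 !endDE endNE => e2 e1.
exists (2^-1 * (k1 + k2)); rewrite -scalerA scalerDl -e1 -e2 addrACA subrr addr0 -mulr2n -scaler_nat.
by rewrite scalerA mulVf ?pnatr_eq0 // scale1r.
Qed.

Lemma fam_locfin c d : locfin (F c d).
Proof.
case: (eqVneq d (ineg c)) => [->|ne]; last by apply/locnilp_locfin/nilF.
apply: eig_locfin => v.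
apply: Span_sub (@weight_decomposition (fun _ => True) v (fun _ _ _ _ => I)
  (fun _ _ _ => I) (fun _ _ _ _ => I) I) => w [_ /(_ c) [k]].
rewrite /hop endZE => e; apply: SpanG; exists (Bi (ineg c) c * k).
by rewrite -scalerA -e scalerA sgB' scale1r.
Qed.

Lemma fam_finite v : exists (S : V -> Prop) (L : seq V), [/\ S v,
  forall u w, S u -> S w -> S (u + w), forall k u, S u -> S (k *: u),
  forall c d u, S u -> S (F c d u) & forall u, S u -> Spanp (inL L) u].
Proof.
pose y (a : 'I_#|{: idx n * idx n}|) := F (enum_val a).1 (enum_val a).2.
have yF c d : exists a, F c d = y a by exists (enum_rank (c, d)); rewrite /y enum_rankK.
have [|a|L HL] := @pbw_locfin _ _ _ y _ _ v.
- move=> a b; rewrite /y (fam_br hF).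
  have gen c d : Spanp (fun z => exists a, z = y a) (F c d) by apply/SpanG/yF.
  by apply: SpanB; [apply: SpanD; [apply: SpanB|]|]; apply/SpanZ/gen.
- exact: fam_locfin.
exists (fun u => exists2 z, algp y z & u = z v), L; split.
- by exists 1 => //; apply: alg_one.
- by move=> _ _ [z hz ->] [z' hz' ->]; exists (z + z') => //; apply: alg_add.
- by move=> k _ [z hz ->]; exists (k *: z) => //; apply: alg_scale.
- move=> c d _ [z hz ->]; exists (F c d * z) => //; apply: alg_mul => //.
  by have [a ->] := yF c d; apply: alg_gen.
- by move=> _ [z hz ->]; apply: HL.
Qed.

End Module.
End Weights.

(** * Bounded submodules *)

Section Projection.
Variable C : numClosedFieldType.
Variable V : nzmod C.

Lemma Span_support (P : V -> Prop) v : Spanp P v ->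
  exists l, (forall x, x \in l -> P x) /\ Spanp (inL l) v.
Proof.
elim=> [|c x w Px _ [l [h1 h2]]]; first by exists [::]; split=> //; apply: Span0.
exists (x :: l); split=> [y|]; first by rewrite inE => /orP [/eqP ->|/h1].
apply: SpanD; first by apply/SpanZ/SpanG; exact: mem_head.
by apply: Span_sub h2 => y yl; apply: SpanG; rewrite /inL inE yl orbT.
Qed.

Lemma Span_supports (P : V -> Prop) (b : seq V) : (forall x, x \in b -> Spanp P x) ->
  exists l, (forall x, x \in l -> P x) /\ forall x, x \in b -> Spanp (inL l) x.
Proof.
elim: b => [|v b IH] h; first by exists [::].
have [|l [h1 h2]] := IH; first by move=> x xb; apply: h; rewrite inE xb orbT.
have [l' [h3 h4]] := Span_support (h v (mem_head _ _)); exists (l' ++ l); split=> x.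
  by rewrite mem_cat => /orP [/h3|/h1].
rewrite inE => /orP [/eqP ->|/h2].
  by apply: Span_sub h4 => y yl; apply: SpanG; rewrite /inL mem_cat yl.
by apply: Span_sub => y yl; apply: SpanG; rewrite /inL mem_cat yl orbT.
Qed.

(** Split v into its part of eigenvalue mu and the rest. The rest is also an eigenvector for mu, and
    a product of factors h - c with c different from mu kills it, so it is 0. *)
Lemma weight_projection1 (P : V -> Prop) (h : End V) mu v :
  (forall x, P x -> exists c, h x = c *: x) -> Spanp P v -> h v = mu *: v ->
  Spanp (fun x => P x /\ h x = mu *: x) v.
Proof.
move=> hP; have split_v x : Spanp P x -> exists x1 x2, [/\ x = x1 + x2,
    Spanp (fun x => P x /\ h x = mu *: x) x1 & Spanp (fun x => exists2 c, c != mu & h x = c *: x) x2].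
  elim=> [|a y w Py _ [x1 [x2 [-> h1 h2]]]].
    by exists 0, 0; rewrite addr0; split=> //; apply: Span0.
  have [c hy] := hP y Py; have [e|ne] := eqVneq c mu.
    exists (a *: y + x1), x2; rewrite addrA; split=> //; apply: SpanC => //.
    by rewrite -e.
  exists x1, (a *: y + x2); rewrite addrCA; split=> //; apply: SpanC => //.
  by exists c.
move=> /split_v [x1 [x2 [-> h1 h2]]] hv.
have hx1 : h x1 = mu *: x1.
  apply: (@Span_min _ _ _ (fun x => h x = mu *: x) _ _ _ _ _ h1) => [|x y ex ey|c x ex|x []] //.
  - by rewrite efun0 scaler0.
  - by rewrite efunD ex ey scalerDr.
  - by rewrite efunZ ex !scalerA mulrC.
have hx2 : h x2 = mu *: x2.
  by move: hv; rewrite efunD hx1 scalerDr => /addrI.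
have [cs [_ csn]] := Span_eigop h2.
rewrite (eigop_eig _ hx2) => /eqP; rewrite scaler_eq0 => /orP [|/eqP -> //]; last by rewrite addr0.
rewrite prodf_seq_eq0 => /hasP [c /csn cmu]; by rewrite /= subr_eq0 eq_sym (negbTE cmu).
Qed.

Lemma weight_projection (I : finType) (P : V -> Prop) (hs : I -> End V) mu v :
  (forall x, P x -> joint hs x) -> Spanp P v -> (forall i, hs i v = mu i *: v) ->
  Spanp (fun x => P x /\ forall i, hs i x = mu i *: x) v.
Proof.
move=> hP vP hv; suff : Spanp (fun x => P x /\ forall i, i \in enum I -> hs i x = mu i *: x) v.
  by apply: Span_sub => x [Px h]; apply: SpanG; split=> // i; apply: h; rewrite mem_enum.
elim: (enum I) => [|i l IH]; first by apply: Span_sub vP => x Px; apply: SpanG.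
apply: (Span_sub (P := fun x => (P x /\ forall j, j \in l -> hs j x = mu j *: x) /\ hs i x = mu i *: x)).
  move=> x [[Px hx] ex]; apply: SpanG; split=> // j; rewrite inE => /orP [/eqP -> //|].
  exact: hx.
by apply: weight_projection1 => // x [Px _]; apply: hP.
Qed.

End Projection.

Section BoundedSubmodules.
Variable C : numClosedFieldType.
Variable sp : bool.
Local Notation eps := (form_eps C sp).
Variable n : nat.
Local Notation Bi := (Bi C sp).
Local Notation fam := (@fam C sp n _).
Local Notation hop := (hop sp).

Record bounded_sub (V : nzmod C) (T : idx n -> idx n -> End V) (S : V -> Prop) : Prop := BoundedSub {
  bs_D : forall u w, S u -> S w -> S (u + w);
  bs_Z : forall k u, S u -> S (k *: u);
  bs_T : forall c d u, S u -> S (T c d u);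
  bs_wt : forall v, S v -> Spanp (fun w => S w /\ joint (hop T) w) v;
  bs_bd : exists d : nat, forall (mu : idx n -> C) (s : seq V),
    (forall w, w \in s -> S w /\ forall c, hop T c w = mu c *: w) -> indep s -> (size s <= d)%N }.

Lemma fam_bounded_sub (V : nzmod C) (T : idx n -> idx n -> End V) :
  fam T -> (forall c d, d != ineg c -> locnilp (T c d)) -> sp || (2 <= n)%N ->
  forall v, exists S, [/\ bounded_sub T S, S v & exists L, forall u, S u -> Spanp (inL L) u].
Proof.
move=> fT nT n2 v; have [S [L [Sv SD SZ ST SL]]] := fam_finite fT nT n2 v.
exists S; split=> //; last by exists L.
split=> // [w Sw|]; first exact: (weight_decomposition fT).
by exists (size L) => mu s hs /indep_dim; apply=> u /hs [] /SL.
Qed.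

Lemma fam_om1 (A : algType C) (th : idx n -> A) : sp -> (forall k l, lieb (th k) (th l) = Bi k l *: 1) ->
  (forall k l p, lieb (om1 th k l) (th p) = Bi l p *: th k - (eps * Bi k p) *: th l) /\
  fam (om1 th).
Proof.
move=> spt htt; have epsN : eps = -1 by rewrite /form_eps spt.
have h k l p : lieb (om1 th k l) (th p) = Bi l p *: th k - (eps * Bi k p) *: th l.
  rewrite /om1 liebZl liebDl !liebMl !htt // epsN mulN1r scaleNr opprK.
  rewrite -!scalerAr -!scalerAl !mulr1 !mul1r.
  set x := _ *: th k; set y := _ *: th l.
  have -> : x + y + (y + x) = 2 *: (x + y) by rewrite scaler_nat mulr2n; ncr.
  by rewrite scalerA mulVf ?scale1r // pnatr_eq0.
split=> //; split=> [c d|a b c d].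
  by rewrite epsN opprK scale1r /om1 addrC.
rewrite {2}/om1 liebZr liebDr !liebMr !h epsN.
rewrite !mulN1r !scaleNr !opprK /om1 ![_ *: (2^-1 *: _)]scalerA ![_ / 2]mulrC -![(2^-1 * _) *: _]scalerA.
rewrite -!scalerDr; congr (_ *: _).
rewrite !mulrDr !mulrDl -!scalerAr -!scalerAl !scalerDr.
do ?[move: (_ *: (_ * _)) => ?].
by ncr.
Qed.

Lemma fam_diff (A : algType C) (P O : idx n -> idx n -> A) : fam P -> fam O ->
  (forall a b c d, comm0 (P a b - O a b) (O c d)) -> fam (fun c d => P c d - O c d).
Proof.
move=> fP fO cm; split=> [c d|a b c d].
  by rewrite (fam_sym fP) (fam_sym fO) scalerBr.
have -> : lieb (P a b - O a b) (P c d - O c d) = lieb (P a b) (P c d) - lieb (O a b) (O c d).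
  rewrite -{2}[P a b](subrK (O a b)) -{2}[P c d](subrK (O c d)).
  move/lieb0P: (cm a b c d) => h1; move/lieb0P/lieb_sym0: (cm c d a b) => h2.
  move: (P a b - O a b) (P c d - O c d) h1 h2 => x y h1 h2.
  by rewrite [in RHS]liebDl ![in RHS]liebDr h1 h2 addr0 add0r addrK.
rewrite (fam_br fP) (fam_br fO) !scalerBr.
do ?[move: (_ *: P _ _) => ?]; do ?[move: (_ *: O _ _) => ?].
by ncr.
Qed.

Lemma yw_perm (A : algType C) D (y : 'I_D -> A) u w : (forall a b, comm0 (y a) (y b)) ->
  perm_eq u w -> yw y u = yw y w.
Proof.
move=> cy; elim: u w => [|a u IH] w; first by rewrite perm_sym => /perm_nilP ->.
move=> pw; have aw : a \in w by rewrite -(perm_mem pw) mem_head.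
case/splitPr: aw pw => p q pw.
have pu : perm_eq u (p ++ q).
  by rewrite -(perm_cons a); apply: (perm_trans pw); rewrite -cat1s perm_catCA.
rewrite yw_cons (IH _ pu) !yw_cat yw_cons !mulrA; congr (_ * _).
elim: p {pw pu} => [|b p IHp]; first by rewrite /yw big_nil mulr1 mul1r.
by rewrite yw_cons mulrA (cy a b) -!mulrA IHp !mulrA.
Qed.

(** * Fock decomposition for the left-over symplectic row *)

Section Single.
Hypothesis spt : sp.
Variable V : nzmod C.
Variables (sig : idx n -> idx n -> End V) (th : idx n -> End V).
Hypothesis fsig : fam sig.
Hypothesis nsig : forall c d, d != ineg c -> locnilp (sig c d).
Hypothesis htt : forall k l, lieb (th k) (th l) = Bi k l *: 1.
Hypothesis hts : forall p k l, comm0 (th p) (sig k l).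
Hypothesis nilth : forall k : idx n, k.1 -> locnilp (th k).

Local Notation ann i := (th (true, i)).
Local Notation cre := (fun i => th (false, i)).

Definition vacuum f := forall i, ann i f = 0.

(** If p f is a sum of terms q^m g with p g = 0, the corresponding sum of q^(m+1) g / ((m + 1) k)
    has the same image under p, so f differs from it by a vector of ker p. Induction is on the power
    of p that kills f. *)
Lemma vac_split (S : V -> Prop) (p q : End V) k f : k != 0 -> lieb p q = k *: 1 -> locnilp p ->
  (forall u w, S u -> S w -> S (u + w)) -> (forall c u, S u -> S (c *: u)) ->
  (forall u, S u -> S (p u)) -> (forall u, S u -> S (q u)) -> S f ->
  Spanp (fun x => exists m g, [/\ S g, p g = 0 & x = (q ^+ m) g]) f.
Proof.
move=> k0 pq np sD sZ spp sq.
have pqm m g : p g = 0 -> p ((q ^+ m.+1) g) = (m.+1%:R * k) *: (q ^+ m) g.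
  have pqx x : p (q x) = q (p x) + k *: x.
    have := congr1 (fun z : End V => z x) pq; rewrite /= => <-.
    by rewrite addrC subrK.
  move=> pg; elim: m => [|m IH]; first by rewrite expr1 pqx pg efun0 add0r mul1r.
  by rewrite end_expS pqx IH efunZ -end_expS -scalerDl -[m.+2%:R]natr1 mulrDl mul1r.
have [m] := np f; elim: m f => [|m IH] f; first by rewrite expr0 end1E => -> _; apply: Span0.
rewrite end_expSr => /IH {}IH sf; have {}IH := IH (spp _ sf).
have [d h1 h2] : exists2 d, Spanp (fun x => exists m g, [/\ S g, p g = 0 & x = (q ^+ m) g]) d & p d = p f.
  elim: IH => [|a x w [m' [g [sg pg ->]]] _ [d h1 h2]].
    by exists 0; rewrite ?efun0 //; apply: Span0.
  exists ((a / (m'.+1%:R * k)) *: (q ^+ m'.+1) g + d).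
    by apply: SpanC => //; exists m'.+1, g.
  by rewrite efunP h2 pqm // scalerA divfK // mulf_neq0 ?pnatr_eq0.
have sdd : S d.
  apply: (@Span_min _ _ _ S _ sD sZ _ _ h1); first by rewrite -(scale0r f); apply: sZ.
  by move=> _ [m' [g [sg _ ->]]]; elim: m' => // m' IHm; rewrite end_expS; apply: sq.
rewrite -[f](subrK d); apply: SpanD => //; apply: SpanG; exists 0%N, (f - d); split=> //.
  by rewrite -scaleN1r; apply: sD => //; apply: sZ.
by rewrite efunB h2 subrr.
Qed.

(** [vac_split] is applied to one pair after another; its subspace [S] consists of the vectors
    killed by the annihilation operators already treated. *)
Lemma vac_span v : Spanp (fun x => exists w f, vacuum f /\ x = yw cre w f) v.
Proof.
have H j : (j <= n)%N -> Spanp (fun x => exists w f, (forall i : 'I_n, (i < j)%N -> ann i f = 0) /\ x = yw cre w f) v.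
  elim: j => [|j IH] jn.
    by apply: SpanG; exists [::], v; split=> //; rewrite /yw big_nil.
  apply: Span_sub (IH (ltnW jn)) => _ [w [f [hf ->]]].
  pose a := Ordinal jn.
  have := @vac_split (fun f => forall i : 'I_n, (i < j)%N -> ann i f = 0) (ann a) (th (false, a)) _ f _ (htt _ _) (nilth (k := (true, a)) isT).
  have -> : Bi (true, a) (false, a) = form_sg C sp (io (true, a)) by rewrite BiE eqxx.
  move=> H; have {}H := H (sg_neq0 _ _ _).
  have swap (i : 'I_n) (k : idx n) x : (i < j)%N -> k.2 = a -> ann i (th k x) = th k (ann i x).
    move=> ij ka; rewrite -!endME; congr (efun _ _); apply/lieb0P; rewrite htt BiE.
    case: eqP => [e|_]; last by rewrite scale0r.
    by move: ka; rewrite e /ineg /= => e'; move: ij; rewrite e' ltnn.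
  have {}H : Spanp (fun x => exists m g, [/\ (forall i : 'I_n, (i < j)%N -> ann i g = 0), ann a g = 0
       & x = (th (false, a) ^+ m) g]) f.
    apply: H => // [u x hu hx i ij|c u hu i ij|u hu i ij|u hu i ij].
    - by rewrite efunD hu ?hx ?addr0.
    - by rewrite efunZ hu ?scaler0.
    - by rewrite swap ?hu ?efun0.
    - by rewrite swap ?hu ?efun0.
  elim: H => [|c x u [m [g [h1 h2 ->]]] _ IHu]; first by rewrite efun0; apply: Span0.
  rewrite efunP; apply: SpanC => //; exists (w ++ nseq m a), g; split=> [i|].
    rewrite ltnS leq_eqVlt => /orP [/eqP e|]; last exact: h1.
    by have -> : i = a by apply: val_inj.
  rewrite yw_cat endME; congr (efun _ _); elim: m => [|m IHm]; first by rewrite /yw big_nil.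
  by rewrite end_expS IHm /= yw_cons endME.
apply: Span_sub (H n (leqnn _)) => x [w [f [hf ->]]]; apply: SpanG; exists w, f; split=> // i.
exact: hf.
Qed.

(* Weight vectors [yw cre w f] with the same [f] and the same weight have words [w] that
   are permutations of one another, so weight multiplicities are at most [size L]. *)
Definition tower (L : seq V) := Spanp (fun x => exists w f, f \in L /\ x = yw cre w f).

(** [sig] commutes with the row [th] and so preserves vacuum vectors. The vacuum vectors in a
    finite-dimensional [sig]-stable space around f are spanned by finitely many joint weight
    vectors, which supply [L]. *)
Lemma vac_tower v : exists L, [/\ forall f, f \in L -> vacuum f /\ joint (hop sig) f,
  forall f c d, f \in L -> Spanp (inL L) (sig c d f) & tower L v].
Proof.
elim: (vac_span v) => [|a x u [w [f [vf ->]]] _ [L [h1 h2 h3]]].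
  by exists [::]; split=> //; apply: Span0.
have n2 : sp || (2 <= n)%N by rewrite spt.
have [S [L0 [Sf SD SZ ST SL]]] := fam_finite fsig nsig n2 f.
pose S' y := S y /\ vacuum y.
have SD' y z : S' y -> S' z -> S' (y + z).
  by move=> [y1 y2] [z1 z2]; split; [exact: SD | move=> i; rewrite efunD y2 z2 addr0].
have SZ' c y : S' y -> S' (c *: y).
  by move=> [y1 y2]; split; [exact: SZ | move=> i; rewrite efunZ y2 scaler0].
have ST' c d y : S' y -> S' (sig c d y).
  move=> [y1 y2]; split; [exact: ST | move=> i].
  by rewrite -endME hts endME y2 efun0.
have [b [_ bS Sb]] := subspace_basis (S := S') (fun y (hy : S' y) => SL y hy.1).
have [y yb|L1 [g1 g2]] := @Span_supports _ _ (fun w => S' w /\ joint (hop sig) w) b.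
  by apply: (weight_decomposition fsig nsig n2 SD' SZ' ST'); apply: bS.
have Sspan y : S' y -> Spanp (inL L1) y by move=> /Sb; apply: Span_sub.
have sub1 y : Spanp (inL L1) y -> Spanp (inL (L1 ++ L)) y.
  by apply: Span_sub => z zl; apply: SpanG; rewrite /inL mem_cat zl.
have sub2 y : Spanp (inL L) y -> Spanp (inL (L1 ++ L)) y.
  by apply: Span_sub => z zl; apply: SpanG; rewrite /inL mem_cat zl orbT.
exists (L1 ++ L); split.
- by move=> y; rewrite mem_cat => /orP [/g1 [[]]|/h1].
- move=> y c d; rewrite mem_cat => /orP [/g1 [sy _]|/h2 hy]; last exact/sub2/hy.
  by apply/sub1/Sspan/ST'.
apply: SpanD; last first.
  by apply: Span_sub h3 => _ [w' [g [gL ->]]]; apply: SpanG; exists w', g; rewrite mem_cat gL orbT.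
apply: SpanZ; apply: (@Span_stab _ _ (inL L1)) (Sspan f _); last by split.
by move=> g gL; apply: SpanG; exists w, g; rewrite mem_cat gL.
Qed.

(** The zero-point weight of the oscillator representation: 1/2 for a positive index and -1/2 for a
    negative one. *)
Definition vacuum_weight (c : idx n) : C :=
  Bi (ineg c) c * (2^-1 * (if c.1 then Bi c (ineg c) else Bi (ineg c) c)).

Local Notation pi := (fun c d => sig c d + om1 th c d).

Lemma hop_th c a : lieb (hop pi c) (th a) = wt C c a *: th a.
Proof.
rewrite -(@hop_vec C sp n _ (om1 th) th c a); last by move=> p; apply: (fam_om1 spt htt).1.
rewrite /hop [LHS]liebZl [RHS]liebZl; congr (_ *: _).
rewrite liebDl [lieb (sig _ _) _](_ : _ = 0) ?add0r //.
by apply: lieb_sym0; apply/lieb0P; exact: hts.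
Qed.

Lemma hop_vacuum c f k : vacuum f -> hop sig c f = k *: f -> hop pi c f = (k + vacuum_weight c) *: f.
Proof.
move=> vf e; have -> : hop pi c f = hop sig c f + Bi (ineg c) c *: om1 th c (ineg c) f.
  by rewrite /hop !endZE endDE scalerDr.
rewrite e scalerDl /vacuum_weight -scalerA; congr (_ + _ *: _).
rewrite /om1 endZE endDE !endME -scalerA; congr (_ *: _).
have br p l : th p (th l f) = th l (th p f) + Bi p l *: f.
  have := congr1 (fun z : End V => z f) (htt p l); rewrite /= => <-.
  by rewrite addrC subrK.
case: c {e} => b i; rewrite /ineg; case: b => /=.
  by rewrite br vf efun0 add0r addr0.
by rewrite [X in _ + X]br vf efun0 !add0r.
Qed.

Definition word_weight (w : seq 'I_n) (c : idx n) : C := \sum_(i <- w) wt C c (false, i).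

Lemma hop_word w c f k : hop pi c f = k *: f ->
  hop pi c (yw cre w f) = (k + word_weight w c) *: yw cre w f.
Proof.
move=> e; rewrite /word_weight; elim: w => [|i w IH].
  by rewrite /yw !big_nil addr0 end1E.
rewrite big_cons yw_cons endME.
have -> : hop pi c (th (false, i) (yw cre w f)) =
    th (false, i) (hop pi c (yw cre w f)) + wt C c (false, i) *: th (false, i) (yw cre w f).
  rewrite -[X in _ + X](_ : lieb (hop pi c) (th (false, i)) (yw cre w f) = _); last by rewrite hop_th.
  by rewrite /lieb endBE !endME addrC subrK.
by rewrite IH efunZ -scalerDl addrAC -addrA.
Qed.

Lemma word_weight_count w j : word_weight w (false, j) = (count_mem j w)%:R.
Proof.
rewrite /word_weight; elim: w => [|i w IH]; first by rewrite big_nil.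
by rewrite big_cons IH /= natrD /wt /ineg !xpair_eqE /= subr0.
Qed.

Lemma bounded_tower L : (forall f, f \in L -> vacuum f /\ joint (hop sig) f) ->
  (forall f c d, f \in L -> Spanp (inL L) (sig c d f)) -> bounded_sub pi (tower L).
Proof.
move=> h1 h2; pose G x := exists w f, f \in L /\ x = yw cre w f.
have [mu Hmu] : exists mu : V -> idx n -> C, forall f, f \in L -> forall c, hop pi c f = mu f c *: f.
  have /choice [mu Hmu] : forall f, exists mu : idx n -> C, f \in L -> forall c, hop pi c f = mu c *: f.
    move=> f; case: (boolP (f \in L)) => [fL|_]; last by exists (fun _ => 0).
    have [vf /choice [k hk]] := h1 f fL.
    by exists (fun c => k c + vacuum_weight c) => _ c; apply: hop_vacuum.
  by exists mu.
have jG x : G x -> joint (hop pi) x.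
  move=> [w [f [fL ->]]] c; exists (mu f c + word_weight w c); apply: hop_word.
  exact: Hmu.
have th_st k u : tower L u -> tower L (th k u).
  apply: Span_stab => _ [w [f [fL ->]]]; case: k => [] [] i; last first.
    by apply: SpanG; exists (i :: w), f; rewrite yw_cons endME.
  elim: w => [|j w IH].
    by rewrite /yw big_nil end1E (h1 f fL).1; apply: Span0.
  rewrite yw_cons endME.
  have -> : ann i (th (false, j) (yw cre w f)) =
      th (false, j) (ann i (yw cre w f)) + Bi (true, i) (false, j) *: yw cre w f.
    have := congr1 (fun z : End V => z (yw cre w f)) (htt (true, i) (false, j)); rewrite /= => <-.
    by rewrite addrC subrK.
  apply: SpanD; last by apply/SpanZ/SpanG; exists w, f.
  apply: Span_stab IH => _ [w' [f' [fL' ->]]].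
  by apply: SpanG; exists (j :: w'), f'; rewrite yw_cons endME.
split.
- exact: SpanD.
- exact: SpanZ.
- move=> c d u hu; rewrite endDE; apply: SpanD; last first.
    by rewrite /om1 endZE endDE !endME; apply/SpanZ/SpanD; exact/th_st/th_st.
  apply: Span_stab hu => _ [w [f [fL ->]]].
  have -> : sig c d (yw cre w f) = yw cre w (sig c d f).
    rewrite -!endME; congr (efun _ _); apply/commr_prod => i _; apply: commr_sym; exact: hts.
  apply: (@Span_stab _ _ (inL L)) (h2 f c d fL) => g gL.
  by apply: SpanG; exists w, g.
- by move=> v; apply: Span_sub => x Gx; apply: SpanG; split; [exact: SpanG | exact: jG].
exists (size L) => nu s hs inds.
have cq a b : comm0 (th (false, a)) (th (false, b)) by apply/lieb0P; rewrite htt BiE xpair_eqE scale0r.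
(* For each f one word of the required weight is fixed, or the empty word if there is none. Any
   other such word is a permutation of it and gives the same operator, since creation operators
   commute. *)
have /choice [wf Hwf] : forall f, exists w, forall w', (forall c, mu f c + word_weight w' c = nu c) -> perm_eq w' w.
  move=> f; have [[w hw]|nex] := pselect (exists w, forall c, mu f c + word_weight w c = nu c); last first.
    by exists [::] => w' hw'; case: nex; exists w'.
  exists w => w' hw'; apply/allP => j _ /=; have := hw' (false, j); rewrite -(hw (false, j)) => /addrI.
  by rewrite !word_weight_count => /eqP; rewrite eqr_nat.
rewrite -(size_map (fun f => yw cre (wf f) f) L); apply: indep_dim inds _ => x /hs [tx ex].
apply: Span_sub (weight_projection jG tx ex) => _ [[w [f [fL ->]]] hw].
have [->|nz] := eqVneq (yw cre w f) 0; first exact: Span0.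
rewrite (@yw_perm _ _ _ w (wf f) cq); first by apply: SpanG; apply/mapP; exists f.
apply: Hwf => c; have := hw c; rewrite (hop_word _ (Hmu f fL c)) => /eqP.
by rewrite -subr_eq0 -scalerBl scaler_eq0 (negbTE nz) orbF subr_eq0 => /eqP.
Qed.

Lemma single_bounded_sub v : exists2 S, bounded_sub pi S & S v.
Proof.
have [L [h1 h2 h3]] := vac_tower v; exists (tower L) => //.
exact: bounded_tower.
Qed.

End Single.
End BoundedSubmodules.

(** * Assembling the final module *)

Section FinalModule.
Variable C : numClosedFieldType.
Variable sp : bool.
Local Notation eps := (form_eps C sp).
Variable n : nat.
Local Notation Bi := (Bi C sp).

Lemma locnilp_sum (V : nzmod C) (I : Type) (r : seq I) (f : I -> End V) :
  (forall i j, comm0 (f i) (f j)) -> (forall i, locnilp (f i)) -> locnilp (\sum_(i <- r) f i).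
Proof.
move=> cf nf; elim: r => [|i r IH]; first by rewrite big_nil => v; exists 1%N; rewrite expr1.
by rewrite big_cons; apply: locnilpD => //; apply: commr_sum => j _; exact: cf.
Qed.

(** For non-opposite c and d the two factors in each product of [om2] commute, so each product
    inherits the local nilpotence of its factor from [eta false]. *)
Lemma om2_nil r s (V : nzmod C) (rho : idx n -> idx n -> End V) (eta : bool -> 'I_r -> idx n -> End V)
   (th : 'I_s -> idx n -> End V) : datum sp rho eta th ->
  (forall j k, locnilp (eta false j k)) -> forall c d, d != ineg c ->
  locnilp (\sum_j om2 sp (eta true j) (eta false j) c d).
Proof.
move=> D nl c d cd.
have ww i j b b' k l : i != j -> comm0 (eta b i k) (eta b' j l) by exact: (dt_cross D).
have ss b j k l : comm0 (eta b j k) (eta b j l) by apply/lieb0P/(dt_same D).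
have ps j k l : l != ineg k -> comm0 (eta true j k) (eta false j l).
  by move=> h; apply/lieb0P; rewrite (dt_pair D) BiE (negbTE h) scale0r.
have cc (k : idx n) : k != ineg k by rewrite eq_sym ineg_neq.
have dc : c != ineg d by rewrite eq_sym ineg_eq.
have cm b j k l : l != ineg k -> comm0 (eta b j k) (eta (~~ b) j l).
  case: b => h; first exact: ps.
  by apply: commr_sym; apply: ps; rewrite eq_sym ineg_eq.
have cmx b b' j k l : l != ineg k -> comm0 (eta b j k) (eta b' j l).
  by move=> h; case: b; case: b'; [exact: ss | exact: (cm true) | exact: (cm false) | exact: ss].
apply: locnilp_sum => [i j|j].
  have [<- //|ij] := eqVneq i j.
  by apply: om2_comm; apply: commr_sym; apply: om2_comm; apply: ww; rewrite eq_sym.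
rewrite /om2 -scaleNr; apply: locnilpD.
- rewrite /comm0 -scalerAl -scalerAr; congr (_ *: _).
  by apply: commrM; apply: commr_sym; apply: commrM; apply: cmx.
- rewrite (cmx true false j d c) //; apply: locnilpM => //; exact: cmx.
- apply: locnilpZ; rewrite (cmx true false j c d) //; apply: locnilpM => //; exact: cmx.
Qed.

(** If 2n pairs were found, no local nilpotence is available for [rho], and [infinite_corr] discards
    it. Otherwise its root operators are locally nilpotent, hence so are those of [sig], the total
    operator without the left-over row. *)
Theorem final_module (V0 : nzmod C) (F0 : int -> int -> End V0) :
  gfam sp (Dm 0) F0 -> dich 0 F0 -> sp || (2 <= n)%N ->
  exists (V : nzmod C) (T : idx n -> idx n -> End V) Rl,
  [/\ corr Rl, forall c d : idx n, Rl (F0 (io c) (io d)) (T c d), fam sp T &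
   forall v, exists S, [/\ bounded_sub sp T S, S v & sp \/ exists L, forall u, S u -> Spanp (inL L) u]].
Proof.
move=> g0 d0 n2; have [r [s [V [rho [eta [th [R1 [c1 D h1 sle alt]]]]]]]] := reduction n g0 d0.
have s1 : (s <= 1)%N by apply: leq_trans sle _; case: (sp).
have [V' [rho' [eta' [th' [R2 [c2 D' h2 nr [ne nt]]]]]]] := datum_transfer s1 D.
have f0 : fam sp (fun c d : idx n => F0 (io c) (io d)).
  have hD (c : idx n) : Dm 0 (io c) by rewrite /Dm absz_gt0 io_neq0.
  by case: g0 => g1 g2; split=> [c d|a b c d]; [exact: g1 | exact: g2].
have c12 := corr_comp c1 c2.
have h12 (c d : idx n) : exists2 z, R1 (F0 (io c) (io d)) z & R2 z (totop sp rho' eta' th' c d).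
  by exists (totop sp rho eta th c d).
have fT := fam_corr c12 h12 f0.
case: alt => [nrho|[s0 nr2]]; last first.
  move: s0 th th' D D' h1 h2 nt c12 h12 fT => -> th th' D D' h1 h2 nt c12 h12 fT.
  have [R3 c3 h3] := infinite_corr D' nr2 fT.
  exists V', (omsum sp eta'), (fun a d => exists2 b, (exists2 z, R1 a z & R2 z b) & R3 b d); split.
  - exact: (corr_comp c12 c3).
  - by move=> c d; exists (totop sp rho' eta' th' c d).
  - exact: (fam_om D' fT).
  move=> v; have [S [S1 S2 S3]] := fam_bounded_sub (fam_om D' fT) (om2_nil D' ne) n2 v.
  by exists S; split=> //; right.
exists V', (totop sp rho' eta' th'), (fun a b => exists2 z, R1 a z & R2 z b); split=> //.
pose sig c d := rho' c d + \sum_j om2 sp (eta' true j) (eta' false j) c d.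
have nsig (c d : idx n) : d != ineg c -> locnilp (sig c d).
  move=> cd; apply: locnilpD; last 2 first.
  - by apply/nr/nrho.
  - exact: (om2_nil D' ne).
  by apply: commr_sum => j _; apply: om2_comm; apply: commr_sym; apply: (dt_comm D').
case: s th th' D D' h1 h2 nt c12 h12 fT sle s1 => [|[|//]] th th' D D' h1 h2 nt c12 h12 fT sle s1.
  have e c d : totop sp rho' eta' th' c d = sig c d by rewrite /totop big_ord0 addr0.
  have nT c d : d != ineg c -> locnilp (totop sp rho' eta' th' c d) by move=> cd; rewrite e; apply: nsig.
  move=> v; have [S [S1 S2 S3]] := fam_bounded_sub fT nT n2 v.
  by exists S; split=> //; right.
have spt : sp by move: sle; case: (sp).
have htt k l : lieb (th' ord0 k) (th' ord0 l) = Bi k l *: 1 by apply: (dt_th D').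
have hts p c d : comm0 (th' ord0 p) (sig c d).
  apply: commrD; first exact: (dt_th_rho D').
  by apply: commr_sum => j _; apply: om2_comm; apply: (dt_th_eta D').
have e : totop sp rho' eta' th' = fun c d => sig c d + om1 (th' ord0) c d.
  by apply/funext => c; apply/funext => d; rewrite /totop big_ord1.
have fsig : fam sp sig.
  have e' : sig = fun c d => totop sp rho' eta' th' c d - om1 (th' ord0) c d.
    by apply/funext => c; apply/funext => d; rewrite e addrK.
  rewrite e'; apply: (fam_diff fT (fam_om1 spt htt).2) => a b c d.
  rewrite e addrK /comm0 /om1 -scalerAl -scalerAr; congr (_ *: _).
  by apply: commrD; apply: commrM; apply/commr_sym/hts.
move=> v; have [S S1 S2] := single_bounded_sub spt fsig nsig htt hts (nt ord0) v.
by exists S; split=> //; [rewrite e | left].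
Qed.

End FinalModule.

(** * Matrices and formal expressions *)

Section Matrices.
Variable R : realType.
Local Notation C := (R[i] : numClosedFieldType).
Local Notation gmat := (gmat R).

Definition isSp (k : kind) := if k is KSp then true else false.
Variable k : kind.
Local Notation sp := (isSp k).
Local Notation eps := (form_eps C sp).
Local Notation sg := (form_sg C sp).
Local Notation Bf := (form_B C sp).
Local Notation in_g := (@in_g R k).

Lemma fF_sg i : fF R k i = sg i.
Proof. by rewrite /form_sg; case: k => //=; case: ifP. Qed.

Definition in_range (m : nat) (i : int) : bool := (i != 0) && (absz i <= m)%N.
Lemma in_rangeN m i : in_range m (- i) = in_range m i.
Proof. by rewrite /in_range oppr_eq0 abszN. Qed.

Lemma in_g_supp m X i j : in_g m X -> ~~ (in_range m i && in_range m j) -> X i j = 0.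
Proof.
case=> h _ ne; apply/eqP; apply: contraTT ne => /h /and4P [h1 h2 h3 h4].
by rewrite negbK /in_range h1 h2 h3 h4.
Qed.
Lemma in_g_opp m X i j : in_g m X -> X (- j) (- i) = - (sg i * sg j) * X i j.
Proof.
case=> _ /(_ i (- j)); rewrite !fF_sg !opprK => /(congr1 (fun z => sg i * z)).
rewrite mulr0 mulrDr [sg i * (sg i * _)]mulrA sgK mul1r => /eqP.
by rewrite addrC addr_eq0 => /eqP ->; ring.
Qed.

Lemma in_gI m (X : gmat) : (forall i j, ~~ (in_range m i && in_range m j) -> X i j = 0) ->
  (forall i j, in_range m i -> in_range m j -> X (- j) (- i) = - (sg i * sg j) * X i j) -> in_g m X.
Proof.
move=> h1 h2; have h3 i j : X i j != 0 -> in_range m i && in_range m j.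
  by move=> ne; apply: contraNT ne => /h1 ->.
split=> [i j /h3 /andP [/andP [-> ->] /andP [-> ->]] //|i j].
rewrite !fF_sg; have [/andP [hi hj]|ne] := boolP (in_range m i && in_range m (- j)).
  have := h2 i (- j) hi hj; rewrite opprK => ->.
  have := sgK C sp i => e; ring: e.
have nj : ~~ (in_range m j && in_range m (- i)) by rewrite in_rangeN andbC -(in_rangeN m j).
by rewrite (h1 _ _ ne) (h1 _ _ nj) mul0r mulr0 addr0.
Qed.

Lemma in_g_le m m' X : (m <= m')%N -> in_g m X -> in_g m' X.
Proof.
move=> le [h1 h2]; split=> // i j /h1 /and4P [-> -> h3 h4].
by rewrite (leq_trans h3 le) (leq_trans h4 le).
Qed.

Lemma sum_range (N : nat) (f : int -> C) c : (absz c <= N)%N ->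
  \sum_(p < (N + N).+1) (p%:Z - N%:Z == c)%:R * f (p%:Z - N%:Z) = f c.
Proof.
move=> cN; have lt : (absz (c + N%:Z)%R < (N + N).+1)%N by lia.
have e : (Ordinal lt : nat)%:Z - N%:Z = c by rewrite /=; lia.
rewrite (bigD1 (Ordinal lt)) //= e eqxx mul1r big1 ?addr0 // => p pn.
case: eqP => [h|_]; last by rewrite mul0r.
by case/eqP: pn; apply: val_inj => /=; lia.
Qed.

Lemma sum_opp (N : nat) (f : int -> C) :
  \sum_(p < (N + N).+1) f (- (p%:Z - N%:Z)) = \sum_(p < (N + N).+1) f (p%:Z - N%:Z).
Proof.
rewrite [RHS](reindex_inj rev_ord_inj) /=; apply: eq_bigr => p _; congr f.
by have := ltn_ord p; lia.
Qed.

Lemma lie_in_g m N X Y : in_g m X -> in_g m Y -> in_g m (lie N X Y).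
Proof.
move=> hX hY; apply: in_gI => [i j ne|i j hi hj].
  rewrite /lie big1 // => p _; set q := _%:Z - N%:Z.
  have [/andP [hi hq]|nq] := boolP (in_range m i && in_range m q).
    have nj : ~~ (in_range m q && in_range m j) by move: ne; rewrite hi hq.
    by rewrite (in_g_supp hX nj) (in_g_supp hY nj) !mulr0 subrr.
  by rewrite (in_g_supp hX nq) (in_g_supp hY nq) !mul0r subrr.
(* Passing to the opposite summation index matches each product with its transpose under the
   form. *)
rewrite /lie -(sum_opp N (fun q => X (- j) q * Y q (- i) - Y (- j) q * X q (- i))) mulr_sumr.
apply: eq_bigr => p _; set q := _%:Z - N%:Z.
rewrite !(in_g_opp _ _ hX) !(in_g_opp _ _ hY).
have := sgK C sp q => e; ring: e.
Qed.

Definition Tm (a b : int) : gmat := fun i j => (i == a)%:R * Bf b j - eps * ((i == b)%:R * Bf a j).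

Lemma Tm_in_g m a b : in_range m a -> in_range m b -> in_g m (Tm a b).
Proof.
move=> ha hb; have hB c j : in_range m c -> ~~ in_range m j -> Bf c j = 0.
  by move=> hc hj; apply: Bf0; apply: contraNneq hj => ->; rewrite in_rangeN.
apply: in_gI => [i j|i j hi hj].
  rewrite /Tm negb_and => /orP [ni|nj]; last by rewrite !hB // !mulr0 subrr.
  have -> : (i == a) = false by apply: contraNF ni => /eqP ->.
  have -> : (i == b) = false by apply: contraNF ni => /eqP ->.
  by rewrite !mul0r mulr0 subrr.
have [i0 j0] : i != 0 /\ j != 0 by move: hi hj; rewrite /in_range => /andP [-> _] /andP [-> _].
have key u v : in_range m u -> in_range m v -> (- j == u)%:R * Bf v (- i) = sg i * sg j * eps * ((i == v)%:R * Bf u j).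
  move=> hu hv; rewrite /form_B eqr_opp [i == v]eq_sym; have -> : (- j == u) = (j == - u) by lia.
  have [->|] := eqVneq v i; last by rewrite !mul0r !mulr0.
  have [ej|] := eqVneq j (- u); rewrite ?mul0r ?mulr0 //.
  have u0 : u != 0 by case/andP: hu.
  rewrite ej sgN //; have := sgK C sp u => e1; have := epsK C sp => e2; ring: e1 e2.
by rewrite /Tm !key //; have := epsK C sp => e2; ring: e2.
Qed.

Lemma lie_Tm m a b c d i j : in_range m a -> in_range m b -> in_range m c -> in_range m d ->
  lie m (Tm a b) (Tm c d) i j = Bf b c * Tm a d i j - (eps * Bf a c) * Tm b d i j +
    Bf b d * Tm c a i j - (eps * Bf a d) * Tm c b i j.
Proof.
move=> ha hb hc hd.
have H u v w z : in_range m w -> in_range m z -> \sum_(p < (m + m).+1) Tm u v i (p%:Z - m%:Z) * Tm w z (p%:Z - m%:Z) j =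
    Tm u v i w * Bf z j - eps * (Tm u v i z * Bf w j).
  move=> /andP [_ hw] /andP [_ hz].
  rewrite -(sum_range (fun q => Tm u v i q * Bf z j) hw) -(sum_range (fun q => Tm u v i q * Bf w j) hz).
  rewrite mulr_sumr -sumrB; apply: eq_bigr => p _; rewrite {2}/Tm; ring.
rewrite /lie sumrB !H // /Tm.
have [[/andP [a0 _] /andP [b0 _]] [/andP [c0 _] /andP [d0 _]]] := ((ha, hb), (hc, hd)).
rewrite (BfC C sp d a0) (BfC C sp c a0) (BfC C sp d b0) (BfC C sp c b0).
have := epsK C sp => e2; ring: e2.
Qed.

Section Expansion.
Variable n : nat.

Lemma io_in_range (c : idx n) : in_range n (io c).
Proof. by rewrite /in_range io_neq0 /=; case: c => b i; have := ltn_ord i; rewrite /io; case: b => /=; lia. Qed.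

Lemma io_surj i : in_range n i -> exists c : idx n, i = io c.
Proof.
move=> /andP [i0 iN]; have lt : ((absz i).-1 < n)%N by lia.
by exists (i < 0, Ordinal lt); rewrite /io /=; case: ifP; lia.
Qed.

(** The factor 1/2 appears because the expansion runs over all ordered pairs, while T_dc = - eps
    T_cd. *)
Definition coef (X : gmat) (c d : idx n) : C := 2^-1 * (X (io c) (- io d) * sg (io d)).

Lemma expansion X : in_g n X -> forall i j, X i j = \sum_c \sum_d coef X c d * Tm (io c) (io d) i j.
Proof.
move=> hX i j; have [/andP [/io_surj [c ->] /io_surj [d ->]]|ne] := boolP (in_range n i && in_range n j); last first.
  rewrite (in_g_supp hX ne) big1 // => c _; rewrite big1 // => d _.
  by rewrite (in_g_supp (Tm_in_g (io_in_range c) (io_in_range d)) ne) mulr0.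
have e1 : \sum_c' \sum_d' coef X c' d' * ((io c == io c')%:R * Bf (io d') (io d)) = 2^-1 * X (io c) (io d).
  under eq_bigr => c' _ do under eq_bigr => d' _ do rewrite mulrCA.
  under eq_bigr => c' _ do rewrite -mulr_sumr.
  rewrite (bigD1 c) //= eqxx mul1r [X in _ + X]big1 ?addr0 => [|c' cc]; last first.
    by rewrite (inj_eq (@io_inj n)) eq_sym (negbTE cc) mul0r.
  rewrite (bigD1 (ineg d)) //= big1 ?addr0 => [|d' dd].
    rewrite /coef /form_B io_neg opprK eqxx -mulrA; congr (_ * _).
    by rewrite -mulrA sgK mulr1.
  rewrite /form_B; have -> : (io d == - io d') = false; last by rewrite mulr0.
  by rewrite -io_neg (inj_eq (@io_inj n)) eq_sym ineg_eq (negbTE (_ : d' != ineg d)).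
have e2 : \sum_c' \sum_d' coef X c' d' * ((io c == io d')%:R * Bf (io c') (io d)) = - eps * (2^-1 * X (io c) (io d)).
  rewrite exchange_big /=.
  under eq_bigr => c' _ do under eq_bigr => d' _ do rewrite mulrCA.
  under eq_bigr => c' _ do rewrite -mulr_sumr.
  rewrite (bigD1 c) //= eqxx mul1r [X in _ + X]big1 ?addr0 => [|c' cc]; last first.
    by rewrite (inj_eq (@io_inj n)) eq_sym (negbTE cc) mul0r.
  rewrite (bigD1 (ineg d)) //= big1 ?addr0 => [|d' dd].
    rewrite /coef /form_B io_neg opprK eqxx (in_g_opp _ _ hX) sgN ?io_neq0 //.
    have := sgK C sp (io c) => h1; have := sgK C sp (io d) => h2; ring: h1 h2.
  rewrite /form_B; have -> : (io d == - io d') = false; last by rewrite mulr0.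
  by rewrite -io_neg (inj_eq (@io_inj n)) eq_sym ineg_eq (negbTE (_ : d' != ineg d)).
transitivity (2^-1 * X (io c) (io d) - eps * (- eps * (2^-1 * X (io c) (io d)))).
  by have := epsK C sp => h; field: h.
rewrite -{1}e1 -e2 mulr_sumr -sumrB; apply: eq_bigr => c' _.
by rewrite mulr_sumr -sumrB; apply: eq_bigr => d' _; rewrite /Tm; ring.
Qed.
End Expansion.
End Matrices.

Section Action.
Variable R : realType.
Local Notation C := (R[i] : numClosedFieldType).
Local Notation gmat := (gmat R).
Variable k : kind.
Local Notation sp := (isSp k).
Local Notation eps := (form_eps C sp).
Local Notation Bf := (form_B C sp).
Local Notation in_g := (@in_g R k).

Definition fx n (A : lmodType C) (F : idx n -> idx n -> A) (X : gmat) : A :=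
  \sum_c \sum_d coef k X c d *: F c d.

Lemma fx_lin n (A : lmodType C) (F : idx n -> idx n -> A) a X Y :
  fx F (gcomb a X Y) = a *: fx F X + fx F Y.
Proof.
rewrite /fx scaler_sumr -big_split; apply: eq_bigr => c _ /=.
rewrite scaler_sumr -big_split; apply: eq_bigr => d _ /=.
by rewrite scalerA -scalerDl; congr (_ *: _); rewrite /coef /gcomb; ring.
Qed.

Fixpoint uev (A : algType C) (phi : gmat -> A) (t : uterm R) : A :=
  match t with
  | UGen X => phi X
  | UScal c => c *: 1
  | UAdd s u => uev phi s + uev phi u
  | UMul s u => uev phi s * uev phi u
  end.

Lemma uev_eq (A : algType C) (phi psi : gmat -> A) m t :
  (forall X, in_g m X -> phi X = psi X) -> term_in k m t -> uev phi t = uev psi t.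
Proof.
move=> h; elim: t => [X|c|s IHs u IHu|s IHs u IHu] //=; first exact: h.
  by move=> [/IHs -> /IHu ->].
by move=> [/IHs -> /IHu ->].
Qed.

Lemma uev_corr (A A' : algType C) Rl (phi : gmat -> A) (psi : gmat -> A') t : corr Rl ->
  (forall X, Rl (phi X) (psi X)) -> Rl (uev phi t) (uev psi t).
Proof.
move=> HR h; elim: t => [X|c|s IHs u IHu|s IHs u IHu] /=; first exact: h.
- exact/(corrZ HR)/(corr1 HR).
- exact: (corrD HR).
- exact: (corrM HR).
Qed.

Lemma fx_corr n (A A' : algType C) Rl (F : idx n -> idx n -> A) (T : idx n -> idx n -> A') X :
  corr Rl -> (forall c d, Rl (F c d) (T c d)) -> Rl (fx F X) (fx T X).
Proof.
move=> HR h; apply: (corr_sum HR) => c _; apply: (corr_sum HR) => d _; exact: (corrZ HR).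
Qed.

Lemma term_in_le m m' t : (m <= m')%N -> @term_in R k m t -> term_in k m' t.
Proof.
move=> le; elim: t => [X|c|s IHs u IHu|s IHs u IHu] //=; first exact: in_g_le.
  by move=> [/IHs h /IHu h'].
by move=> [/IHs h /IHu h'].
Qed.

Lemma in_g0 m : in_g m (fun _ _ => 0).
Proof. by apply: in_gI => // i j _ _; rewrite mulr0. Qed.
Lemma in_g_comb m a X Y : in_g m X -> in_g m Y -> in_g m (gcomb a X Y).
Proof.
move=> hX hY; apply: in_gI => [i j ne|i j hi hj]; rewrite /gcomb.
  by rewrite (in_g_supp hX ne) (in_g_supp hY ne) mulr0 addr0.
by rewrite !(in_g_opp _ _ hX) !(in_g_opp _ _ hY); ring.
Qed.

Section Representation.
Variable M : ginf_rep R k.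

(** Linearity in the matrix is available inside a single g(2m) and for [gcomb] only. Finite sums are
    built from it, and the action of 0 vanishes by 0 = 1 * 0 + 0. *)
Lemma ract_sum m (I : eqType) (r : seq I) (c : I -> C) (Y : I -> gmat) v : (forall p, p \in r -> in_g m (Y p)) ->
  in_g m (fun i j => \sum_(p <- r) c p * Y p i j) /\
  @ract _ _ _ M (fun i j => \sum_(p <- r) c p * Y p i j) v = \sum_(p <- r) c p *: @ract _ _ _ M (Y p) v.
Proof.
elim: r => [|p r IH] h.
  have e : (fun i j => \sum_(p <- [::]) c p * Y p i j) = (fun _ _ => 0) :> gmat.
    by apply/funext => i; apply/funext => j; rewrite big_nil.
  rewrite e big_nil; split; first exact: in_g0.
  have := @ract_linX _ _ _ M m Logic.I 1 _ _ (in_g0 m) (in_g0 m) v.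
  have -> : gcomb 1 (fun _ _ : int => 0) (fun _ _ => 0) = (fun _ _ => 0) :> gmat.
    by apply/funext => i; apply/funext => j; rewrite /gcomb mul1r addr0.
  by rewrite scale1r => /eqP; rewrite -subr_eq subrr eq_sym => /eqP.
have [|h1 h2] := IH; first by move=> q qr; apply: h; rewrite inE qr orbT.
have e : (fun i j => \sum_(q <- p :: r) c q * Y q i j) = gcomb (c p) (Y p) (fun i j => \sum_(q <- r) c q * Y q i j).
  by apply/funext => i; apply/funext => j; rewrite big_cons.
have hp := h p (mem_head _ _); rewrite e; split; first exact: in_g_comb.
by rewrite (ract_linX (m := m)) // big_cons h2.
Qed.

Hypothesis simpleM : simple_rep M.

Definition modM : nzmod C := NzMod (proj1 simpleM).
Definition opX (X : gmat) : End modM := @MkEnd C modM (@ract _ _ _ M X) (@ract_linV _ _ _ M X).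
Definition FT (a b : int) : End modM := opX (Tm R k a b).

Lemma opX_fx n X : in_g n X -> opX X = fx (fun c d : idx n => FT (io c) (io d)) X.
Proof.
move=> hX; apply: end_ext => v; rewrite /fx pair_bigA /= end_sumE.
have [|_ e] := @ract_sum n _ (index_enum {: idx n * idx n}) (fun p => coef k X p.1 p.2)
   (fun p => Tm R k (io p.1) (io p.2)) v; first by move=> p _; apply: Tm_in_g; exact: io_in_range.
transitivity (@ract _ _ _ M X v) => //; rewrite -[RHS]e; congr (@ract _ _ _ M _ v).
by apply/funext => i; apply/funext => j; rewrite (expansion hX) pair_bigA.
Qed.

Lemma gfam_FT : gfam sp (Dm 0) FT.
Proof.
have rng (a : int) m : Dm 0 a -> (absz a <= m)%N -> in_range m a.
  by rewrite /Dm /in_range absz_gt0 => -> ->.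
split=> [a b Da Db|a b c d Da Db Dc Dd].
  pose m := maxn (absz a) (absz b).
  have ha : in_range m a by apply: rng => //; rewrite leq_maxl.
  have hb : in_range m b by apply: rng => //; rewrite leq_maxr.
  apply: end_ext => v; have [|_ e] := @ract_sum m _ [:: - eps] id (fun _ => Tm R k a b) v.
    by move=> p _; apply: Tm_in_g.
  rewrite big_seq1 in e; rewrite endZE -[RHS]e; congr (@ract _ _ _ M _ v).
  apply/funext => i; apply/funext => j; rewrite big_seq1 /Tm.
  have := epsK C sp => h; ring: h.
pose m := maxn (maxn (absz a) (absz b)) (maxn (absz c) (absz d)).
have ha : in_range m a by apply: rng => //; rewrite /m; lia.
have hb : in_range m b by apply: rng => //; rewrite /m; lia.
have hc : in_range m c by apply: rng => //; rewrite /m; lia.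
have hd : in_range m d by apply: rng => //; rewrite /m; lia.
apply: end_ext => v.
have [|_ e] := @ract_sum m _ [:: (Bf b c, (a, d)); (- (eps * Bf a c), (b, d)); (Bf b d, (c, a)); (- (eps * Bf a d), (c, b))]
    (fun p => p.1) (fun p => Tm R k p.2.1 p.2.2) v.
  by move=> p; rewrite !inE => /or4P [] /eqP -> /=; apply: Tm_in_g.
rewrite !big_cons big_nil /= addr0 !scaleNr in e.
transitivity (@ract _ _ _ M (lie m (Tm R k a b) (Tm R k c d)) v).
  by rewrite (ract_bracket (m := m)) //; apply: Tm_in_g.
rewrite !endDE !endNE !endZE -!addrA -[RHS]e; congr (@ract _ _ _ M _ v).
apply/funext => i; apply/funext => j.
by rewrite (@lie_Tm R k m a b c d i j ha hb hc hd) !big_cons big_nil /=; ring.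
Qed.

Lemma dich_FT : dich 0 FT.
Proof.
apply: (dich_simple gfam_FT) => S SD SZ ST nz; apply: (proj2 simpleM) => // n X v hX Sv.
have -> : @ract _ _ _ M X v = opX X v by [].
rewrite (opX_fx hX) /fx end_sumE.
have S0 : S 0 by rewrite -(scale0r v); apply: (SZ).
elim/big_rec: _ => // c x _ Sx; apply: (SD) => //; rewrite end_sumE.
elim/big_rec: _ => // d y _ Sy; apply: (SD) => //; rewrite endZE; apply: (SZ).
by apply: ST => //; rewrite /Dm absz_gt0 io_neq0.
Qed.

Lemma ueval_uev t v : @ueval _ _ _ M t v = uev opX t v.
Proof.
elim: t v => [X|c|s IHs u IHu|s IHs u IHu] v //=; first by rewrite IHs IHu.
by rewrite IHs IHu.
Qed.

(** All m <= n are treated together because the orthogonal construction needs n >= 2, whereas local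
    integrability also concerns g(0) and g(2). *)
Lemma model n : sp || (2 <= n)%N ->
  exists (V : nzmod C) (T : idx n -> idx n -> End V),
  [/\ fam sp T,
   forall m X Y, (m <= n)%N -> in_g m X -> in_g m Y -> fx T (lie m X Y) = lieb (fx T X) (fx T Y),
   forall m t, (m <= n)%N -> restr k m (Ann M) t <-> term_in k m t /\ uev (fx T) t = 0 &
   forall v, exists S, [/\ bounded_sub sp T S, S v & sp \/ exists L, forall u, S u -> Spanp (inL L) u]].
Proof.
move=> n2; have [V [T [Rl [HR hT fT hS]]]] := final_module gfam_FT dich_FT n2.
exists V, T; split=> // [m X Y mn hX hY|m t mn].
  have R1 := fx_corr (lie m X Y) HR hT; have R2 := corrL HR (fx_corr X HR hT) (fx_corr Y HR hT).
  apply/(corr_eq HR R1 R2).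
  have hX' := in_g_le mn hX; have hY' := in_g_le mn hY.
  rewrite -!opX_fx //; last exact: lie_in_g.
  by apply: end_ext => v; apply: (ract_bracket (m := m)).
have e : term_in k m t -> uev opX t = uev (fx (fun c d : idx n => FT (io c) (io d))) t.
  by move/(term_in_le mn); apply: uev_eq => X; exact: opX_fx.
have := uev_corr t HR (fun X => fx_corr X HR hT) => /(corr_eq0 HR) z.
split=> -[ht h]; split=> //.
  by apply/z; rewrite -e //; apply: end_ext => v; rewrite -ueval_uev h.
by move=> v; rewrite ueval_uev e //; move/z: h => ->.
Qed.

End Representation.
End Action.

(** * Matrices of operators on a finite-dimensional stable subspace *)

Section FiniteDimensional.
Variable C : numClosedFieldType.
Variables (V : nzmod C) (d : nat) (b : 'I_d.+1 -> V).
Hypothesis ind : forall c : 'I_d.+1 -> C, \sum_i c i *: b i = 0 -> forall i, c i = 0.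

Definition mx_of (a : End V) (A : 'M[C]_d.+1) := forall i, a (b i) = \sum_j A j i *: b j.

Lemma mx_of1 : mx_of 1 1.
Proof.
move=> i; rewrite (bigD1 i) //= big1 ?addr0 => [|j ji]; first by rewrite mxE eqxx scale1r.
by rewrite mxE (negbTE ji) scale0r.
Qed.
Lemma mx_ofD x y A B : mx_of x A -> mx_of y B -> mx_of (x + y) (A + B).
Proof.
move=> hx hy i; rewrite endDE hx hy -big_split; apply: eq_bigr => j _ /=.
by rewrite mxE scalerDl.
Qed.
Lemma mx_ofZ c x A : mx_of x A -> mx_of (c *: x) (c *: A).
Proof.
move=> hx i; rewrite endZE hx scaler_sumr; apply: eq_bigr => j _ /=.
by rewrite mxE scalerA.
Qed.
Lemma mx_ofM x y A B : mx_of x A -> mx_of y B -> mx_of (x * y) (A * B).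
Proof.
move=> hx hy i; rewrite endME hy efun_sum.
under eq_bigr => j _ do rewrite efunZ hx scaler_sumr.
rewrite exchange_big; apply: eq_bigr => j _ /=.
by rewrite mxE scaler_suml; apply: eq_bigr => l _; rewrite scalerA mulrC.
Qed.
Lemma mx_of_eq x A B : mx_of x A -> mx_of x B -> A = B.
Proof.
move=> hA hB; apply/matrixP => i j; apply/eqP; rewrite -subr_eq0.
have := @ind (fun l => A l j - B l j) _ i => -> //.
by under eq_bigr => l _ do rewrite scalerBl; rewrite sumrB -hA -hB subrr.
Qed.
Lemma mx_of_eq0 x A : mx_of x A -> A = 0 <-> forall i, x (b i) = 0.
Proof.
move=> hA; split=> [e i|h].
  by rewrite hA e big1 // => j _; rewrite mxE scale0r.
apply/matrixP => i j; rewrite mxE; apply: (@ind (fun l => A l j)).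
by rewrite -hA h.
Qed.
End FiniteDimensional.

Section Subspace.
Variable C : numClosedFieldType.
Variable V : lmodType C.
Record subspace := Subspace {
  ss :> V -> Prop;
  ss0 : ss 0;
  ssD : forall u v, ss u -> ss v -> ss (u + v);
  ssZ : forall k u, ss u -> ss (k *: u) }.

Variable S : subspace.
Definition ss_pred : {pred V} := fun v => `[< ss S v >].
Fact ss_closed : submod_closed ss_pred.
Proof.
split; first by apply/asboolP/ss0.
by move=> a u v /asboolP hu /asboolP hv; apply/asboolP/ssD => //; apply: ssZ.
Qed.
HB.instance Definition _ := GRing.isSubmodClosed.Build C V ss_pred ss_closed.
Record subty := Subty { ssval : V; ssvalP : ssval \in ss_pred }.
HB.instance Definition _ := [isSub for ssval].
HB.instance Definition _ := [Choice of subty by <:].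
HB.instance Definition _ := [SubChoice_isSubLmodule of subty by <:].
End Subspace.

(** * From stable subspaces to ideals and representations *)

Section Models.
Variable R : realType.
Local Notation C := (R[i] : numClosedFieldType).
Variable k : kind.
Local Notation sp := (isSp k).
Variables (n : nat) (V : nzmod C) (T : idx n -> idx n -> End V).
Hypothesis fT : fam sp T.
Hypothesis brT : forall m X Y, (m <= n)%N -> in_g k m X -> in_g k m Y ->
  fx k T (lie m X Y) = lieb (fx k T X) (fx k T Y).

(** The dimension is a successor so that the matrices form a nonzero algebra, as [falgType]
    demands. *)
Record fdrep := FdRep {
  fd_dim : nat;
  fd_b : 'I_fd_dim.+1 -> V;
  fd_T : idx n -> idx n -> 'M[C]_fd_dim.+1;
  fd_ind : forall c : 'I_fd_dim.+1 -> C, \sum_i c i *: fd_b i = 0 -> forall i, c i = 0;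
  fd_mx : forall c d, mx_of fd_b (T c d) (fd_T c d) }.

Arguments fd_b : clear implicits.
Arguments fd_T : clear implicits.

Lemma fd_fx (f : fdrep) X : mx_of (fd_b f) (fx k T X) (fx k (fd_T f) X).
Proof.
have z : mx_of (fd_b f) 0 0.
  by have := mx_ofZ 0 (mx_of1 (fd_b f)); rewrite !scale0r.
rewrite /fx; elim/big_rec2: _ => // c A x _ hx; apply: mx_ofD => //.
elim/big_rec2: _ => // d B y _ hy; apply: mx_ofD => //; apply: mx_ofZ; exact: fd_mx.
Qed.

Arguments fd_fx : clear implicits.

Lemma fd_bracket (f : fdrep) m X Y : (m <= n)%N -> in_g k m X -> in_g k m Y ->
  fx k (fd_T f) (lie m X Y) = fx k (fd_T f) X * fx k (fd_T f) Y - fx k (fd_T f) Y * fx k (fd_T f) X.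
Proof.
move=> mn hX hY; have h := fd_fx f (lie m X Y); rewrite (brT mn hX hY) in h.
apply: (mx_of_eq (@fd_ind f) h).
have hx := fd_fx f X; have hy := fd_fx f Y.
rewrite -scaleN1r /lieb -[- (_ * _)]scaleN1r.
by apply: mx_ofD; [|apply: mx_ofZ]; apply: mx_ofM.
Qed.

Definition fd_ideal m (mn : (m <= n)%N) (f : fdrep) : fin_codim_ideal R k m :=
  @FCI R k m _ (fx k (fd_T f)) (fun a X Y _ _ => fx_lin k (fd_T f) a X Y)
    (fun X Y => @fd_bracket f m X Y mn).

Lemma fd_idealP m (mn : (m <= n)%N) f t :
  in_ideal (fd_ideal mn f) t <-> forall i, uev (fx k T) t (fd_b f i) = 0.
Proof.
apply: (mx_of_eq0 (@fd_ind f)).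
elim: t => [X|c|s IHs u IHu|s IHs u IHu] /=; first exact: fd_fx.
- exact/mx_ofZ/mx_of1.
- exact: mx_ofD.
- exact: mx_ofM.
Qed.

Lemma fdrep_ex (S : V -> Prop) L v : (forall c d u, S u -> S (T c d u)) ->
  (forall u, S u -> Spanp (inL L) u) -> S v -> v != 0 ->
  exists (f : fdrep) (a : 'I_(fd_dim f).+1 -> C), v = \sum_i a i *: fd_b f i.
Proof.
move=> ST SL Sv v0; have [b [ib bS Sb]] := subspace_basis SL.
case: b ib bS Sb => [|x b] ib bS Sb.
  by have /Span_list [a] := Sb v Sv; rewrite big_ord0 => e; rewrite e eqxx in v0.
pose B (i : 'I_(size b).+1) := (x :: b)`_i.
have BS i : S (B i) by apply/bS/mem_nth.
have /choice [A HA] : forall c, exists A : idx n -> 'M[C]_((size b).+1), forall d, mx_of B (T c d) (A d).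
  move=> c; suff /choice [A HA] : forall d, exists A, mx_of B (T c d) A by exists A.
  move=> d; have /choice [a Ha] : forall i, exists a : 'I_(size b).+1 -> C, T c d (B i) = \sum_j a j *: B j.
    by move=> i; have /Span_list [a e] := Sb _ (ST c d _ (BS i)); exists a.
  exists (\matrix_(j, i) a i j) => i; rewrite Ha; apply: eq_bigr => j _; by rewrite mxE.
by have /Span_list [a e] := Sb v Sv; exists (@FdRep (size b) B A ib HA), a.
Qed.

Section Sub.
Variable S : subspace V.
Hypothesis bS : bounded_sub sp T S.

Lemma sub_fx X u : S u -> S (fx k T X u).
Proof.
move=> su; rewrite /fx end_sumE; elim/big_rec: _ => [|c x _ sx]; first exact: ss0.
apply: ssD => //; rewrite end_sumE; elim/big_rec: _ => [|d y _ sy]; first exact: ss0.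
by apply: ssD => //; rewrite endZE; apply/ssZ/(bs_T bS).
Qed.

Fact sub_act_subproof X (u : subty S) : fx k T X (val u) \in ss_pred S.
Proof. by apply/asboolP/sub_fx/asboolP/(valP u). Qed.
Definition sub_act X (u : subty S) : subty S := Subty (sub_act_subproof X u).

Lemma ssvalP_lin a (u w : subty S) : ssval (a *: u + w) = a *: ssval u + ssval w.
Proof. exact: (linearP val). Qed.
Lemma ssvalD (u w : subty S) : ssval (u + w) = ssval u + ssval w.
Proof. exact: (raddfD val). Qed.
Lemma ssvalZ a (u : subty S) : ssval (a *: u) = a *: ssval u.
Proof.
have e0 : ssval (0 : subty S) = 0 by exact: (raddf0 val).
by rewrite -[a *: u]addr0 ssvalP_lin e0 addr0.
Qed.
Lemma ssvalB (u w : subty S) : ssval (u - w) = ssval u - ssval w.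
Proof. exact: (raddfB val). Qed.

Definition sub_rep : gn_rep R k n.
Proof.
refine (@LieRep R k _ (subty S) sub_act _ _ _).
- move=> X a v w; apply: val_inj.
  change (fx k T X (ssval (a *: v + w)) = ssval (a *: sub_act X v + sub_act X w)).
  by rewrite !ssvalP_lin efunP.
- move=> m mn a X Y hX hY v; apply: val_inj.
  change (fx k T (gcomb a X Y) (ssval v) = ssval (a *: sub_act X v + sub_act Y v)).
  by rewrite ssvalP_lin fx_lin.
- move=> m mn X Y hX hY v; apply: val_inj.
  change (fx k T (lie m X Y) (ssval v) = ssval (sub_act X (sub_act Y v) - sub_act Y (sub_act X v))).
  by rewrite ssvalB (brT mn hX hY).
Defined.

Lemma sub_ueval t (u : subty S) : ssval (@ueval _ _ _ sub_rep t u) = uev (fx k T) t (ssval u).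
Proof.
elim: t u => [X|c|s IHs w IHw|s IHs w IHw] u //.
- rewrite [uev _ _]/= endDE -IHs -IHw; exact: ssvalD.
- by rewrite [uev _ _]/= endME -IHw -IHs.
Qed.

Lemma fx_diag H : in_h k n H -> fx k T H = \sum_c (2^-1 * H (io c) (io c)) *: hop sp T c.
Proof.
move=> [_ hd]; rewrite /fx; apply: eq_bigr => c _.
rewrite (bigD1 (ineg c)) //= big1 ?addr0 => [|d dc].
  by rewrite /coef /hop scalerA io_neg opprK BiE inegK eqxx io_neg mulrA.
rewrite /coef hd ?mul0r ?mulr0 ?scale0r //.
by rewrite -io_neg (inj_eq (@io_inj n)) eq_sym ineg_eq.
Qed.

(** Its image under [fx] is [hop c], so the value of a weight functional on it is the eigenvalue of
    [hop c] on nonzero weight vectors. *)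
Definition Ecart (c : idx n) : gmat R := fun i j =>
  if i == j then (i == io c)%:R - (i == - io c)%:R else 0.

Lemma Ecart_in_h c : in_h k n (Ecart c).
Proof.
split; last by move=> i j /negbTE ij; rewrite /Ecart ij.
apply: in_gI => [i j|i j _ _]; rewrite /Ecart ?eqr_opp ?(eq_sym j i); case: eqVneq => [->|] //.
- rewrite andbb => ni; have e1 : (j == io c) = false by apply: contraNF ni => /eqP ->; exact: io_in_range.
  have e2 : (j == - io c) = false by apply: contraNF ni => /eqP ->; rewrite in_rangeN; exact: io_in_range.
  by rewrite e1 e2 subrr.
- have e1 : (- j == io c) = (j == - io c) by lia.
  by rewrite e1 sgK mulN1r opprB.
- by rewrite mulr0.
Qed.

Lemma fx_Ecart c : fx k T (Ecart c) = hop sp T c.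
Proof.
rewrite (fx_diag (Ecart_in_h c)).
transitivity (\sum_(d : idx n) (2^-1 *: ((d == c)%:R *: hop sp T d) - 2^-1 *: ((d == ineg c)%:R *: hop sp T d))).
  apply: eq_bigr => d _; rewrite /Ecart eqxx -io_neg !(inj_eq (@io_inj n)).
  by rewrite -scalerBr -scalerBl scalerA.
have one (e : idx n) : \sum_(d : idx n) 2^-1 *: ((d == e)%:R *: hop sp T d) = 2^-1 *: hop sp T e.
  rewrite (bigD1 e) //= eqxx scale1r big1 ?addr0 // => d /negbTE ->.
  by rewrite scale0r scaler0.
rewrite sumrB !one (hopN fT) scalerN opprK -scalerDl.
by rewrite (_ : 2^-1 + 2^-1 = 1) ?scale1r // [RHS]splitr !mul1r.
Qed.

Lemma sub_weight_module : weight_module sub_rep.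
Proof.
move=> v; have := bs_wt bS (asboolP _ (valP v)).
suff H x : Spanp (fun w => S w /\ joint (hop sp T) w) x -> exists s : seq ((gmat R -> C) * subty S),
    (forall p, List.In p s -> @weight_vec _ _ _ sub_rep p.1 p.2) /\ x = ssval (\sum_(p <- s) p.2).
  by move=> /H [s [h1 h2]]; exists s; split=> //; apply: val_inj.
elim=> [|a w u [Sw jw] _ [s [h1 ->]]].
  by exists [::]; rewrite big_nil; split=> //; apply: esym; exact: (raddf0 val).
have /choice [mu hmu] := jw.
have Sw' : w \in ss_pred S by apply/asboolP.
(* A joint eigenvector with eigenvalues mu has this weight; the half compensates for summing over
   both c and its opposite. *)
exists ((fun H => \sum_c 2^-1 * H (io c) (io c) * mu c, a *: Subty Sw') :: s); split; last first.
  by rewrite big_cons [RHS]ssvalD ssvalZ.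
move=> p [<-|/h1 //] H hH /=; apply: val_inj.
change (fx k T H (ssval (a *: Subty Sw')) = ssval ((\sum_c 2^-1 * H (io c) (io c) * mu c) *: (a *: Subty Sw'))).
rewrite !ssvalZ /= (fx_diag hH) efunZ end_sumE scalerA mulrC -scalerA; congr (_ *: _).
by rewrite scaler_suml; apply: eq_bigr => c _; rewrite endZE hmu scalerA.
Qed.

Lemma In_mem (E : eqType) (x : E) s : List.In x s <-> x \in s.
Proof.
elim: s => [|y s IH] //=; rewrite inE; split=> [[->|/IH ->]|/orP [/eqP ->|/IH]]; rewrite ?eqxx ?orbT //.
  by left.
by right.
Qed.

Lemma sub_bounded_dims : bounded_dims sub_rep.
Proof.
have [d hd] := bs_bd bS; exists d => lam s hs ind.
rewrite -(size_map (@ssval _ _ S) s); apply: (hd (fun c => lam (Ecart c))).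
  move=> _ /mapP [u us ->]; split; first by apply/asboolP/(valP u).
  move=> c; have := hs u ((In_mem _ _).2 us) _ (Ecart_in_h c) => /(congr1 (@ssval _ _ S)).
  by rewrite ssvalZ /= fx_Ecart.
move=> c; rewrite -[X in forall i : 'I_X, _]/(size _).
have sz : size s = size [seq ssval i | i <- s] by rewrite size_map.
pose c' := mkseq (fun i => if insub i is Some j then c j else 0) (size s).
have c'E (i : 'I_(size s)) : c'`_i = c (cast_ord sz i).
  rewrite nth_mkseq //; case: insubP => [j _ ej|]; last first.
    by move/negP; case; rewrite size_map; exact: ltn_ord.
  by congr c; apply: val_inj.
move=> e i; have : c'`_(cast_ord (esym sz) i) = 0.
  apply: ind; first by rewrite size_mkseq.
  apply: val_inj; rewrite [RHS](raddf0 val) -e.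
  have -> : val (\sum_(j < size s) c'`_j *: s`_j) = \sum_(j < size s) c'`_j *: ssval s`_j.
    rewrite [LHS](raddf_sum val); apply: eq_bigr => j _; exact: ssvalZ.
  rewrite [RHS](reindex (cast_ord sz)) /=; last first.
    by exists (cast_ord (esym sz)) => j _; rewrite ?cast_ordK ?cast_ordKV.
  by apply: eq_bigr => j _; rewrite c'E (nth_map 0).
by rewrite c'E; congr (c _ = 0); apply: val_inj.
Qed.

End Sub.
End Models.

Section Main.
Variable R : realType.
Local Notation C := (R[i] : numClosedFieldType).

Lemma integrable_annihilator (M : ginf_rep R KO) : simple_rep M -> locally_integrable KO (Ann M).
Proof.
(* The model is taken for g(2n+4), where the condition on the number of indices holds, and is then
   restricted to g(2n). *)
move=> hM n; have n2 : isSp KO || (2 <= n.+2)%N by [].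
have [V [T [fT brT annT subT]]] := model hM n2.
have le : (n <= n.+2)%N by rewrite -addn2 leq_addr.
exists (fdrep T), (fd_ideal brT le) => t; rewrite (annT n t le).
split=> -[ht h]; split=> //.
  by move=> f; apply/fd_idealP => i; rewrite h.
apply: end_ext => v; have [v0|v0] := eqVneq v 0; first by rewrite v0 efun0.
have [S [S1 S2 [//|[L hL]]]] := subT v.
have [f [a ->]] := fdrep_ex (bs_T S1) hL S2 v0.
rewrite efun_sum big1 // => i _; rewrite efunZ.
by have /fd_idealP -> := h f; rewrite scaler0.
Qed.

Lemma bounded_annihilator (k : kind) (M : ginf_rep R k) : simple_rep M -> weakly_bounded k (Ann M).
Proof.
move=> hM n n2; have [|V [T [fT brT annT subT]]] := @model _ _ _ hM n; first by rewrite n2 orbT.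
(* All bounded stable subspaces serve as the family; every vector of the model lies in one of them,
   so their common annihilator is that of the model. *)
pose J := {S : subspace V | bounded_sub (isSp k) T S}.
exists J, (fun j : J => sub_rep brT (proj2_sig j)); split=> [j|t].
  by split; [apply: sub_weight_module | apply: sub_bounded_dims].
rewrite (annT n t (leqnn n)); split=> -[ht h]; split=> //.
  move=> j v; apply: val_inj.
  by rewrite [LHS]sub_ueval h; apply: esym; exact: (raddf0 val).
apply: end_ext => v; have [S [S1 S2 _]] := subT v.
have S0 : S 0 by rewrite -(scale0r v); apply: (bs_Z S1).
pose S' := Subspace S0 (bs_D S1) (bs_Z S1).
have vS : v \in ss_pred S' by apply/asboolP.
have := h (exist _ S' S1) (Subty vS) => /(congr1 (@ssval _ _ S')).
by rewrite sub_ueval => ->; exact: (raddf0 val).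
Qed.

End Main.

Theorem theorem3p11 (R : realType) :
  (forall (k : kind) (M : ginf_rep R k), simple_rep M -> weakly_bounded k (Ann M)) /\
  (forall M : ginf_rep R KO, simple_rep M -> locally_integrable KO (Ann M)).
Proof.
split=> [k M|M]; [exact: bounded_annihilator | exact: integrable_annihilator].
Qed.
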